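(* Let $p\ge1$, let $X:[0,1]\to G(V)$ be a geometric $p$-rough path, and let $U,W$ be Banach spaces. Suppose $\beta_1\in(X,E^U_X)$ is a slowly-varying one-form such that $\|\beta_1\|_{\theta_1}^{\omega_1}<\infty$ for a control $\omega_1$ and $\theta_1>1$. Denote $h_t:=\int_{r=0}^t\beta_1(X_r)\,dX_r$, $t\in[0,1]$, and $\|h\|_\infty:=\sup_{t\in[0,1]}\|h_t\|$. For $\varphi\in C^\gamma(U,W)$, $\gamma>p$, define $\beta\in(X,E^W_X)$ by $$\beta(X_t)(x):=\sum_{l=1}^{[p]}\frac1{l!}(D^l\varphi)(h_t)\Big(\textstyle\prod_{\le[p]}\big(\beta_1(X_t)^{\otimes l}\big)\Big)(x),\qquad x\in G(V).$$ Then with $\omega:=\omega_1+\|X\|^p_{p-var}$ (that is, $\omega(s,t)=\omega_1(s,t)+\|X\|^p_{p-var,[s,t]}$) and $\theta:=\min\big(\theta_1,\frac{\gamma}{p},\frac{[p]+1}{p}\big)$, $$\|\beta\|_\theta^\omega\le C_{p,\theta,\omega(0,1)}\,\|\varphi\|_{\gamma,\|h\|_\infty}\max\Big(\|\beta_1\|_{\theta_1}^{\omega_1},\big(\|\beta_1\|_{\theta_1}^{\omega_1}\big)^{[p]}\Big),$$ where $C_{p,\theta,\omega(0,1)}$ is a constant depending on $p,\theta,\omega(0,1)$, and $$\int_{r=0}^t\beta(X_r)\,dX_r=\varphi(h_t)-\varphi(h_0)\quad\text{for }t\in[0,1].$$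
   Context: $V$ is a Banach space whose tensor powers are equipped with admissible norms (permutations of factors are isometries and $\|v\otimes w\|\le\|v\|\|w\|$). Elements of the (completed) tensor algebra over $V$ are written $x=\sum_{k\ge0}x^k$ with $x^k=\pi_k(x)\in V^{\otimes k}$. For $\sigma\in S_N$, $\sigma\cdot(v_1\otimes\cdots\otimes v_N):=v_{\sigma1}\otimes\cdots\otimes v_{\sigma N}$, extended linearly. For $k_1,\dots,k_l\ge0$ with $N=k_1+\cdots+k_l$, let $\mathrm{Sh}(k_1,\dots,k_l)\subset S_N$ be the set of $\tau$ whose word $\tau(1)\cdots\tau(N)$ is a shuffle of the $l$ consecutive increasing blocks $1\cdots k_1$, $(k_1+1)\cdots(k_1+k_2)$, etc.; with $1_k$ the identity of $S_k$, one writes $1_{k_1}\ast'\cdots\ast'1_{k_l}:=\sum_{\tau\in\mathrm{Sh}(k_1,\dots,k_l)}\tau$. $G(V)$ is the group of group-like elements (algebraic exponentials of Lie series), i.e. the characters of the shuffle algebra: $x^0=1$ and $x^n\otimes x^m=\sum_{\tau\in\mathrm{Sh}(n,m)}\tau^{-1}\cdot x^{n+m}$ for all $n,m$. On $G(V)$, $d(a,b):=\max_{k\in\mathbb N,\,k\ge1}\|\pi_k(a^{-1}b)\|^{1/k}$. A control is a continuous super-additive function $\omega:\{(s,t):0\le s\le t\le1\}\to[0,\infty)$ vanishing on the diagonal. $X:[0,1]\to G(V)$ is a geometric $p$-rough path if there is a control $\omega$ with $\|X\|^p_{p-var,[s,t]}:=\sup_D\sum_k d(X_{t_k},X_{t_{k+1}})^p\le\omega(s,t)$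 for every $s\le t$, the supremum being over finite partitions $D=\{t_k\}$ of $[s,t]$. $X_{s,t}:=X_s^{-1}X_t$. $[p]:=\max\{n\in\mathbb N:n\le p\}$ and $\lfloor\gamma\rfloor:=\max\{n\in\mathbb N:n<\gamma\}$. For a Banach space $U$ and $a\in G(V)$, $E^U_a$ is the vector space of functions $\phi:G(V)\to U$ of the form $\phi(x)=\sum_{k=1}^{[p]}\phi^k(x^k)$ with $\phi^k\in L(V^{\otimes k},U)$ (continuous linear maps). $\|\phi\|_k:=\|\phi^k\|$ (operator norm), $\|\phi\|:=\max_{k=1,\dots,[p]}\|\phi\|_k$. For $b\in G(V)$, $(\phi)_b\in E^U_{ab}$ is $(\phi)_b(x):=\phi(bx)-\phi(b)$. $\beta\in(X,E^U_X)$ means that $\beta$ assigns to each $X_t$, $t\in[0,1]$, an element $\beta(X_t)\in E^U_{X_t}$. For a control $\omega$ and $\theta>1$, $$\|\beta\|_\theta^\omega:=\sup_{t\in[0,1]}\|\beta(X_t)\|+\max_{k=1,\dots,[p]}\sup_{0\le s<t\le1}\frac{\|\beta(X_t)-(\beta(X_s))_{X_{s,t}}\|_k}{\omega(s,t)^{\theta-k/p}}.$$ $\beta$ is a slowly-varying one-form if $\|\beta\|_\theta^\omega<\infty$ for some control $\omega$ and some $\theta>1$; then $\int_{r=0}^t\beta(X_r)\,dX_r:=\lim_{|D|\to0}\sum_k\beta(X_{t_k})(X_{t_k,t_{k+1}})$ over finite partitions $D=\{t_k\}$ of $[0,t]$, which exists. Truncated polynomial: for $\phi=\sum_{k=1}^{[p]}\phi^k\in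 E^U_{X_t}$ and $l=1,\dots,[p]$, $\prod_{\le[p]}(\phi^{\otimes l})\in E^{U^{\otimes l}}_{X_t}$ is $$x\mapsto\sum_{\substack{k_1+\cdots+k_l\le[p]\\ k_i=1,\dots,[p]}}(\phi^{k_1}\otimes\cdots\otimes\phi^{k_l})\Big((1_{k_1}\ast'\cdots\ast'1_{k_l})\cdot x^{k_1+\cdots+k_l}\Big),\qquad x\in G(V).$$ Derivatives $(D^l\varphi)(u)$ are regarded as linear maps from $U^{\otimes l}$ to $W$. $C^\gamma(U,W)$ is the set of $\varphi:U\to W$ that are $\lfloor\gamma\rfloor$-times Fréchet differentiable with $\lfloor\gamma\rfloor$th derivative $(\gamma-\lfloor\gamma\rfloor)$-Hölder, uniformly on any bounded set; that is, for each $R>0$, $$\|\varphi\|_{\gamma,R}:=\max_{k=0,1,\dots,\lfloor\gamma\rfloor}\|D^k\varphi\|_{\infty,R}+\|D^{\lfloor\gamma\rfloor}\varphi\|_{(\gamma-\lfloor\gamma\rfloor)\text{-Höl},R}<\infty,$$ with the uniform and Hölder norms taken on $\{u\in U:\|u\|\le R\}$.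
   Formalization: The power [p] of the norm of β₁ in the bound is replaced by [p]+1; permutations in the truncated polynomial act by their inverses; tensor products of continuous linear maps V^{⊗k}→U are assumed continuous with norm at most the product of the norms. *)

(* Defs.v *)
From HB Require Import structures.
From mathcomp Require Export all_boot all_order all_fingroup all_algebra.
From mathcomp Require Export all_classical all_reals all_analysis.

Set Implicit Arguments.
Unset Strict Implicit.
Unset Printing Implicit Defensive.

Export Order.TTheory GRing.Theory Num.Theory numFieldNormedType.Exports.

Global Open Scope classical_set_scope.
Global Open Scope ring_scope.

Definition clinear (R : realType) (A B : normedModType R) (f : A -> B) : Prop :=
  linear f /\ continuous f.

(* Only applied to continuous linear maps, for which the supremum is finite. *)
Definition opnorm (R : realType) (A B : normedModType R) (f : A -> B) : R :=
  sup [set `|f x| | x in [set x | `|x| <= 1]].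

Definition multilinear (R : realType) (V Z : lmodType R) (n : nat)
    (f : ('I_n -> V) -> Z) : Prop :=
  forall (v : 'I_n -> V) (i : 'I_n) (a : R) (x y : V),
    f [eta v with i |-> a *: x + y] =
    a *: f [eta v with i |-> x] + f [eta v with i |-> y].

Definition vcat (T : Type) (n m : nat) (v : 'I_n -> T) (w : 'I_m -> T)
    (i : 'I_(n + m)) : T :=
  match fintype.split i with inl a => v a | inr b => w b end.

(* [tpow n] is the completion of the algebraic tensor power of order [n] of
   [V] for some norm: [ptens v] is v_0 (x) ... (x) v_(n-1), the linear span of
   these elements has the universal property of the algebraic tensor power
   ([ptens_universal] says that every multilinear map factors through it) and
   is dense. The operations [tmul] and [tperm] are the unique continuous
   extensions of concatenation and of the action
   s . (v_0 (x) ... ) = v_(s 0) (x) ... ; the norms are admissible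
   ([tmul_norm], [tperm_norm]), and the powers of order 0 and 1 are isometric
   to [R] and [V]. *)
Record tensor_powers (R : realType) (V : completeNormedModType R) := TensorPowers {
  tpow :> nat -> completeNormedModType R ;
  ptens : forall n, ('I_n -> V) -> tpow n ;
  ptens_multilinear : forall n, multilinear (@ptens n) ;
  ptens_universal : forall n (Z : lmodType R) (f : ('I_n -> V) -> Z),
    multilinear f ->
    forall m (c : 'I_m -> R) (v : 'I_m -> 'I_n -> V),
      \sum_j c j *: ptens (v j) = 0 -> \sum_j c j *: f (v j) = 0 ;
  ptens_dense : forall n,
    closure [set x : tpow n | exists m (c : 'I_m -> R) (v : 'I_m -> 'I_n -> V),
      x = \sum_j c j *: ptens (v j)] = setT ;
  ptens0_norm : forall v : 'I_0 -> V, `|ptens v| = 1 ;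
  ptens1_norm : forall v : 'I_1 -> V, `|ptens v| = `|v ord0| ;
  tmul : forall n m, tpow n -> tpow m -> tpow (n + m) ;
  tmul_linearl : forall n m (y : tpow m), linear (fun x : tpow n => tmul x y) ;
  tmul_linearr : forall n m (x : tpow n), linear (fun y : tpow m => tmul x y) ;
  tmul_ptens : forall n m (v : 'I_n -> V) (w : 'I_m -> V),
    tmul (ptens v) (ptens w) = ptens (vcat v w) ;
  tmul_norm : forall n m (x : tpow n) (y : tpow m), `|tmul x y| <= `|x| * `|y| ;
  tperm : forall n, 'S_n -> tpow n -> tpow n ;
  tperm_linear : forall n (s : 'S_n), linear (tperm s) ;
  tperm_ptens : forall n (s : 'S_n) (v : 'I_n -> V),
    tperm s (ptens v) = ptens (fun i => v (s i)) ;
  tperm_norm : forall n (s : 'S_n) (x : tpow n), `|tperm s x| = `|x|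
}.

(* The letters 0 .. N-1 are cut into consecutive blocks, [b] giving the block
   of a letter. The word s(0) s(1) ... is a shuffle of the (increasing) blocks
   iff letters of a same block occur in increasing order, the position of the
   letter [i] in that word being s^-1 i. *)
Definition shuffles (N : nat) (I : eqType) (b : 'I_N -> I) : {set 'S_N} :=
  [set s : 'S_N | [forall i : 'I_N, forall j : 'I_N,
     ((i < j)%N && (b i == b j)) ==> ((s^-1)%g i < (s^-1)%g j)%N]].

Definition shuffles2 (n m : nat) : {set 'S_(n + m)} :=
  shuffles (fun i : 'I_(n + m) => (n <= i)%N).

Definition shufflesn (l : nat) (k : 'I_l -> nat) : {set 'S_(\sum_i k i)} :=
  shuffles (fun i : 'I_(\sum_i k i) => tagnat.sig1 i).

Section TensorSeries.
Variables (R : realType) (V : completeNormedModType R) (T : tensor_powers V).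

Definition tseries : Type := forall k, T k.

Definition tsone : tseries :=
  fun k => match k return T k with
           | 0%N => ptens T (fun _ : 'I_0 => 0)
           | k'.+1 => 0
           end.

Definition tsmul (a b : tseries) : tseries := fun n =>
  \sum_(i < n.+1) ecast k (T k) (subnKC (leq_ord i)) (tmul (a i) (b (n - i)%N)).

(* Neumann series of the inverse of a series whose component of order 0 is 1:
   the powers j > n of 1 - a do not contribute in order n. *)
Definition tsinv (a : tseries) : tseries := fun n =>
  \sum_(j < n.+1) iter j (tsmul (fun k => tsone k - a k)) tsone n.

Definition grouplike (x : tseries) : Prop :=
  x 0%N = tsone 0%N /\
  forall n m, tmul (x n) (x m) =
    \sum_(s in shuffles2 n m) tperm (s^-1)%g (x (n + m)%N).

Definition gdist (a b : tseries) : \bar R :=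
  ereal_sup [set (`|tsmul (tsinv a) b k| `^ (k%:R^-1))%:E | k in [set k | (0 < k)%N]].

Definition control (w : R -> R -> R) : Prop :=
  [/\ {within [set st : R * R | 0 <= st.1 /\ st.1 <= st.2 /\ st.2 <= 1],
        continuous (fun st : R * R => w st.1 st.2)},
      (forall s t, 0 <= s -> s <= t -> t <= 1 -> 0 <= w s t),
      (forall s, 0 <= s -> s <= 1 -> w s s = 0) &
      (forall s u t, 0 <= s -> s <= u -> u <= t -> t <= 1 ->
         w s u + w u t <= w s t)].

(* the p-th power of the p-variation *)
Definition pvarp (p : R) (X : R -> tseries) (s t : R) : \bar R :=
  ereal_sup [set (\sum_(0 <= i < size D)
      poweR (gdist (X (nth t (s :: D) i)) (X (nth t D i))) p)%E
    | D in [set D : seq R | itv_partition s t D]].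

Definition geometric_rough_path (p : R) (X : R -> tseries) : Prop :=
  (forall t, 0 <= t -> t <= 1 -> grouplike (X t)) /\
  exists2 w, control w &
    forall s t, 0 <= s -> s <= t -> t <= 1 -> (pvarp p X s t <= (w s t)%:E)%E.

Definition increment (X : R -> tseries) (s t : R) : tseries :=
  tsmul (tsinv (X s)) (X t).

Section OneForms.
Variable U : completeNormedModType R.

(* Functions on the group are functions on all series of which only the values
   at group-like elements matter; [n] is the integer part of p. *)
Definition is_coefs (n : nat) (c : forall k, T k -> U) (f : tseries -> U) : Prop :=
  (forall k, (1 <= k <= n)%N -> clinear (c k)) /\
  (forall x, grouplike x -> f x = \sum_(1 <= k < n.+1) c k (x k)).

(* Membership in E^U_a, the base point a playing no role. *)
Definition in_E (n : nat) (f : tseries -> U) : Prop := exists c, is_coefs n c f.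

(* The maps phi^1, ..., phi^n of an element of E^U_a. They are unique, the
   components x^k of group-like elements spanning a dense subspace. *)
Definition coefs (n : nat) (f : tseries -> U) : forall k, T k -> U :=
  xget (fun _ _ => 0) [set c | is_coefs n c f].
Arguments coefs n f k _ : clear implicits.

Definition normk (n k : nat) (f : tseries -> U) : \bar R :=
  if `[< in_E n f >] then (opnorm (coefs n f k))%:E else +oo%E.

Definition normE (n : nat) (f : tseries -> U) : \bar R :=
  \big[maxe/0%E]_(1 <= k < n.+1) normk n k f.

Definition shift (f : tseries -> U) (b : tseries) : tseries -> U :=
  fun x => f (tsmul b x) - f b.

(* [beta t] is the one-form attached to the point X_t. *)
Definition one_form (n : nat) (beta : R -> tseries -> U) : Prop :=
  forall t, 0 <= t -> t <= 1 -> in_E n (beta t).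

(* The quotient is taken in \bar R, where a / 0 is +oo for 0 < a and 0 / 0 is
   0: where w vanishes the numerator has to vanish. *)
Definition slow_norm (p : R) (X : R -> tseries) (w : R -> R -> R) (theta : R)
    (beta : R -> tseries -> U) : \bar R :=
  let n := Num.truncn p in
  let defect (st : R * R) (x : tseries) : U :=
    beta st.2 x - shift (beta st.1) (increment X st.1 st.2) x in
  let quot k (st : R * R) : \bar R :=
    (normk n k (defect st) / (w st.1 st.2 `^ (theta - k%:R / p))%:E)%E in
  adde (ereal_sup [set normE n (beta t) | t in [set t : R | 0 <= t <= 1]])
   (\big[maxe/0%E]_(1 <= k < n.+1)
     ereal_sup [set quot k st | st in
       [set st : R * R | [/\ 0 <= st.1, st.1 < st.2 & st.2 <= 1]]]).

Definition riemann_sum (X : R -> tseries) (beta : R -> tseries -> U) (t : R)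
    (D : seq R) : U :=
  \sum_(0 <= i < size D)
    beta (nth t (0 :: D) i) (increment X (nth t (0 :: D) i) (nth t D i)).

(* Partitions of [0, t], filtered by their mesh tending to 0. *)
Definition mesh_to0 (t : R) : set_system (seq R) :=
  filter_from [set d : R | 0 < d] (fun d => [set D : seq R |
    itv_partition 0 t D /\
    forall i, (i < size D)%N -> nth t D i - nth t (0 :: D) i < d]).

Definition rough_integral (X : R -> tseries) (beta : R -> tseries -> U) (t : R) : U :=
  lim (riemann_sum X beta t @ mesh_to0 t).

End OneForms.

End TensorSeries.
Arguments coefs {R V T U} n f k _.

Section TruncatedPolynomials.
Variables (R : realType) (V U : completeNormedModType R).
Variables (TV : tensor_powers V) (TU : tensor_powers U).

(* [F] is c_0 (x) ... (x) c_(l-1), a map on V^{(x) k_0 + ... + k_(l-1)};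
   [tagnat.Rank i j] is the position of the j-th letter of the i-th block. *)
Definition is_tensor_map (l : nat) (k : 'I_l -> nat) (c : forall i, TV (k i) -> U)
    (F : TV (\sum_i k i)%N -> TU l) : Prop :=
  clinear F /\
  forall v : 'I_(\sum_i k i)%N -> V,
    F (ptens TV v) =
    ptens TU (fun i => c i (ptens TV (fun j => v (tagnat.Rank i j)))).

Definition tensor_map (l : nat) (k : 'I_l -> nat) (c : forall i, TV (k i) -> U) :
    TV (\sum_i k i)%N -> TU l :=
  xget (fun _ => 0) [set F | is_tensor_map c F].

(* Tensor products of continuous linear maps are continuous linear maps of
   norm at most the product of the norms. Admissibility alone does not give
   this; it holds e.g. whenever V carries the projective tensor norms. *)
Definition tensor_compatible : Prop :=
  forall (l : nat) (k : 'I_l -> nat) (c : forall i, TV (k i) -> U),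
    (forall i, clinear (c i)) ->
    exists2 F, is_tensor_map c F & opnorm F <= \prod_i opnorm (c i).

(* The permutations act by their inverses, as in the shuffle identity defining
   [grouplike]: for group-like [x] the argument of the tensor map is
   x^{k_1} (x) ... (x) x^{k_l}, and [tpoly] is the part of order at most [n] of
   f(x)^{(x) l}. *)
Definition tpoly (n l : nat) (f : tseries TV -> U) (x : tseries TV) : TU l :=
  \sum_(k : {ffun 'I_l -> 'I_n.+1} |
        [forall i, (0 < k i)%N] && (\sum_i k i <= n)%N)
    tensor_map (fun i => coefs n f (k i))
      (\sum_(s in shufflesn (fun i => k i : nat))
         tperm (s^-1)%g (x (\sum_i k i)%N)).

End TruncatedPolynomials.

Section Derivatives.
Variables (R : realType) (U : completeNormedModType R) (TU : tensor_powers U).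
Variable W : completeNormedModType R.

(* [B], a continuous linear map on U^{(x) l+1}, is the Fréchet derivative at
   [u] of [A : U -> L(U^{(x) l}, W)], through e |-> B (e (x) _). *)
Definition is_frechet (l : nat) (A : U -> TU l -> W) (u : U) (B : TU l.+1 -> W) : Prop :=
  clinear B /\
  forall eps : R, 0 < eps -> \forall e \near (0 : U),
    opnorm (fun w : TU l =>
      A (u + e) w - A u w - B (tmul (ptens TU (fun _ : 'I_1 => e)) w))
    <= eps * `|e|.

Definition scalar_part (w : TU 0%N) : R :=
  xget 0 [set a : R | w = a *: ptens TU (fun _ : 'I_0 => 0)].

Fixpoint frechet (phi : U -> W) (l : nat) : U -> TU l -> W :=
  match l return U -> TU l -> W with
  | 0%N => fun u w => scalar_part w *: phi u
  | l'.+1 => fun u => xget (fun _ => 0) [set B | is_frechet (frechet phi (l:=l')) u B]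
  end.

Definition frechet_differentiable (phi : U -> W) (N : nat) : Prop :=
  forall l, (l < N)%N -> forall u, exists B, is_frechet (frechet phi (l:=l)) u B.

(* the largest natural number < g, for 0 < g *)
Definition floor_lt (g : R) : nat := `|Num.ceil g|%N.-1.

(* The quotient for u = v is 0 / 0 = 0 in \bar R. *)
Definition Cnorm (g : R) (phi : U -> W) (r : R) : \bar R :=
  let N := floor_lt g in
  let quot (u v : U) : \bar R :=
    ((opnorm (fun w => frechet phi (l:=N) u w - frechet phi (l:=N) v w))%R%:E
     / (`|u - v| `^ (g - N%:R))%R%:E)%E in
  adde (\big[maxe/0%E]_(0 <= k < N.+1)
     ereal_sup [set (opnorm (frechet phi (l:=k) u))%:E | u in [set u : U | `|u| <= r]])
   (ereal_sup [set quot uv.1 uv.2 | uv in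
       [set uv : U * U | `|uv.1| <= r /\ `|uv.2| <= r]]).

Definition Cclass (g : R) (phi : U -> W) : Prop :=
  frechet_differentiable phi (floor_lt g) /\
  forall r : R, 0 < r -> (Cnorm g phi r < +oo)%E.

End Derivatives.

Definition composed_form (R : realType) (V U W : completeNormedModType R)
    (TV : tensor_powers V) (TU : tensor_powers U) (n : nat)
    (phi : U -> W) (h : R -> U) (beta1 : R -> tseries TV -> U) :
    R -> tseries TV -> W :=
  fun t x => \sum_(1 <= l < n.+1)
    (l`!%:R)^-1 *: frechet phi (h t) (tpoly TU n l (beta1 t) x).

(* Main.v *)
(* Let mu(s,t) = beta_1(X_s)(X_{s,t}). Slow variation of beta_1 says that
   beta_1(X_s)(b x) - beta_1(X_s)(b) - beta_1(X_t)(x), with b = X_{s,t}, is small; at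
   x = X_{t,u} this is the defect of additivity of mu, and sewing gives
   |h_t - h_s - mu(s,t)| = O(omega^theta).

   On group-like x the shuffle identity turns the truncated polynomial of order l
   into the part of degree <= [p] of beta_1(X_t)(x)^{(x) l}, so that beta(X_t)(x) is,
   up to terms of degree > [p], the Taylor polynomial of phi at h_t applied to
   beta_1(X_t)(x). Comparing the Taylor polynomials at h_s and h_t, by Taylor's formula
   with Hoelder remainder, bounds both beta(X_t) - (beta(X_s))_{X_{s,t}} and
   phi(h_t) - phi(h_s) - beta(X_s)(X_{s,t}); the latter being O(omega^theta) with theta > 1,
   the Riemann sums of beta converge to phi(h_t) - phi(h_0).

   Functions on the group are measured by writing them as sum_J c_J(x^J) with
   |c_J| <= K / q^J, a condition stable under products; as the c_J are unique
   (group-like components span densely), K / q^J bounds the norms of the one-form. The scale q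
   stands for omega(s,t)^{1/p}. *)

(* Derivatives are linear maps on completed tensor powers, about which only products and
   permutations are known. Identities are therefore proved on pure tensors and extended by density.
   Symmetry of the derivatives has to be established as well: without it the Taylor polynomial at
   h_s, taken at a sum of two vectors, could not be expanded by the binomial formula.

   The scale q must be positive while omega(s,t) may vanish, so the estimates are made for every q >
   omega(s,t)^(1/p), and q then decreases to that value. Products of forms create degrees up to
   [p]^2, although the defect of the composed form has degree at most [p]; uniqueness of the c_J
   discards the excess.

   The exponent theta and the power of M, the norm of beta_1, have the following sources. Terms of
   degree > [p] give ([p]+1)/p. The Hoelder remainder has order (M q)^([p]+eta) with 0 < eta <= 1:
   the power of q gives gamma/p, and the power of M, which may exceed M^[p], is why the bound is
   max(M, M^([p]+1)). *)
From HB Require Import structures.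
From mathcomp Require Import ring lra zify.
Require Import Defs.
Set Implicit Arguments.
Unset Strict Implicit.
Unset Printing Implicit Defensive.

(* Identities of abelian groups by reflection: [ring] does not apply to the
   elements of a normed module. *)
Inductive zexpr := ZVar of nat | ZAdd of zexpr & zexpr | ZOpp of zexpr | ZZero.

Fixpoint zeval (V : zmodType) (env : seq V) (e : zexpr) : V :=
  match e with
  | ZVar i => nth 0 env i
  | ZAdd a b => zeval env a + zeval env b
  | ZOpp a => - zeval env a
  | ZZero => 0
  end.

Fixpoint zcoef (i : nat) (e : zexpr) : int :=
  match e with
  | ZVar j => (i == j)%:Z
  | ZAdd a b => zcoef i a + zcoef i b
  | ZOpp a => - zcoef i a
  | ZZero => 0
  end.

Lemma zevalE (V : zmodType) (env : seq V) e :
  zeval env e = \sum_(i < size env) nth 0 env i *~ zcoef i e.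
Proof.
elim: e => /= [j|a -> b ->|a ->|].
- have [jn|jn] := ltnP j (size env).
    rewrite (bigD1 (Ordinal jn)) //= eqxx mulr1z big1 ?addr0 // => i.
    by rewrite -val_eqE /= => /negPf ->; rewrite mulr0z.
  rewrite nth_default // big1 // => i _; rewrite (_ : (i == j :> nat) = false) ?mulr0z //.
  by apply/negbTE; rewrite neq_ltn (leq_trans (ltn_ord i) jn).
- by rewrite -big_split; apply: eq_bigr => i _; rewrite mulrzDr.
- by rewrite -sumrN; apply: eq_bigr => i _; rewrite mulrNz.
- by rewrite big1 // => i _; rewrite mulr0z.
Qed.

Lemma zeval_eq (V : zmodType) (env : seq V) a b :
  all (fun i => zcoef i a == zcoef i b) (iota 0 (size env)) -> zeval env a = zeval env b.
Proof.
move=> /allP h; rewrite !zevalE; apply: eq_bigr => i _; congr (_ *~ _).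
by apply/eqP/h; rewrite mem_iota add0n ltn_ord.
Qed.

(** Atoms are identified up to conversion, by type-checking [erefl]; this is why large terms are
    generalized before [zmod_eq] is called. *)
Ltac zmem x l :=
  lazymatch l with
  | nil => constr:(false)
  | ?y :: ?l' =>
    match constr:(tt) with
    | _ => let _ := constr:(erefl x : x = y) in constr:(true)
    | _ => zmem x l'
    end
  end.
Ltac zatoms l t :=
  lazymatch t with
  | (?a + ?b)%R => let l1 := zatoms l a in zatoms l1 b
  | (- ?a)%R => zatoms l a
  | 0%R => l
  | ?x => match zmem x l with true => l | false => constr:(x :: l) end
  end.
Ltac zindex x l :=
  lazymatch l with
  | ?y :: ?l' =>
    match constr:(tt) with
    | _ => let _ := constr:(erefl x : x = y) in constr:(0%N)
    | _ => let i := zindex x l' in constr:(i.+1)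
    end
  end.
Ltac zreify l t :=
  lazymatch t with
  | (?a + ?b)%R => let u := zreify l a in let v := zreify l b in constr:(ZAdd u v)
  | (- ?a)%R => let u := zreify l a in constr:(ZOpp u)
  | 0%R => constr:(ZZero)
  | ?x => let i := zindex x l in constr:(ZVar i)
  end.
Ltac zmod_eq :=
  lazymatch goal with
  | |- @eq ?V ?s ?t =>
    let l0 := constr:(@nil V) in
    let l1 := zatoms l0 s in let l2 := zatoms l1 t in
    let a := zreify l2 s in let b := zreify l2 t in
    apply: (@zeval_eq _ l2 a b); vm_compute; reflexivity
  end.

(** * Bounded linear maps *)

Section PlainLinear.
Variables (R : realType) (A B : lmodType R) (f : A -> B).
Hypothesis fL : linear f.

Lemma linearD' x y : f (x + y) = f x + f y.
Proof. by have := fL 1 x y; rewrite !scale1r. Qed.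

Lemma linear0' : f 0 = 0.
Proof. by apply: (addrI (f 0)); rewrite -linearD' !addr0. Qed.

Lemma linearZ' a x : f (a *: x) = a *: f x.
Proof. by have := fL a x 0; rewrite linear0' !addr0. Qed.

Lemma linearN' x : f (- x) = - f x.
Proof. by rewrite -scaleN1r linearZ' scaleN1r. Qed.

Lemma linearB' x y : f (x - y) = f x - f y.
Proof. by rewrite linearD' linearN'. Qed.

Lemma linear_sum' I (r : seq I) (Q : pred I) (F : I -> A) :
  f (\sum_(i <- r | Q i) F i) = \sum_(i <- r | Q i) f (F i).
Proof. by apply: (big_morph f linearD' linear0'). Qed.
End PlainLinear.

Section LinearClosure.
Variables (R : realType) (A B C : lmodType R).

Lemma linear_cst0 : linear (fun _ : A => 0 : B).
Proof. by move=> a x y; rewrite scaler0 addr0. Qed.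

Lemma linear_addf (f g : A -> B) : linear f -> linear g -> linear (fun x => f x + g x).
Proof. by move=> fL gL a x y; rewrite fL gL scalerDr addrACA. Qed.

Lemma linear_scalef (k : R) (f : A -> B) : linear f -> linear (fun x => k *: f x).
Proof. by move=> fL a x y; rewrite fL scalerDr !scalerA mulrC. Qed.

Lemma linear_compf (g : B -> C) (f : A -> B) : linear g -> linear f -> linear (fun x => g (f x)).
Proof. by move=> gL fL a x y; rewrite fL gL. Qed.
End LinearClosure.

Section BoundedLinear.
Variables (R : realType).
Implicit Types A B C : normedModType R.

(** Bounds are carried with explicit constants; [opnorm], a supremum, enters only where a one-form
    or a derivative is measured. *)
Definition linear_bounded A B (K : R) (f : A -> B) :=
  linear f /\ forall x, `|f x| <= K * `|x|.

Lemma linear_bounded_clinear A B K (f : A -> B) : linear_bounded K f -> clinear f.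
Proof.
move=> [fL fK]; split=> // x.
pose F : {linear A -> B} := HB.pack f (GRing.isLinear.Build _ _ _ _ f fL).
apply: (@bounded_linear_continuous R A B F).
apply/linear_boundedP; exists K; split=> [|r /ltW Kr y]; first exact: num_real.
by apply: le_trans (fK y) _; apply: ler_wpM2r.
Qed.

Lemma opnorm_le A B K (f : A -> B) : 0 <= K -> linear_bounded K f -> opnorm f <= K.
Proof.
move=> K0 [fL fK]; apply: ge_sup.
  by exists `|f 0|; exists 0 => //=; rewrite normr0.
move=> _ [x /= x1 <-]; apply: le_trans (fK x) _.
by rewrite -[leRHS]mulr1 ler_wpM2l.
Qed.

Lemma opnorm_has_sup A B (f : A -> B) : clinear f ->
  has_sup [set `|f x| | x in [set x | `|x| <= 1]].
Proof.
move=> [fL fC]; split.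
  by exists `|f 0|; exists 0 => //=; rewrite normr0.
pose F : {linear A -> B} := HB.pack f (GRing.isLinear.Build _ _ _ _ f fL).
have /linear_boundedP [M [Mr HM]] := @continuous_linear_bounded R A B 0 F (fC 0).
exists (`|M| + 1) => _ [x /= x1 <-].
have := HM (`|M| + 1); rewrite (le_lt_trans (ler_norm M)) ?ltrDl//.
move=> /(_ isT x) h; apply: le_trans h _.
by rewrite -[leRHS]mulr1 ler_wpM2l // addr_ge0.
Qed.

Lemma opnorm_ge0 A B (f : A -> B) : 0 <= opnorm f.
Proof.
rewrite /opnorm; set S := [set _ | _ in _].
(* The supremum of an unbounded set is 0 by convention, so linearity and continuity need not be
   assumed. *)
have [hS|/sup_out ->//] := pselect (has_sup S).
apply: (@le_trans _ _ `|f 0|) => //; apply: ub_le_sup; first exact: hS.2.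
by exists 0 => //=; rewrite normr0.
Qed.

Lemma clinear_linear_bounded A B (f : A -> B) : clinear f -> linear_bounded (opnorm f) f.
Proof.
move=> fC; have [fL _] := fC; split=> // x.
have [->|x0] := eqVneq x 0; first by rewrite (linear0' fL) !normr0 mulr0.
have nx : 0 < `|x| by rewrite normr_gt0.
rewrite -ler_pdivrMr //.
have -> : `|f x| / `|x| = `|f (`|x|^-1 *: x)|.
  by rewrite (linearZ' fL) normrZ ger0_norm ?invr_ge0// mulrC.
apply: ub_le_sup; first exact: (opnorm_has_sup fC).2.
by exists (`|x|^-1 *: x) => //=; rewrite normrZ normfV normr_id mulVf ?gt_eqF.
Qed.

Lemma linear_bounded_le A B K K' (f : A -> B) : K <= K' ->
  linear_bounded K f -> linear_bounded K' f.
Proof.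
move=> KK [fL fK]; split=> // x; apply: le_trans (fK x) _.
by apply: ler_wpM2r.
Qed.

Lemma linear_bounded0 A B : linear_bounded 0 (fun _ : A => 0 : B).
Proof. by split; [exact: linear_cst0|move=> x; rewrite normr0 mul0r]. Qed.

Lemma linear_boundedD A B K K' (f g : A -> B) :
  linear_bounded K f -> linear_bounded K' g -> linear_bounded (K + K') (fun x => f x + g x).
Proof.
move=> [fL fK] [gL gK]; split; first exact: linear_addf.
by move=> x; rewrite mulrDl; apply: le_trans (ler_normD _ _) _; apply: lerD.
Qed.

Lemma linear_boundedZ A B K (a : R) (f : A -> B) :
  linear_bounded K f -> linear_bounded (`|a| * K) (fun x => a *: f x).
Proof.
move=> [fL fK]; split; first exact: linear_scalef.
by move=> x; rewrite normrZ -mulrA ler_wpM2l.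
Qed.

Lemma linear_boundedN A B K (f : A -> B) :
  linear_bounded K f -> linear_bounded K (fun x => - f x).
Proof.
move=> [fL fK]; split; last by move=> x; rewrite normrN.
by move=> a x y; rewrite fL opprD scalerN.
Qed.

Lemma linear_boundedB A B K K' (f g : A -> B) :
  linear_bounded K f -> linear_bounded K' g -> linear_bounded (K + K') (fun x => f x - g x).
Proof. by move=> fK gK; apply: linear_boundedD => //; apply: linear_boundedN. Qed.

Lemma linear_bounded_sum A B I (r : seq I) (Q : pred I) (K : I -> R) (f : I -> A -> B) :
  (forall i, Q i -> linear_bounded (K i) (f i)) ->
  linear_bounded (\sum_(i <- r | Q i) K i) (fun x => \sum_(i <- r | Q i) f i x).
Proof.
move=> fK; split=> [a x y|x].
  rewrite scaler_sumr -big_split /=; apply: eq_bigr => i Qi.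
  by have [fL _] := fK i Qi; rewrite fL.
rewrite mulr_suml; apply: le_trans (ler_norm_sum _ _ _) _.
by apply: ler_sum => i Qi; have [_] := fK i Qi; apply.
Qed.

Lemma linear_bounded_comp A B C K K' (g : B -> C) (f : A -> B) : 0 <= K' ->
  linear_bounded K' g -> linear_bounded K f -> linear_bounded (K' * K) (fun x => g (f x)).
Proof.
move=> K0 [gL gK] [fL fK]; split; first exact: linear_compf.
by move=> x; rewrite -mulrA; apply: le_trans (gK _) _; rewrite ler_wpM2l.
Qed.

Lemma linear_bounded_exP A B (f : A -> B) : clinear f -> exists2 K, 0 <= K & linear_bounded K f.
Proof. by move=> fC; exists (opnorm f); [exact: opnorm_ge0|exact: clinear_linear_bounded]. Qed.

End BoundedLinear.

(** * Shuffles as words *)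

Section Splits.
Variable A : Type.

(** All ways of dealing the letters of a word, in order, to two words: the unshuffling coproduct on
    words. *)
Fixpoint splits (v : seq A) : seq (seq A * seq A) :=
  if v is x :: v' then
    [seq (x :: ab.1, ab.2) | ab <- splits v'] ++ [seq (ab.1, x :: ab.2) | ab <- splits v']
  else [:: ([::], [::])].

(** Splits of a concatenation are pairs of splits. This is the combinatorial core of the
    multiplicativity of the coproduct, [DelM]. *)
Lemma big_splits_cat (B : nmodType) (F : seq A -> seq A -> B) u v :
  \sum_(ab <- splits (u ++ v)) F ab.1 ab.2 =
  \sum_(ab <- splits u) \sum_(cd <- splits v) F (ab.1 ++ cd.1) (ab.2 ++ cd.2).
Proof.
elim: u F => [|x u IH] F /=; first by rewrite big_seq1.
rewrite !big_cat !big_map /=.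
by rewrite (IH (fun a b => F (x :: a) b)) (IH (fun a b => F a (x :: b))).
Qed.

Lemma splits_count n v :
  count (fun ab => size ab.1 == n) (splits v) = 'C(size v, n).
Proof.
elim: v n => [|x v IH] [|n] //=; rewrite count_cat !count_map /=.
  rewrite bin0 (eq_count (a2 := pred0)) // count_pred0 add0n -(bin0 (size v)) -IH.
  exact: eq_count.
by rewrite binS addnC -IH -(IH n); congr (_ + _)%N; apply: eq_count.
Qed.

End Splits.

Lemma splits_map A B (f : A -> B) v :
  splits (map f v) = [seq (map f ab.1, map f ab.2) | ab <- splits v].
Proof. by elim: v => //= x v ->; rewrite map_cat -!map_comp. Qed.

Lemma splits_perm (A : eqType) (v : seq A) ab :
  ab \in splits v -> perm_eq (ab.1 ++ ab.2) v.
Proof.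
elim: v ab => [|x v IH] ab /=; first by rewrite inE => /eqP->.
rewrite mem_cat => /orP[] /mapP[cd /IH h ->] /=; first by rewrite perm_cons.
by rewrite -cat1s perm_catCA perm_cons.
Qed.

Lemma splits_size A (v : seq A) : all (fun ab => size ab.1 + size ab.2 == size v)%N (splits v).
Proof.
elim: v => //= x v IH; rewrite all_cat !all_map; apply/andP; split;
  by apply: sub_all IH => ab /= /eqP <-; rewrite ?addnS.
Qed.

Lemma splits_uniq (A : eqType) (v : seq A) : uniq v -> uniq (splits v).
Proof.
elim: v => //= x v IH /andP[xv uv]; rewrite cat_uniq !map_inj_uniq ?IH//=.
- rewrite andbT; apply/hasPn => _ /mapP[ab abv ->]; apply/negP => /mapP[cd cdv [e1 e2]].
  move/splits_perm/perm_mem: abv => /(_ x); rewrite mem_cat e1 inE eqxx /= => h.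
  by rewrite -h in xv.
- by move=> [a b] [c d] [-> ->].
- by move=> [a b] [c d] [-> ->].
Qed.

(** Induction on [v]: its head is smaller than every other letter, so it heads whichever of the two
    increasing parts contains it. *)
Lemma splits_sortedP (v a b : seq nat) : sorted ltn v ->
  ((a, b) \in splits v) = [&& perm_eq (a ++ b) v, sorted ltn a & sorted ltn b].
Proof.
elim: v a b => [|x v IH] a b.
  move=> _; rewrite inE; apply/eqP/and3P => [[-> ->]//|[/perm_nilP]].
  by case: a b => [[]|].
move=> /= pxv; have sv : sorted ltn v by exact: path_sorted pxv.
have xmin : {in v, forall y, (x < y)%N}.
  by move=> y yv; have /allP := order_path_min ltn_trans pxv; exact.
have sub c d : (c, d) \in splits v -> {subset c <= v} /\ {subset d <= v}.
  move=> /splits_perm /= /perm_mem h; split => z zc; rewrite -h mem_cat zc ?orbT//.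
have pathx c : {subset c <= v} -> sorted ltn c -> path ltn x c.
  by move=> cv; rewrite (path_sortedE ltn_trans) => ->; rewrite andbT;
     apply/allP => y /cv /xmin.
rewrite mem_cat; apply/orP/and3P.
  case=> /mapP[[c d] cd [-> ->]]; have [s1 s2] := sub _ _ cd;
    move: (cd); rewrite IH//= => /and3P[p1 so1 so2]; split => //.
  - by rewrite /= perm_cons.
  - exact: pathx.
  - by rewrite -cat1s perm_catCA perm_cons.
  - exact: pathx.
have head c : x \in c -> sorted ltn c -> {subset c <= x :: v} -> exists c', c = x :: c'.
  case: c => // y c; rewrite inE => /orP[/eqP<- _ _|xc /=]; first by exists c.
  move=> pyc /(_ y); rewrite inE eqxx => /(_ isT); rewrite inE => /orP[/eqP->|/xmin xy].
    by exists c.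
  have /allP/(_ _ xc) := order_path_min ltn_trans pyc.
  by rewrite /= ltnNge ltnW.
move=> [pab sa sb]; have : x \in a ++ b by rewrite (perm_mem pab) inE eqxx.
have suba : {subset a <= x :: v} by move=> z za; rewrite -(perm_mem pab) mem_cat za.
have subb : {subset b <= x :: v} by move=> z zb; rewrite -(perm_mem pab) mem_cat zb orbT.
rewrite mem_cat => /orP[/head/(_ sa suba)|/head/(_ sb subb)] [c' ec]; [left|right].
  apply/mapP; exists (c', b); last by rewrite ec.
  move: pab sa; rewrite ec /= perm_cons => pab /path_sorted sa.
  by rewrite IH// pab sa sb.
apply/mapP; exists (a, c'); last by rewrite ec.
move: pab sb; rewrite ec /= -cat1s perm_catCA perm_cons => pab /path_sorted sb.
by rewrite IH// pab sa sb.
Qed.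

(** A shuffle is encoded by the positions of its letters, that is by the word of the inverse
    permutation: cut along the blocks, the positions increase in each piece. *)
Definition shuffle_words (ks : seq nat) : seq (seq nat) :=
  [seq r <- permutations (iota 0 (sumn ks)) | all (sorted ltn) (reshape ks r)].

Lemma mem_shuffle_words ks r : (r \in shuffle_words ks) =
  perm_eq r (iota 0 (sumn ks)) && all (sorted ltn) (reshape ks r).
Proof. by rewrite mem_filter mem_permutations andbC. Qed.

Lemma shuffle_words_uniq ks : uniq (shuffle_words ks).
Proof. by rewrite filter_uniq // permutations_uniq. Qed.

Lemma sorted_ltn_uniq (s : seq nat) : sorted ltn s -> uniq s.
Proof. by rewrite ltn_sorted_uniq_leq => /andP[]. Qed.

(** The first block occupies the positions [ab.1], which leaves the free positions [ab.2]. A shuffle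
    of the other blocks is numbered from 0 and hence read through [ab.2]. This recursion lets the
    shuffle identity of two factors be iterated. *)
Lemma shuffle_words_cons k ks : perm_eq (shuffle_words (k :: ks))
  [seq ab.1 ++ [seq nth 0%N ab.2 j | j <- r] | ab <- [seq ab <- splits (iota 0 (k + sumn ks)) | size ab.1 == k],
                                       r <- shuffle_words ks].
Proof.
have sN := iota_ltn_sorted 0 (k + sumn ks).
have szb ab : ab \in [seq ab <- splits (iota 0 (k + sumn ks)) | size ab.1 == k] ->
  [/\ size ab.1 = k, size ab.2 = sumn ks, uniq (ab.1 ++ ab.2) & perm_eq (ab.1 ++ ab.2) (iota 0 (k + sumn ks))].
  rewrite mem_filter => /andP[/eqP sa /splits_perm pab].
  have := perm_size pab; rewrite size_cat size_iota sa => /addnI sb; split=> //.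
  by rewrite (perm_uniq pab) iota_uniq.
have szr r : r \in shuffle_words ks ->
  [/\ perm_eq r (iota 0 (sumn ks)), size r = sumn ks & all (gtn (sumn ks)) r].
  rewrite mem_shuffle_words => /andP[pr _]; split=> //.
    by rewrite (perm_size pr) size_iota.
  by apply/allP => j; rewrite (perm_mem pr) mem_iota add0n.
apply: uniq_perm; first exact: shuffle_words_uniq.
  apply: allpairs_uniq.
  - by rewrite filter_uniq // splits_uniq // iota_uniq.
  - exact: shuffle_words_uniq.
  move=> _ _ /allpairsP [[[a b] r] /= [h1 h2 ->]] /allpairsP [[[c d] r'] /= [h3 h4 ->]] /=.
  have [/= sa sb uab pab] := szb _ h1; have [/= sc sd ucd pcd] := szb _ h3.
  have [pr sr /allP ar] := szr _ h2; have [pr' sr' /allP ar'] := szr _ h4.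
  move=> /eqP; rewrite eqseq_cat ?sa ?sc// => /andP[/eqP eac /eqP ebd].
  subst c.
  have sorted_b : sorted ltn b /\ sorted ltn d.
    by move: h1 h3; rewrite !mem_filter !splits_sortedP// => /and4P[_ _ _ ->] /and4P[_ _ _ ->].
  have ebd' : b = d.
    apply: (irr_sorted_eq ltn_trans ltnn) => //; try by case: sorted_b.
    move=> z; have := perm_mem pab z; rewrite -(perm_mem pcd) !mem_cat.
    case zb : (z \in b); case zd : (z \in d) => //; rewrite ?orbT ?orbF => // ha.
    - by move: uab; rewrite cat_uniq => /and3P[_ /hasPn/(_ z zb)]; rewrite /= -ha.
    - by move: ucd; rewrite cat_uniq => /and3P[_ /hasPn/(_ z zd)]; rewrite /= ha.
  subst d.
  suff -> : r = r' by [].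
  apply: (@eq_from_nth _ 0%N) => [|i]; first by rewrite sr sr'.
  move=> ir; have := congr1 (fun s => nth 0%N s i) ebd.
  rewrite !(nth_map 0%N) ?sr' -?sr// => /eqP.
  rewrite nth_uniq; first by move/eqP.
  - by rewrite sb; apply: ar; rewrite mem_nth.
  - by rewrite sb; apply: ar'; rewrite mem_nth // sr' -sr.
  - by move: uab; rewrite cat_uniq => /and3P[].
move=> w; rewrite mem_shuffle_words; apply/andP/allpairsPdep.
  move=> /= [pw /andP[s1 s2]].
  have sw : size w = (k + sumn ks)%N by rewrite (perm_size pw) size_iota.
  set a := take k w in s1; set c := drop k w in s2.
  have sa : size a = k by rewrite size_takel // sw leq_addr.
  have sc : size c = sumn ks by rewrite size_drop sw addKn.
  have uw : uniq w by rewrite (perm_uniq pw) iota_uniq.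
  (* The positions left free by the first block, in increasing order; the shuffle of the other
     blocks consists of the ranks in [b] of the entries of [c]. *)
  pose b := sort leq c.
  have pb : perm_eq b c by rewrite perm_sort.
  have uc : uniq c by rewrite drop_uniq.
  have sob : sorted ltn b.
    by rewrite ltn_sorted_uniq_leq sort_uniq uc sort_sorted //; exact: leq_total.
  have sb : size b = sumn ks by rewrite size_sort.
  exists (a, b), [seq index z b | z <- c]; split.
  - rewrite mem_filter /= sa eqxx splits_sortedP // s1 sob andbT /=.
    apply/andP; split=> //; apply: perm_trans pw.
    by rewrite -[w in perm_eq _ w](cat_take_drop k) perm_cat2l.
  - rewrite mem_shuffle_words; apply/andP; split.
      apply: (@perm_trans _ [seq index z b | z <- b]); first by rewrite perm_map // perm_sym.
      suff -> : [seq index z b | z <- b] = iota 0 (sumn ks) by [].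
      apply: (@eq_from_nth _ 0%N); rewrite size_map sb ?size_iota // => i ilt.
      rewrite (nth_map 0%N) ?sb// nth_iota // index_uniq ?sb//.
      exact: sorted_ltn_uniq.
    have {}s2 : all (sorted ltn) (reshape ks c) by [].
    rewrite -map_reshape all_map; apply/allP => e eks /=; have soe := allP s2 e eks.
    have sub : {subset e <= b}.
      move=> z ze; rewrite mem_sort; have : z \in flatten (reshape ks c) by apply/flattenP; exists e.
      by rewrite reshapeKr ?sc.
    rewrite sorted_map; apply: (sub_in_sorted (P := mem b)) soe; last exact/allP.
    move=> y z yb zb /= yz; rewrite ltnNge leq_eqVlt; apply/negP => /orP[/eqP|].
      by move=> /(congr1 (nth 0%N b)); rewrite !nth_index // => ezy; rewrite ezy ltnn in yz.
    move/(sorted_ltn_index ltn_trans sob _ _ zb yb) => zy.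
    by have := ltn_trans yz zy; rewrite ltnn.
  - rewrite /= -[w](cat_take_drop k) -/a -/c; congr (_ ++ _).
    rewrite -map_comp -[LHS]map_id; apply/eq_in_map => z zc /=.
    by rewrite nth_index // mem_sort.
move=> [[a b] [r [h1 h2 ->]]] /=; have [/= sa sb uab pab] := szb _ h1; have [pr sr /allP ar] := szr _ h2.
move: h1; rewrite mem_filter /= splits_sortedP// => /and4P[_ _ soa sob].
rewrite take_size_cat // drop_size_cat //.
split.
  apply: perm_trans pab; rewrite perm_cat2l.
  rewrite -[X in perm_eq _ X](mkseq_nth 0%N) /mkseq sb.
  exact: perm_map.
rewrite soa /= -map_reshape all_map.
move: h2; rewrite mem_shuffle_words => /andP[_ /allP s3]; apply/allP => e eks /=; have soe := s3 e eks.
have sub z : z \in e -> (z < size b)%N.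
  move=> ze; rewrite sb; apply: ar; have : z \in flatten (reshape ks r) by apply/flattenP; exists e.
  by rewrite reshapeKr ?sr.
rewrite sorted_map; apply: (sub_in_sorted (P := [pred z | (z < size b)%N])) soe; last exact/allP.
move=> y z /= yb zb yz; rewrite (sorted_ltn_nth ltn_trans) //.
Qed.

Section Words.
Variable N : nat.

(** Both the condition in [shuffles] and the action in the shuffle identity concern the inverse of
    the permutation, so the inverse is what is written as a word. *)
Definition inverse_word (s : 'S_N) : seq nat := [seq val ((s^-1)%g i) | i <- enum 'I_N].

Lemma nth_inverse_word (s : 'S_N) (i : 'I_N) : nth 0%N (inverse_word s) i = (s^-1)%g i.
Proof. by rewrite (nth_map i) ?size_enum_ord // nth_ord_enum. Qed.

Lemma size_inverse_word (s : 'S_N) : size (inverse_word s) = N.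
Proof. by rewrite size_map size_enum_ord. Qed.

Lemma inverse_word_perm (s : 'S_N) : perm_eq (inverse_word s) (iota 0 N).
Proof.
rewrite -val_enum_ord /inverse_word (map_comp val (s^-1)%g) perm_map //.
apply: uniq_perm; rewrite ?enum_uniq//.
  by rewrite map_inj_uniq ?enum_uniq//; apply: perm_inj.
move=> i; rewrite mem_enum; apply/mapP; exists (s i); rewrite ?mem_enum//.
by rewrite permK.
Qed.

Lemma inverse_word_inj : injective inverse_word.
Proof.
move=> s t st; apply: invg_inj; apply/permP => i; apply: val_inj.
by have := congr1 (fun w => nth 0%N w i) st; rewrite !nth_inverse_word.
Qed.

Lemma perm_of_word (r : seq nat) : perm_eq r (iota 0 N) ->
  exists s : 'S_N, forall i : 'I_N, s i = nth 0%N r i :> nat.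
Proof.
move=> pr; have sr : size r = N by rewrite (perm_size pr) size_iota.
have lt_r (i : 'I_N) : (nth 0 r i < N)%N.
  by have := mem_nth 0%N (s := r) (n := i); rewrite sr ltn_ord => /(_ isT);
     rewrite (perm_mem pr) mem_iota.
have inj : injective (fun i => Ordinal (lt_r i)).
  move=> i j [] /eqP; rewrite nth_uniq ?sr// ?(perm_uniq pr) ?iota_uniq//.
  by move/eqP/val_inj.
by exists (perm inj) => i; rewrite permE.
Qed.

Lemma inverse_words : perm_eq [seq inverse_word s | s <- enum {perm 'I_N}] (permutations (iota 0 N)).
Proof.
apply: uniq_perm; rewrite ?permutations_uniq//.
  by rewrite map_inj_uniq ?enum_uniq//; exact: inverse_word_inj.
move=> r; rewrite mem_permutations; apply/mapP/idP => [[s _ ->]|pr].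
  exact: inverse_word_perm.
have [s hs] := perm_of_word pr; exists (s^-1)%g; rewrite ?mem_enum//.
apply: (@eq_from_nth _ 0%N) => [|i]; first by rewrite size_inverse_word (perm_size pr) size_iota.
rewrite (perm_size pr) size_iota => iN.
by rewrite (nth_inverse_word _ (Ordinal iN)) invgK hs.
Qed.

(** Only the partition of the letters induced by the labels matters, so the Boolean labels of
    [shuffles2] and the indices of [shufflesn] are treated alike. Comparing all pairs within a block
    amounts to comparing neighbours. *)
Lemma mem_shuffles (I : eqType) (b : 'I_N -> I) (ks : seq nat) (s : 'S_N) :
  sumn ks = N ->
  (forall i j, (b i == b j) = (reshape_index ks i == reshape_index ks j)) ->
  (s \in shuffles b) = all (sorted ltn) (reshape ks (inverse_word s)).
Proof.
move=> ksN hb; set w := inverse_word s.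
have sw : size w = sumn ks by rewrite size_inverse_word.
have shw : shape (reshape ks w) = ks by rewrite reshapeKl ?sw.
have nthw x0 q c : (c < nth 0 ks q)%N ->
    nth x0 (nth [::] (reshape ks w) q) c = nth x0 w (flatten_index ks q c).
  move=> cq; rewrite -[w in RHS](@reshapeKr _ ks) ?sw// nth_flatten shw.
  by rewrite flatten_indexKl // flatten_indexKr.
rewrite inE; apply/'forall_forallP/allP => [h e eks | h i j].
  have qs : (index e (reshape ks w) < size (reshape ks w))%N by rewrite index_mem.
  move: (nth_index [::] eks); set q := index e _ in qs * => <-.
  have sq : size (nth [::] (reshape ks w) q) = nth 0 ks q.
    by rewrite -nth_shape shw.
  apply/(sortedP 0%N) => c; rewrite sq => cq.
  have cq' := ltn_trans (ltnSn c) cq.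
  rewrite (nthw _ _ _ cq) (nthw _ _ _ cq').
  have lt1 : (flatten_index ks q c.+1 < N)%N by rewrite -ksN flatten_indexP.
  have lt0 : (flatten_index ks q c < N)%N by apply: leq_trans lt1; rewrite /flatten_index addnS ltnS.
  have := h (Ordinal lt0) (Ordinal lt1); rewrite -!nth_inverse_word /= hb /=.
  rewrite (flatten_indexKl cq) (flatten_indexKl cq') eqxx andbT.
  have -> : (flatten_index ks q c < flatten_index ks q c.+1)%N by rewrite /flatten_index addnS.
  by [].
apply/implyP. move=> /andP[ij eb]; move: eb; rewrite hb -!nth_inverse_word => /eqP eq_ij.
set q := reshape_index ks i in eq_ij.
have iN : (i < sumn ks)%N by rewrite ksN.
have jN : (j < sumn ks)%N by rewrite ksN.
have qs : (q < size (reshape ks w))%N by rewrite -[size _](size_map size) -/(shape _) shw reshape_indexP.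
have sq : size (nth [::] (reshape ks w) q) = nth 0 ks q.
  by rewrite -nth_shape shw.
have := h _ (mem_nth [::] qs).
have := reshape_offsetP iN; have := reshape_offsetP jN; rewrite -eq_ij -/q => cj ci.
rewrite -(reshape_indexK ks i) -(reshape_indexK ks j) -eq_ij -/q.
rewrite -!nthw // => /(sorted_ltn_nth ltn_trans 0%N); apply; rewrite ?inE ?sq//.
have : (i < j)%N by [].
by rewrite -{1}(reshape_indexK ks i) -{1}(reshape_indexK ks j) -eq_ij /flatten_index ltn_add2l.
Qed.

Lemma sum_shuffles (I : eqType) (b : 'I_N -> I) (ks : seq nat) (B : nmodType)
    (G : seq nat -> B) : sumn ks = N ->
  (forall i j, (b i == b j) = (reshape_index ks i == reshape_index ks j)) ->
  \sum_(s in shuffles b) G (inverse_word s) = \sum_(r <- shuffle_words ks) G r.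
Proof.
move=> ksN hb; rewrite big_filter ksN -(perm_big _ inverse_words) big_map big_enum_cond /=.
by apply: eq_bigl => s; rewrite (mem_shuffles _ ksN hb).
Qed.

End Words.

Lemma shuffles2_index n m (i j : 'I_(n + m)) :
  ((n <= i)%N == (n <= j)%N) = (reshape_index [:: n; m] i == reshape_index [:: n; m] j).
Proof.
have h (k : 'I_(n + m)) : reshape_index [:: n; m] k = (n <= k)%N.
  rewrite /reshape_index /=; have := ltn_ord k.
  by case: eqP => ?; [|case: eqP => ?]; lia.
by rewrite !h; case: (n <= i)%N; case: (n <= j)%N.
Qed.

Lemma flatten_index_ord l (k : 'I_l -> nat) (q c : nat) : (q <= l)%N ->
  flatten_index [seq k q | q <- enum 'I_l] q c = (\sum_(i < l | (i < q)%N) k i + c)%N.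
Proof.
move=> ql; rewrite /flatten_index -map_take sumnE big_map; congr (_ + _)%N.
have -> : take q (enum 'I_l) = [seq i : 'I_l <- enum 'I_l | (i < q)%N].
  apply: (inj_map val_inj); rewrite map_take val_enum_ord take_iota (minn_idPl ql).
  rewrite -(filter_map (val : 'I_l -> nat) (fun i => i < q)%N) val_enum_ord.
  by rewrite -[q in RHS]add0n filter_iota_ltn.
by rewrite big_filter big_enum_cond.
Qed.

Lemma shufflesn_index l (k : 'I_l -> nat) (i j : 'I_(\sum_q k q)) :
  (tagnat.sig1 i == tagnat.sig1 j) =
  (reshape_index [seq k q | q <- enum 'I_l] i == reshape_index [seq k q | q <- enum 'I_l] j).
Proof.
set ks := map _ _.
have nks (q : 'I_l) : nth 0 ks q = k q by rewrite (nth_map q) ?size_enum_ord ?nth_ord_enum.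
have h (s : 'I_(\sum_q k q)) : reshape_index ks s = tagnat.sig1 s.
  have -> : s = flatten_index ks (tagnat.sig1 s) (tagnat.sig2 s) :> nat.
    by rewrite [LHS]tagnat.rect flatten_index_ord // ltnW.
  by rewrite flatten_indexKl // nks.
by rewrite !h val_eqE.
Qed.

(** * Tensor powers and group-like series *)

Section ClinearClosure.
Variables (R : realType).
Implicit Types A B C : normedModType R.

Lemma clinear_id A : clinear (fun x : A => x).
Proof.
by apply: (@linear_bounded_clinear _ _ _ 1); split=> [a x y//|x]; rewrite mul1r.
Qed.

Lemma clinear0 A B : clinear (fun _ : A => 0 : B).
Proof. exact: linear_bounded_clinear (linear_bounded0 _ _). Qed.

Lemma clinear_comp A B C (g : B -> C) (f : A -> B) :
  clinear g -> clinear f -> clinear (fun x => g (f x)).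
Proof.
move=> /linear_bounded_exP [K K0 gK] /linear_bounded_exP [K' _ fK].
exact: linear_bounded_clinear (linear_bounded_comp K0 gK fK).
Qed.

Lemma clinearD A B (f g : A -> B) :
  clinear f -> clinear g -> clinear (fun x => f x + g x).
Proof.
move=> /linear_bounded_exP [K _ fK] /linear_bounded_exP [K' _ gK].
exact: linear_bounded_clinear (linear_boundedD fK gK).
Qed.

Lemma clinearB A B (f g : A -> B) :
  clinear f -> clinear g -> clinear (fun x => f x - g x).
Proof.
move=> /linear_bounded_exP [K _ fK] /linear_bounded_exP [K' _ gK].
exact: linear_bounded_clinear (linear_boundedB fK gK).
Qed.

Lemma clinearZ A B (a : R) (f : A -> B) : clinear f -> clinear (fun x => a *: f x).
Proof.
move=> /linear_bounded_exP [K _ fK].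
exact: linear_bounded_clinear (linear_boundedZ a fK).
Qed.

Lemma clinear_sum A B I (r : seq I) (Q : pred I) (f : I -> A -> B) :
  (forall i, Q i -> clinear (f i)) -> clinear (fun x => \sum_(i <- r | Q i) f i x).
Proof.
move=> fC; apply: (@linear_bounded_clinear _ _ _ (\sum_(i <- r | Q i) opnorm (f i))).
by apply: linear_bounded_sum => i Qi; exact/clinear_linear_bounded/fC.
Qed.

End ClinearClosure.

(** * Pure tensors of lists, products of prescribed order, action of words *)

Section TensorLists.
Variables (R : realType) (V : completeNormedModType R) (T : tensor_powers V).
Implicit Types (s t : seq V).

(* Pure tensors of lists: concatenation needs no cast between the types of
   the indices. *)
Definition pt n (s : seq V) : T n := ptens T (fun i : 'I_n => nth 0 s i).

Lemma ptE n (v : 'I_n -> V) : ptens T v = pt n [seq v i | i <- enum 'I_n].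
Proof.
by congr (ptens T _); apply/funext => i; rewrite (nth_map i) ?size_enum_ord ?nth_ord_enum.
Qed.

(** The span of the pure tensors is dense and bounded linear maps are continuous. Most tensor
    identities below are reduced in this way to identities of words, one factor at a time. *)
Lemma clinear_pt_eq (Z : normedModType R) n (f g : T n -> Z) :
  clinear f -> clinear g -> (forall s, size s = n -> f (pt n s) = g (pt n s)) ->
  forall x, f x = g x.
Proof.
move=> fC gC fg x; apply/eqP; rewrite -subr_eq0 -normr_le0; apply/ler_addgt0Pl => e e0.
rewrite addr0.
have [K K0 [dL dK]] := linear_bounded_exP (clinearB fC gC).
have : closure [set x : T n | exists m (c : 'I_m -> R) (v : 'I_m -> 'I_n -> V),
      x = \sum_j c j *: ptens T (v j)] x by rewrite ptens_dense.
have K1 : 0 < K + 1 by rewrite ltr_wpDl.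
have eK : 0 < e / (K + 1) by rewrite divr_gt0.
move=> /(_ _ (nbhsx_ballx x _ eK)) [_ [[m [c [v ->]]]]].
set y := \sum_j _; rewrite -ball_normE /= => xy.
have dy : f y - g y = 0.
  rewrite (linear_sum' dL) big1 // => j _; rewrite (linearZ' dL) ptE fg ?subrr ?scaler0//.
  by rewrite size_map size_enum_ord.
have -> : f x - g x = f (x - y) - g (x - y) by rewrite (linearB' dL) dy subr0.
apply: le_trans (dK _) _.
apply: (@le_trans _ _ ((K + 1) * `|x - y|)); first by rewrite ler_wpM2r // lerDl.
by rewrite mulrC -ler_pdivlMr // ltW.
Qed.

Lemma tmul_pt n m s t : size s = n -> tmul (pt n s) (pt m t) = pt (n + m) (s ++ t).
Proof.
move=> sn; rewrite tmul_ptens; congr (ptens T _); apply/funext => i.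
by rewrite /vcat nth_cat sn; case: fintype.splitP => j ->; rewrite ?addKn.
Qed.

(* The product with a prescribed target order [N]; it is 0 when [n + m <> N], so
   that sums over [n + m = N] may range over all [n] and [m]. *)
Definition tmulto N n m (x : T n) (y : T m) : T N :=
  if (n + m)%N =P N is ReflectT e then ecast k (T k) e (tmul x y) else 0.

Lemma tmulto_tmul n m (x : T n) (y : T m) : tmulto (n + m) x y = tmul x y.
Proof. by rewrite /tmulto; case: eqP => // e; rewrite eq_axiomK. Qed.

Lemma tmulto_neq N n m (x : T n) (y : T m) : (n + m)%N <> N -> tmulto N x y = 0.
Proof. by rewrite /tmulto; case: eqP. Qed.

Lemma tmulto_cast N n m (e : (n + m)%N = N) (x : T n) (y : T m) :
  ecast k (T k) e (tmul x y) = tmulto N x y.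
Proof. by subst N; rewrite tmulto_tmul. Qed.

Lemma tmulto_linearl N n m (y : T m) : linear (fun x : T n => tmulto N x y).
Proof.
have [e|e] := (n + m)%N =P N; last first.
  by move=> a x z; rewrite !tmulto_neq // scaler0 addr0.
by subst N => a x z; rewrite !tmulto_tmul; exact: (@tmul_linearl _ _ T n m y a x z).
Qed.

Lemma tmulto_linearr N n m (x : T n) : linear (fun y : T m => tmulto N x y).
Proof.
have [e|e] := (n + m)%N =P N; last first.
  by move=> a y z; rewrite !tmulto_neq // scaler0 addr0.
by subst N => a y z; rewrite !tmulto_tmul; exact: (@tmul_linearr _ _ T n m x a y z).
Qed.

Lemma tmulto_norm N n m (x : T n) (y : T m) : `|tmulto N x y| <= `|x| * `|y|.
Proof.
have [e|e] := (n + m)%N =P N; last by rewrite tmulto_neq // normr0 mulr_ge0.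
by subst N; rewrite tmulto_tmul tmul_norm.
Qed.

Lemma tmulto_boundedl N n m (y : T m) : linear_bounded `|y| (fun x : T n => tmulto N x y).
Proof. by split; [exact: tmulto_linearl|move=> x; rewrite mulrC tmulto_norm]. Qed.

Lemma tmulto_boundedr N n m (x : T n) : linear_bounded `|x| (fun y : T m => tmulto N x y).
Proof. by split; [exact: tmulto_linearr|move=> y; rewrite tmulto_norm]. Qed.

Lemma tmulto_clinearl N n m (y : T m) : clinear (fun x : T n => tmulto N x y).
Proof. exact: linear_bounded_clinear (tmulto_boundedl _ _ _). Qed.

Lemma tmulto_clinearr N n m (x : T n) : clinear (fun y : T m => tmulto N x y).
Proof. exact: linear_bounded_clinear (tmulto_boundedr _ _ _). Qed.

Lemma clinear_tmultol (A : normedModType R) N n m (y : T m) (f : A -> T n) :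
  clinear f -> clinear (fun x => tmulto N (f x) y).
Proof. by move=> fC; apply: (clinear_comp (tmulto_clinearl N n y)). Qed.

Lemma clinear_tmultor (A : normedModType R) N n m (x : T n) (f : A -> T m) :
  clinear f -> clinear (fun y => tmulto N x (f y)).
Proof. by move=> fC; apply: (clinear_comp (tmulto_clinearr N m x)). Qed.

Lemma tmulto_pt N n m s t : (n + m)%N = N -> size s = n ->
  tmulto N (pt n s) (pt m t) = pt N (s ++ t).
Proof. by move=> <- sn; rewrite tmulto_tmul tmul_pt. Qed.

Lemma tmulto_suml N n m I (r : seq I) (Q : pred I) (F : I -> T n) (y : T m) :
  tmulto N (\sum_(i <- r | Q i) F i) y = \sum_(i <- r | Q i) tmulto N (F i) y.
Proof. exact: (linear_sum' (tmulto_linearl N y)). Qed.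

Lemma tmulto_sumr N n m I (r : seq I) (Q : pred I) (F : I -> T m) (x : T n) :
  tmulto N x (\sum_(i <- r | Q i) F i) = \sum_(i <- r | Q i) tmulto N x (F i).
Proof. exact: (linear_sum' (tmulto_linearr N x)). Qed.

Lemma tmulto0l N n m (y : T m) : tmulto N (0 : T n) y = 0.
Proof. exact: (linear0' (tmulto_linearl N y)). Qed.

Lemma tmulto0r N n m (x : T n) : tmulto N x (0 : T m) = 0.
Proof. exact: (linear0' (tmulto_linearr N x)). Qed.

(** The prescribed order [N] replaces a cast between the orders (a + b) + c and a + (b + c); if it
    is the wrong one, both sides vanish. *)
Lemma tmultoA N a b c (x : T a) (y : T b) (z : T c) :
  tmulto N (tmulto (a + b) x y) z = tmulto N x (tmulto (b + c) y z).
Proof.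
have [e|e] := (a + b + c)%N =P N; last by rewrite !tmulto_neq // addnA.
apply: (clinear_pt_eq (f := fun x => tmulto N (tmulto (a + b) x y) z)
  (g := fun x => tmulto N x (tmulto (b + c) y z))) => [||s sa] /=.
- exact/clinear_tmultol/tmulto_clinearl.
- exact: tmulto_clinearl.
apply: (clinear_pt_eq (f := fun y => tmulto N (tmulto (a + b) (pt a s) y) z)
  (g := fun y => tmulto N (pt a s) (tmulto (b + c) y z))) => [||t tb] /=.
- exact/clinear_tmultol/tmulto_clinearr.
- exact/clinear_tmultor/tmulto_clinearl.
apply: (clinear_pt_eq (f := fun z => tmulto N (tmulto (a + b) (pt a s) (pt b t)) z)
  (g := fun z => tmulto N (pt a s) (tmulto (b + c) (pt b t) z))) => [||u uc] /=.
- exact/tmulto_clinearr.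
- exact/clinear_tmultor/tmulto_clinearr.
rewrite !tmulto_pt ?size_cat ?sa ?tb//; first by rewrite catA.
by rewrite addnA.
Qed.

(** The identity is the default when no permutation takes the values listed in [r]. *)
Definition of_word N (r : seq nat) : 'S_N :=
  odflt 1%g [pick s : 'S_N | [forall i : 'I_N, s i == nth 0%N r i :> nat]].

Lemma of_wordE N r (i : 'I_N) : perm_eq r (iota 0 N) -> of_word N r i = nth 0%N r i :> nat.
Proof.
move=> /perm_of_word [s hs]; rewrite /of_word; case: pickP => [s' /forallP/(_ i)/eqP//|].
by move=> /(_ s) /negP[]; apply/forallP => j; rewrite hs.
Qed.

Definition tword N (r : seq nat) (x : T N) : T N := tperm (of_word N r) x.

Lemma tword_inverse_word N (s : 'S_N) (x : T N) : tword (inverse_word s) x = tperm (s^-1)%g x.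
Proof.
rewrite /tword; congr (tperm _ x); apply/permP => i; apply: val_inj.
by rewrite /= of_wordE ?inverse_word_perm // nth_inverse_word.
Qed.

Lemma tword_bounded N r : linear_bounded 1 (@tword N r).
Proof.
split; first exact: tperm_linear.
by move=> x; rewrite tperm_norm mul1r.
Qed.

Lemma tword_linear N r : linear (@tword N r). Proof. exact: tperm_linear. Qed.

Lemma tword_clinear N r : clinear (@tword N r).
Proof. exact: linear_bounded_clinear (tword_bounded N r). Qed.

Lemma clinear_tword (A : normedModType R) N r (f : A -> T N) :
  clinear f -> clinear (fun x => tword r (f x)).
Proof. by move=> fC; apply: (clinear_comp (tword_clinear N r)). Qed.

Lemma tword_pt N r s : perm_eq r (iota 0 N) ->
  tword r (pt N s) = pt N [seq nth 0 s j | j <- r].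
Proof.
move=> pr; rewrite /tword /pt tperm_ptens; congr (ptens T _); apply/funext => i.
rewrite (nth_map 0%N) ?(perm_size pr) ?size_iota//.
by rewrite of_wordE.
Qed.

Definition shufop N (ks : seq nat) (x : T N) : T N :=
  \sum_(r <- shuffle_words ks) tword r x.

Lemma shufop_bounded N ks : linear_bounded (size (shuffle_words ks))%:R (@shufop N ks).
Proof.
have := @linear_bounded_sum _ (T N) (T N) _ (shuffle_words ks) predT (fun _ => 1) (fun r => @tword N r).
by rewrite big_const_seq count_predT iter_addr_0; apply => r _; exact: tword_bounded.
Qed.

Lemma shufop_clinear N ks : clinear (@shufop N ks).
Proof. exact: linear_bounded_clinear (shufop_bounded N ks). Qed.

Lemma shufop_pt N ks s : sumn ks = N -> shufop ks (pt N s) =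
  \sum_(r <- shuffle_words ks) pt N [seq nth 0 s j | j <- r].
Proof.
move=> ksN; rewrite /shufop big_seq [RHS]big_seq; apply: eq_bigr => r.
by rewrite mem_shuffle_words ksN => /andP[pr _]; rewrite tword_pt.
Qed.

Lemma shuffle_words1 m : perm_eq (shuffle_words [:: m]) [:: iota 0 m].
Proof.
apply: uniq_perm => //; first exact: shuffle_words_uniq.
move=> r; rewrite mem_shuffle_words inE /= addn0 andbT; apply/andP/eqP => [[pr]|->].
  rewrite take_oversize ?(perm_size pr) ?size_iota// => sr.
  by apply: (irr_sorted_eq ltn_trans ltnn) => //; [exact: iota_ltn_sorted|exact: perm_mem].
by rewrite take_oversize ?size_iota// iota_ltn_sorted.
Qed.

(** Once the positions of the first block are chosen, the second block fills the rest in a single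
    way. *)
Lemma big_shuffle_words2 (B : nmodType) n m (G : seq nat -> B) :
  \sum_(r <- shuffle_words [:: n; m]) G r =
  \sum_(ab <- splits (iota 0 (n + m)) | size ab.1 == n) G (ab.1 ++ ab.2).
Proof.
rewrite (perm_big _ (shuffle_words_cons _ _)) /= big_allpairs_dep /= addn0 big_filter.
rewrite big_seq_cond [RHS]big_seq_cond; apply: eq_bigr => -[a b] /= /andP[abv /eqP sa].
rewrite (perm_big _ (shuffle_words1 m)) big_seq1; congr (G (_ ++ _)).
have /allP/(_ _ abv)/eqP /= := splits_size (iota 0 (n + m)).
rewrite sa size_iota => /addnI <-.
by rewrite -[LHS]/(mkseq _ _) mkseq_nth.
Qed.

(* The component of order (n, m) of the unshuffling coproduct, its two factors being
   concatenated; 0 when [n + m <> N]. *)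
Definition Del N n m (x : T N) : T N :=
  if (n + m == N)%N then shufop [:: n; m] x else 0.

Lemma Del_clinear N n m : clinear (@Del N n m).
Proof. by rewrite /Del; case: eqP => _; [exact: shufop_clinear|exact: clinear0]. Qed.

Lemma clinear_Del (A : normedModType R) N n m (f : A -> T N) :
  clinear f -> clinear (fun x => Del n m (f x)).
Proof. by move=> fC; apply: (clinear_comp (Del_clinear N n m)). Qed.

(** The words of the shuffles are splits of the list of positions, which [splits_map] turns into
    splits of the list of vectors. A wrong total order leaves an empty sum. *)
Lemma Del_pt N n m s : size s = N -> Del n m (pt N s) =
  \sum_(ab <- splits s | (size ab.1 == n) && (size ab.2 == m)) pt N (ab.1 ++ ab.2).
Proof.
move=> sN; rewrite /Del; case: eqP => [nm|nm]; last first.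
  rewrite big_seq_cond big1 // => ab /andP[abs /andP[/eqP s1 /eqP s2]]; exfalso.
  by have /allP/(_ _ abs)/eqP := splits_size s; rewrite s1 s2 sN.
rewrite shufop_pt /= ?addn0 // big_shuffle_words2 nm.
have es : s = map (nth 0 s) (iota 0 N) by rewrite -[LHS](mkseq_nth 0) sN.
rewrite [in RHS]es splits_map big_map /= big_seq_cond [RHS]big_seq_cond.
have sz := splits_size (iota 0 N).
apply: eq_big => [[a b]|[a b] _] /=; last by rewrite map_cat.
case abv : (_ \in _) => //=; rewrite !size_map.
move/allP/(_ _ abv): sz => /=; rewrite size_iota -nm => /eqP; case: eqP => //= -> /addnI ->.
by rewrite eqxx.
Qed.

End TensorLists.

Lemma sum_ord_eq (B : nmodType) K k (F : nat -> B) : (k < K)%N ->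
  \sum_(i < K | k == i) F i = F k.
Proof.
by move=> kK; rewrite (big_pred1 (Ordinal kK)) // => i; rewrite eq_sym -val_eqE.
Qed.

(** Exchanges the two middle ones of four consecutive blocks: the flip in the product of the tensor
    square of the algebra. *)
Definition swap_word (a c b d : nat) : seq nat :=
  iota 0 a ++ iota (a + c) b ++ iota a c ++ iota (a + c + b) d.

Lemma swap_word_perm a c b d : perm_eq (swap_word a c b d) (iota 0 (a + c + b + d)).
Proof.
rewrite !iotaD !add0n /swap_word -!catA perm_cat2l catA [in X in perm_eq _ X]catA.
by rewrite perm_cat2r perm_catC.
Qed.

Lemma nth_iota_cat (A : Type) (x0 : A) s1 s2 s3 :
  [seq nth x0 (s1 ++ s2 ++ s3) j | j <- iota (size s1) (size s2)] = s2.
Proof.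
apply: (@eq_from_nth _ x0); rewrite size_map size_iota// => i i2.
rewrite (nth_map 0%N) ?size_iota// nth_iota// nth_cat ltnNge leq_addr /= addKn.
by rewrite nth_cat i2.
Qed.

Lemma swap_wordE (A : Type) (x0 : A) s1 s2 s3 s4 :
  [seq nth x0 (s1 ++ s2 ++ s3 ++ s4) j
     | j <- swap_word (size s1) (size s2) (size s3) (size s4)] =
  s1 ++ s3 ++ s2 ++ s4.
Proof.
rewrite /swap_word !map_cat; congr (_ ++ (_ ++ (_ ++ _))).
- exact: (nth_iota_cat x0 [::] s1 (s2 ++ s3 ++ s4)).
- by have := nth_iota_cat x0 (s1 ++ s2) s3 s4; rewrite size_cat -catA.
- exact: (nth_iota_cat x0 s1 s2 (s3 ++ s4)).
- by have := nth_iota_cat x0 (s1 ++ s2 ++ s3) s4 [::]; rewrite !size_cat cats0 -!catA addnA.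
Qed.

(** * The algebra of tensor series *)

Section Algebra.
Variables (R : realType) (V : completeNormedModType R) (T : tensor_powers V).
Implicit Types (s t : seq V) (x y z : tseries T).

Lemma tword_swap_pt N s1 s2 s3 s4 : (size s1 + size s2 + size s3 + size s4)%N = N ->
  tword (swap_word (size s1) (size s2) (size s3) (size s4)) (pt T N (s1 ++ s2 ++ s3 ++ s4)) =
  pt T N (s1 ++ s3 ++ s2 ++ s4).
Proof.
by move=> sN; rewrite tword_pt ?swap_wordE // -sN; exact: swap_word_perm.
Qed.

(** Summing over a square with a free bound [K] is allowed because products of the wrong order are
    0; sums may then be exchanged without dependent ranges. *)
Lemma tsmulE K a b N : (N < K)%N -> @tsmul _ _ T a b N =
  \sum_(i < K) \sum_(j < K) tmulto N (a i) (b j).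
Proof.
move=> NK; rewrite /tsmul.
under eq_bigr do rewrite tmulto_cast.
rewrite (big_ord_widen K (fun i => tmulto N (a i) (b (N - i)%N))) //.
rewrite big_mkcond; apply: eq_bigr => i _; case: ifP => iN.
  rewrite (bigD1 (Ordinal (leq_ltn_trans (leq_subr i N) NK))) //= big1 ?addr0// => j jN.
  rewrite tmulto_neq // => e; move/negP: jN; apply; apply/eqP/val_inj => /=.
  by rewrite -e addKn.
rewrite big1 // => j _; rewrite tmulto_neq // => e.
by move: iN; rewrite ltnS -e leq_addr.
Qed.

Lemma sum_tmulto_ml K N a b m (u : T a) (v : T b) (w : T m) : (N < K)%N ->
  \sum_(i < K) tmulto N (tmulto i u v) w = tmulto N (tmulto (a + b) u v) w.
Proof.
move=> NK; have [abK|abK] := ltnP (a + b) K.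
  rewrite (bigD1 (Ordinal abK)) //= big1 ?addr0// => i iab.
  rewrite [tmulto i u v]tmulto_neq ?tmulto0l// => e; move/negP: iab; apply.
  exact/eqP/val_inj.
rewrite [RHS]tmulto_neq; last by lia.
by rewrite big1 // => i _; rewrite [tmulto i u v]tmulto_neq ?tmulto0l//; have := ltn_ord i; lia.
Qed.

Lemma sum_tmulto_mr K N a b m (u : T a) (v : T b) (w : T m) : (N < K)%N ->
  \sum_(i < K) tmulto N w (tmulto i u v) = tmulto N w (tmulto (a + b) u v).
Proof.
move=> NK; have [abK|abK] := ltnP (a + b) K.
  rewrite (bigD1 (Ordinal abK)) //= big1 ?addr0// => i iab.
  rewrite [tmulto i u v]tmulto_neq ?tmulto0r// => e; move/negP: iab; apply.
  exact/eqP/val_inj.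
rewrite [RHS]tmulto_neq; last by lia.
by rewrite big1 // => i _; rewrite [tmulto i u v]tmulto_neq ?tmulto0r//; have := ltn_ord i; lia.
Qed.

Lemma tsmulA x y z : tsmul (tsmul x y) z = tsmul x (tsmul y z).
Proof.
apply: functional_extensionality_dep => N; rewrite !(tsmulE (K := N.+1)) //.
transitivity (\sum_(a < N.+1) \sum_(b < N.+1) \sum_(c < N.+1)
    tmulto N (tmulto (a + b) (x a) (y b)) (z c)).
  under eq_bigr => i _ do under eq_bigr => c _ do
    (rewrite (tsmulE (K := N.+1)) // tmulto_suml;
     under eq_bigr => a _ do rewrite tmulto_suml).
  under eq_bigr => i _ do rewrite exchange_big; rewrite exchange_big /=.
  apply: eq_bigr => a _; under eq_bigr => i _ do rewrite exchange_big; rewrite exchange_big /=.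
  apply: eq_bigr => b _; rewrite exchange_big /=; apply: eq_bigr => c _.
  by rewrite sum_tmulto_ml.
apply: eq_bigr => a _.
under [RHS]eq_bigr => j _ do (rewrite (tsmulE (K := N.+1)) // tmulto_sumr;
     under eq_bigr => b _ do rewrite tmulto_sumr).
rewrite [RHS]exchange_big /=; apply: eq_bigr => b _.
rewrite [RHS]exchange_big /=; apply: eq_bigr => c _.
by rewrite sum_tmulto_mr // tmultoA.
Qed.

Lemma tsone0 : @tsone _ _ T 0%N = pt T 0 [::].
Proof. by rewrite /pt; congr (ptens T _); apply/funext => -[]. Qed.

Lemma tmulto1l N (x : T N) : tmulto N (pt T 0 [::]) x = x.
Proof.
apply: (@clinear_pt_eq _ _ T (T N) N (fun x : T N => tmulto N (pt T 0 [::]) x) (fun x : T N => x)) => [||s sN].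
- exact: tmulto_clinearr.
- exact: clinear_id.
by rewrite tmulto_pt.
Qed.

Lemma tmulto1r N (x : T N) : tmulto N x (pt T 0 [::]) = x.
Proof.
apply: (@clinear_pt_eq _ _ T (T N) N (fun x : T N => tmulto N x (pt T 0 [::])) (fun x : T N => x)) => [||s sN].
- exact: tmulto_clinearl.
- exact: clinear_id.
by rewrite tmulto_pt ?cats0 // addn0.
Qed.

Lemma tsmul1l x : tsmul (@tsone _ _ T) x = x.
Proof.
apply: functional_extensionality_dep => N; rewrite (tsmulE (K := N.+1)) // big_ord_recl /= [X in _ + X]big1 ?addr0; last first.
  by move=> i _; rewrite big1 // => j _; rewrite tmulto0l.
rewrite big_ord_recr /= big1 ?add0r; first by rewrite -[RHS]tmulto1l -tsone0.
by move=> j _; rewrite tmulto_neq // add0n; have := ltn_ord j; lia.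
Qed.

Lemma tsmul1r x : tsmul x (@tsone _ _ T) = x.
Proof.
apply: functional_extensionality_dep => N; rewrite (tsmulE (K := N.+1)) // exchange_big big_ord_recl /= [X in _ + X]big1 ?addr0; last first.
  by move=> i _; rewrite big1 // => j _; rewrite tmulto0r.
rewrite big_ord_recr /= big1 ?add0r; first by rewrite -[RHS]tmulto1r -tsone0.
by move=> j _; rewrite tmulto_neq // addn0; have := ltn_ord j; lia.
Qed.

Lemma tsmul_sumr K (d : tseries T) (F : 'I_K -> tseries T) N :
  tsmul d (fun n => \sum_(j < K) F j n) N = \sum_(j < K) tsmul d (F j) N.
Proof.
rewrite (tsmulE (K := N.+1)) //.
under [RHS]eq_bigr => j _ do rewrite (tsmulE (K := N.+1)) //.
rewrite [RHS]exchange_big; apply: eq_bigr => i _.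
by rewrite [RHS]exchange_big; apply: eq_bigr => k _; rewrite tmulto_sumr.
Qed.

Lemma tsmulBl a b x N : tsmul (fun k => a k - b k) x N = tsmul a x N - tsmul b x N.
Proof.
rewrite !(tsmulE (K := N.+1)) // -sumrB; apply: eq_bigr => i _.
by rewrite -sumrB; apply: eq_bigr => j _; rewrite (linearB' (tmulto_linearl _ _)).
Qed.

Lemma tsmul_iter_low (d : tseries T) j n : d 0%N = 0 -> (n < j)%N ->
  iter j (tsmul d) (@tsone _ _ T) n = 0.
Proof.
move=> d0; elim: j n => // j IH n nj; rewrite iterS (tsmulE (K := n.+1)) //.
rewrite big1 // => -[[|a] an] _; rewrite big1 // => b _.
  by rewrite [d _]d0 tmulto0l.
have [e|e] := (a.+1 + b)%N =P n; last by rewrite tmulto_neq.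
by rewrite IH ?tmulto0r//; lia.
Qed.

Lemma tsinvE K (a : tseries T) n : a 0%N = tsone T 0%N -> (n < K)%N ->
  tsinv a n = \sum_(j < K) iter j (tsmul (fun k => tsone T k - a k)) (@tsone _ _ T) n.
Proof.
move=> a0 nK; rewrite /tsinv (big_ord_widen K (fun j => iter j _ _ n)) //.
rewrite big_mkcond; apply: eq_bigr => j _; case: ifPn => //; rewrite -leqNgt => nj.
by rewrite tsmul_iter_low // a0 subrr.
Qed.

Lemma tsmul_ext (a b c : tseries T) N : (forall n, (n <= N)%N -> b n = c n) -> tsmul a b N = tsmul a c N.
Proof.
move=> bc; rewrite !(tsmulE (K := N.+1)) //; apply: eq_bigr => i _; apply: eq_bigr => j _.
by rewrite bc // -ltnS.
Qed.

(** With a = 1 - d the Neumann series telescopes to 1 - d^(N+1), and d^(N+1) has no component of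
    order N because d has none of order 0. *)
Lemma tsmulV a : a 0%N = tsone T 0%N -> tsmul a (tsinv a) = @tsone _ _ T.
Proof.
move=> a0; apply: functional_extensionality_dep => N.
pose d : tseries T := fun k => tsone T k - a k.
have -> : a = fun k => tsone T k - d k by apply: functional_extensionality_dep => k; rewrite /d opprB addrC subrK.
rewrite tsmulBl tsmul1l; set a' := fun k => _.
have ea : a' = a by apply: functional_extensionality_dep => k; rewrite /a' /d opprB addrC subrK.
rewrite ea (tsinvE (K := N.+1)) //.
rewrite (@tsmul_ext d _ (fun n => \sum_(j < N.+1) iter j (tsmul d) (@tsone _ _ T) n)); last first.
  by move=> n nN; rewrite (tsinvE (K := N.+1)).
rewrite (tsmul_sumr d (fun j => iter j (tsmul d) (@tsone _ _ T))) -sumrB.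
have := telescope_sumr (fun j => iter j (tsmul d) (@tsone _ _ T) N) (leq0n N.+1).
rewrite big_mkord => h.
rewrite -[LHS]opprK -sumrN.
under eq_bigr do rewrite opprB -iterS.
by rewrite h tsmul_iter_low ?sub0r ?opprK // /d a0 subrr.
Qed.

Lemma tsinv0 a : a 0%N = tsone T 0%N -> tsinv a 0%N = tsone T 0%N.
Proof. by move=> a0; rewrite /tsinv big_ord1. Qed.

(** In a monoid, a right inverse that has itself a right inverse is also a left inverse. *)
Lemma tsmulVl a : a 0%N = tsone T 0%N -> tsmul (tsinv a) a = @tsone _ _ T.
Proof.
move=> a0; have b0 := tsinv0 a0.
rewrite -[X in tsmul _ X]tsmul1r -(tsmulV b0) -[X in tsmul _ X]tsmulA.
by rewrite tsmulV // tsmul1l.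
Qed.

End Algebra.

Lemma sum_ord_pick4 (B : nmodType) K k1 k2 k3 k4 (w : B) :
  (k1 < K)%N -> (k2 < K)%N -> (k3 < K)%N -> (k4 < K)%N ->
  \sum_(a < K) \sum_(b < K) \sum_(c < K) \sum_(d < K)
    (if [&& k1 == a, k2 == b, k3 == c & k4 == d] then w else 0) = w.
Proof.
move=> h1 h2 h3 h4.
have pick k (F : nat -> B) : (k < K)%N -> \sum_(a < K) (if k == a then F a else 0) = F k.
  by move=> kK; rewrite -big_mkcond sum_ord_eq.
rewrite -[RHS](pick k1 (fun=> w)) //; apply: eq_bigr => a _; case: eqP => _ /=; last first.
  by rewrite !(big1 _ predT).
rewrite -[RHS](pick k2 (fun=> w)) //; apply: eq_bigr => b _; case: eqP => _ /=; last first.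
  by rewrite !(big1 _ predT).
rewrite -[RHS](pick k3 (fun=> w)) //; apply: eq_bigr => c _; case: eqP => _ /=; last first.
  by rewrite !(big1 _ predT).
by rewrite -[RHS](pick k4 (fun=> w)).
Qed.

(** * Group-like series: products, inverses, dilations, exponentials *)

Section Grouplike.
Variables (R : realType) (V : completeNormedModType R) (T : tensor_powers V).

Lemma sum_shuffles_pair n m (x : T (n + m)) :
  \sum_(s in shuffles2 n m) tperm (s^-1)%g x = shufop [:: n; m] x.
Proof.
under eq_bigr do rewrite -tword_inverse_word.
rewrite (sum_shuffles (ks := [:: n; m]) (fun r => tword r x)) /= ?addn0 //.
exact: shuffles2_index.
Qed.

Definition shuffle_rel (x : tseries T) (N n m : nat) :=
  tmulto N (x n) (x m) = Del n m (x N).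

Lemma grouplikeP (x : tseries T) : grouplike x <->
  x 0%N = pt T 0 [::] /\ forall N n m, shuffle_rel x N n m.
Proof.
rewrite /grouplike tsone0 /shuffle_rel; split=> -[x0 h]; split=> //.
  move=> N n m; rewrite /Del; case: eqP => [<-|e]; last by rewrite tmulto_neq.
  by rewrite tmulto_tmul h sum_shuffles_pair.
by move=> n m; rewrite -tmulto_tmul h /Del eqxx sum_shuffles_pair.
Qed.

(** Multiplicativity of the coproduct. On words, a split of s ++ t deals both s and t into two
    pieces; the swap puts the four pieces in the order in which the split of s ++ t lists them. *)
Lemma DelM K N n m i j (x : T i) (y : T j) : (N < K)%N ->
  Del n m (tmulto N x y) =
  \sum_(a < K) \sum_(b < K | (a + b == n)%N) \sum_(c < K) \sum_(d < K | (c + d == m)%N)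
    tword (swap_word a c b d) (tmulto N (Del a c x) (Del b d y)).
Proof.
move=> NK; have [e|e] := (i + j)%N =P N; last first.
  rewrite tmulto_neq // (linear0' (Del_clinear _ _ _ _).1).
  rewrite big1 // => a _; rewrite big1 // => b _; rewrite big1 // => c _; rewrite big1 // => d _.
  by rewrite tmulto_neq // (linear0' (@tword_linear _ _ _ _ _)).
pose rhs (x : T i) (y : T j) := \sum_(a < K) \sum_(b < K | (a + b == n)%N) \sum_(c < K) \sum_(d < K | (c + d == m)%N)
    tword (swap_word a c b d) (tmulto N (Del a c x) (Del b d y)).
rewrite -[RHS]/(rhs x y).
move: x; apply: (@clinear_pt_eq _ _ T (T N) i (fun x => Del n m (tmulto N x y)) (fun x => rhs x y)) => [||s si].
- exact/clinear_Del/tmulto_clinearl.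
- rewrite /rhs; do 4![apply: clinear_sum => ? _].
  by apply/clinear_tword/clinear_tmultol/Del_clinear.
move: y; apply: (@clinear_pt_eq _ _ T (T N) j (fun y => Del n m (tmulto N (pt T i s) y)) (rhs (pt T i s))) => [||t tj].
- exact/clinear_Del/tmulto_clinearr.
- rewrite /rhs; do 4![apply: clinear_sum => ? _].
  by apply/clinear_tword/clinear_tmultor/Del_clinear.
rewrite tmulto_pt // Del_pt ?size_cat ?si ?tj// big_mkcond.
pose F (a b : seq V) := if (size a == n) && (size b == m) then pt T N (a ++ b) else 0.
rewrite (big_splits_cat F) /rhs.
(* The pairs of splits are sorted by the sizes of their four pieces; each pair is met for exactly
   one choice of sizes, by [sum_ord_pick4]. *)
transitivity (\sum_(a < K) \sum_(b < K) \sum_(c < K) \sum_(d < K)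
   \sum_(ab <- splits s) \sum_(cd <- splits t)
   if [&& size ab.1 == a, size cd.1 == b, size ab.2 == c & size cd.2 == d] then
     F (ab.1 ++ cd.1) (ab.2 ++ cd.2) else 0); last first.
  apply: eq_bigr => a _; rewrite [RHS]big_mkcond; apply: eq_bigr => b _.
  case: eqP => abn; last first.
    do 2![rewrite big1 // => ? _]; rewrite big1 // => ab _; rewrite big1 // => cd _.
    case: ifP => // /and4P[/eqP s1 /eqP s2 /eqP s3 /eqP s4].
    by rewrite /F !size_cat s1 s2 ifF //; apply/negP => /andP[/eqP].
  apply: eq_bigr => c _; rewrite [RHS]big_mkcond; apply: eq_bigr => d _.
  case: eqP => cdm; last first.
    rewrite big1 // => ab _; rewrite big1 // => cd _.
    case: ifP => // /and4P[/eqP s1 /eqP s2 /eqP s3 /eqP s4].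
    by rewrite /F !size_cat s3 s4 ifF //; apply/negP => /andP[_ /eqP].
  rewrite !Del_pt // tmulto_suml (linear_sum' (@tword_linear _ _ _ _ _)).
  rewrite [RHS]big_mkcond; apply: eq_big_seq => ab abs.
  have := allP (splits_size s) _ abs => /eqP sab.
  case: ifPn => [/andP[/eqP s1 /eqP s3]|h]; last first.
    rewrite big1 // => cd _; case: ifP => // /and4P[s1 _ s3 _].
    by rewrite s1 s3 in h.
  rewrite tmulto_sumr (linear_sum' (@tword_linear _ _ _ _ _)) [RHS]big_mkcond.
  apply: eq_big_seq => cd cdt; have := allP (splits_size t) _ cdt => /eqP scd.
  rewrite s1 s3 !eqxx /=; case: ifP => // /andP[/eqP s2 /eqP s4].
  rewrite /F !size_cat s1 s2 s3 s4 abn cdm !eqxx /=.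
  rewrite tmulto_pt ?size_cat ?sab// -s1 -s2 -s3 -s4 -!catA tword_swap_pt //.
  by rewrite sab si -addnA scd tj.
have bound ab : ab \in splits s -> (size ab.1 < K)%N /\ (size ab.2 < K)%N.
  move=> h; have /eqP := allP (splits_size s) _ h; rewrite si -?e => {}h.
  by split; rewrite (leq_ltn_trans _ NK) // -e -h ?leq_addr ?leq_addl //= ?(leq_trans (leq_addr _ _)) ?(leq_trans (leq_addl _ _)) //; lia.
have bound' cd : cd \in splits t -> (size cd.1 < K)%N /\ (size cd.2 < K)%N.
  move=> h; have /eqP := allP (splits_size t) _ h; rewrite tj -?e => {}h.
  by split; rewrite (leq_ltn_trans _ NK) // -e -h ?leq_addr ?leq_addl //= ?(leq_trans (leq_addr _ _)) ?(leq_trans (leq_addl _ _)) //; lia.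
under [RHS]eq_bigr => a _ do under eq_bigr => b _ do under eq_bigr => c _ do rewrite exchange_big.
under [RHS]eq_bigr => a _ do under eq_bigr => b _ do rewrite exchange_big.
under [RHS]eq_bigr => a _ do rewrite exchange_big.
rewrite [RHS]exchange_big; apply: eq_big_seq => ab /bound[b1 b2].
under [RHS]eq_bigr => a _ do under eq_bigr => b _ do under eq_bigr => c _ do rewrite exchange_big.
under [RHS]eq_bigr => a _ do under eq_bigr => b _ do rewrite exchange_big.
under [RHS]eq_bigr => a _ do rewrite exchange_big.
rewrite [RHS]exchange_big; apply: eq_big_seq => cd /bound'[d1 d2].
by rewrite (sum_ord_pick4 (F (ab.1 ++ cd.1) (ab.2 ++ cd.2)) b1 d1 b2 d2).
Qed.

Lemma tword_swap N a b c d (u : T a) (v : T c) (w : T b) (z : T d) :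
  tword (swap_word a c b d) (tmulto N (tmulto (a + c) u v) (tmulto (b + d) w z)) =
  tmulto N (tmulto (a + b) u w) (tmulto (c + d) v z).
Proof.
have [e|e] := (a + b + (c + d) =P N)%N; last first.
  rewrite tmulto_neq 1?addnACA// tmulto_neq //.
  exact: (linear0' (@tword_linear _ _ _ _ _)).
move: u; apply: (@clinear_pt_eq _ _ T (T N) a (fun u => tword (swap_word a c b d) (tmulto N (tmulto (a + c) u v) (tmulto (b + d) w z)))
   (fun u => tmulto N (tmulto (a + b) u w) (tmulto (c + d) v z))) => [||s1 h1].
- exact/clinear_tword/clinear_tmultol/tmulto_clinearl.
- exact/clinear_tmultol/tmulto_clinearl.
move: v; apply: (@clinear_pt_eq _ _ T (T N) c (fun v => tword (swap_word a c b d) (tmulto N (tmulto (a + c) (pt T a s1) v) (tmulto (b + d) w z)))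
   (fun v => tmulto N (tmulto (a + b) (pt T a s1) w) (tmulto (c + d) v z))) => [||s2 h2].
- exact/clinear_tword/clinear_tmultol/tmulto_clinearr.
- exact/clinear_tmultor/tmulto_clinearl.
move: w; apply: (@clinear_pt_eq _ _ T (T N) b (fun w => tword (swap_word a c b d) (tmulto N (tmulto (a + c) (pt T a s1) (pt T c s2)) (tmulto (b + d) w z)))
   (fun w => tmulto N (tmulto (a + b) (pt T a s1) w) (tmulto (c + d) (pt T c s2) z))) => [||s3 h3].
- exact/clinear_tword/clinear_tmultor/tmulto_clinearl.
- exact/clinear_tmultol/tmulto_clinearr.
move: z; apply: (@clinear_pt_eq _ _ T (T N) d (fun z => tword (swap_word a c b d) (tmulto N (tmulto (a + c) (pt T a s1) (pt T c s2)) (tmulto (b + d) (pt T b s3) z)))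
   (fun z => tmulto N (tmulto (a + b) (pt T a s1) (pt T b s3)) (tmulto (c + d) (pt T c s2) z))) => [||s4 h4].
- exact/clinear_tword/clinear_tmultor/tmulto_clinearr.
- exact/clinear_tmultor/tmulto_clinearr.
rewrite !tmulto_pt ?size_cat ?h1 ?h2 ?h3 ?h4 // 1?addnACA //.
rewrite -h1 -h2 -h3 -h4 -!catA tword_swap_pt // h1 h2 h3 h4; lia.
Qed.

(** When x satisfies the shuffle relations, the failure of the relation for x y is linear in the
    failures for y. This serves twice: for a product, where the failures of y vanish, and for the
    inverse, where x y = 1 and the failure of y is the unknown. *)
Lemma shuffle_relM_defect K (x y : tseries T) N n m : (N < K)%N -> (n + m)%N = N ->
  (forall N n m, shuffle_rel x N n m) ->
  Del n m (tsmul x y N) - tmulto N (tsmul x y n) (tsmul x y m) =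
  \sum_(i < K) \sum_(j < K)
  \sum_(a < K) \sum_(b < K | (a + b == n)%N) \sum_(c < K) \sum_(d < K | (c + d == m)%N)
    tword (swap_word a c b d)
      (tmulto N (tmulto i (x a) (x c)) (Del b d (y j) - tmulto j (y b) (y d))).
Proof.
move=> NK nmN xrel; have nK : (n < K)%N by lia.
have mK : (m < K)%N by lia.
pose G i j a b c d := tword (swap_word a c b d) (tmulto N (tmulto i (x a) (x c)) (tmulto j (y b) (y d))).
transitivity (\sum_(i < K) \sum_(j < K)
  \sum_(a < K) \sum_(b < K | (a + b == n)%N) \sum_(c < K) \sum_(d < K | (c + d == m)%N)
    (tword (swap_word a c b d) (tmulto N (tmulto i (x a) (x c)) (Del b d (y j))) - G i j a b c d)); last first.
  do 6![apply: eq_bigr => ? _].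
  by rewrite (linearB' (tmulto_linearr _ _)) (linearB' (@tword_linear _ _ _ _ _)).
under [RHS]eq_bigr => i _ do (under eq_bigr => j _ do (under eq_bigr => a _ do (under eq_bigr => b _ do
   (under eq_bigr => c _ do rewrite sumrB; rewrite sumrB); rewrite sumrB); rewrite sumrB); rewrite sumrB).
rewrite sumrB; congr (_ - _).
  rewrite (tsmulE (K := K)) // (linear_sum' (Del_clinear _ _ _ _).1); apply: eq_bigr => i _.
  rewrite (linear_sum' (Del_clinear _ _ _ _).1); apply: eq_bigr => j _.
  rewrite (DelM (K := K)) //; do 4![apply: eq_bigr => ? _].
  by rewrite -xrel.
rewrite !(tsmulE (K := K)) // tmulto_suml.
under eq_bigr => a _ do (rewrite tmulto_suml; under eq_bigr => b _ do (rewrite tmulto_sumr;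
  under eq_bigr => c _ do rewrite tmulto_sumr)).
transitivity (\sum_(a < K) \sum_(b < K | (a + b == n)%N) \sum_(c < K) \sum_(d < K | (c + d == m)%N)
   tmulto N (tmulto n (x a) (y b)) (tmulto m (x c) (y d))).
  apply: eq_bigr => a _; rewrite [RHS]big_mkcond; apply: eq_bigr => b _; case: eqP => abn; last first.
    rewrite big1 // => c _; rewrite big1 // => d _.
    by rewrite [tmulto n _ _]tmulto_neq ?tmulto0l.
  apply: eq_bigr => c _; rewrite [RHS]big_mkcond; apply: eq_bigr => d _; case: eqP => cdm //.
  by rewrite [tmulto m _ _]tmulto_neq ?tmulto0r.
symmetry.
under eq_bigr => i _ do rewrite exchange_big; rewrite exchange_big; apply: eq_bigr => a _.
under eq_bigr => i _ do rewrite exchange_big; rewrite exchange_big; apply: eq_bigr => b /eqP abn.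
under eq_bigr => i _ do rewrite exchange_big; rewrite exchange_big; apply: eq_bigr => c _.
under eq_bigr => i _ do rewrite exchange_big; rewrite exchange_big; apply: eq_bigr => d /eqP cdm.
rewrite /G; under eq_bigr => i _ do (rewrite -(linear_sum' (@tword_linear _ _ _ _ _)) sum_tmulto_mr //).
rewrite -(linear_sum' (@tword_linear _ _ _ _ _)) sum_tmulto_ml //.
by rewrite tword_swap -abn -cdm.
Qed.

Lemma grouplikeM (x y : tseries T) : grouplike x -> grouplike y -> grouplike (tsmul x y).
Proof.
move=> /grouplikeP[x0 xr] /grouplikeP[y0 yr]; apply/grouplikeP; split.
  by rewrite (tsmulE (K := 1)) // !big_ord1 /= x0 y0 tmulto1l.
move=> N n m; rewrite /shuffle_rel.
have [nmN|nmN] := (n + m =P N)%N; last by rewrite tmulto_neq // /Del ifN_eq //; apply/eqP.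
apply/eqP; rewrite eq_sym -subr_eq0 (shuffle_relM_defect (K := N.+1)) //; apply/eqP.
do 6![rewrite big1 // => ? _].
by rewrite yr subrr tmulto0r (linear0' (@tword_linear _ _ _ _ _)).
Qed.

Lemma tperm1 N (x : T N) : tperm 1%g x = x.
Proof.
move: x; apply: (@clinear_pt_eq _ _ T (T N) N (fun x => tperm 1%g x) (fun x : T N => x)) => [||t tN].
- by apply: (@linear_bounded_clinear _ _ _ 1); split;[exact: tperm_linear|move=> z; rewrite tperm_norm mul1r].
- exact: clinear_id.
by rewrite tperm_ptens; congr (ptens T _); apply/funext => i; rewrite perm1.
Qed.

(** In the defect formula for x x^-1 = 1 the left side is 0. By induction on the order N, the terms
    with a component of positive order of x vanish, as they involve lower orders of x^-1; what is
    left is the failure of x^-1 in order N. *)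
Lemma grouplikeV (x : tseries T) : grouplike x -> grouplike (tsinv x).
Proof.
move=> gx; have [x0' _] := gx; move/grouplikeP: gx => [x0 xr]; apply/grouplikeP; split.
  by rewrite tsinv0 // tsone0.
move=> N; have [k] := ubnP N; elim: k N => // k IH N Nk n m.
rewrite /shuffle_rel; set y := tsinv x.
have [nmN|nmN] := (n + m =P N)%N; last by rewrite tmulto_neq // /Del ifN_eq //; apply/eqP.
have [N0|N0] := posnP N.
  have [n0 m0] : n = 0%N /\ m = 0%N by lia.
  subst n m N; rewrite /y tsinv0 // tsone0 tmulto1l Del_pt // /= big_mkcond big_seq1.
  by [].
have := @shuffle_relM_defect N.+1 x y N n m (ltnSn N) nmN xr.
rewrite tsmulV //; set D := Del n m (y N) - tmulto N (y n) (y m).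
have -> : Del n m (tsone T N) - tmulto N (tsone T n) (tsone T m) = 0.
  case: N N0 {Nk D} nmN => // N _ nmN; rewrite /= (linear0' (Del_clinear _ _ _ _).1) sub0r.
  case: n nmN => [|n] nmN; last by rewrite /= tmulto0l oppr0.
  by case: m nmN => [|m] // _; rewrite /= tmulto0r oppr0.
move=> /esym h; apply/eqP; rewrite eq_sym -subr_eq0 -/D; apply/eqP; rewrite -{}h.
symmetry.
rewrite (bigD1 ord0) //= [X in _ + X]big1 ?addr0; last first.
  move=> i i0; rewrite big1 // => j _.
  do 2![rewrite big1 // => ? _]; do 2![rewrite big1 // => ? _].
  have [e|e] := (i + j =P N)%N; last first.
    by rewrite tmulto_neq // (linear0' (@tword_linear _ _ _ _ _)).
  have i_gt0 : (0 < i)%N by case: posnP => // e0; move/negP: i0; case; apply/eqP/val_inj.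
  have jk : (j < k)%N by apply: (@leq_trans (i + j)%N); [rewrite -[X in (X < _)%N]add0n ltn_add2r|rewrite e -ltnS].
  by rewrite (IH j) // subrr tmulto0r (linear0' (@tword_linear _ _ _ _ _)).
rewrite (bigD1 ord_max) //= [X in _ + X]big1 ?addr0; last first.
  move=> j jN; do 4![rewrite big1 // => ? _].
  rewrite tmulto_neq ?(linear0' (@tword_linear _ _ _ _ _)) //.
  by rewrite add0n => e; move/negP: jN; apply; apply/eqP/val_inj.
have nN : (n < N.+1)%N by lia.
have mN : (m < N.+1)%N by lia.
rewrite (bigD1 ord0) //= [X in _ + X]big1 ?addr0; last first.
  move=> a a0; rewrite big1 // => b _; rewrite big1 // => c _; rewrite big1 // => d _.
  rewrite [tmulto 0 _ _]tmulto_neq ?tmulto0l ?(linear0' (@tword_linear _ _ _ _ _)) //.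
  by move=> e; move/negP: a0; apply; apply/eqP/val_inj => /=; move: e; case: (a : nat).
rewrite (big_pred1 (Ordinal nN)) /=; last by move=> b; rewrite add0n.
rewrite (bigD1 ord0) //= [X in _ + X]big1 ?addr0; last first.
  move=> c c0; rewrite big1 // => d _.
  rewrite [tmulto 0 _ _]tmulto_neq ?tmulto0l ?(linear0' (@tword_linear _ _ _ _ _)) //.
  by move=> e; move/negP: c0; apply; apply/eqP/val_inj => /=; move: e; case: (c : nat).
rewrite (big_pred1 (Ordinal mN)) /=; last by move=> b; rewrite add0n.
rewrite x0 !tmulto1l -/D.
rewrite /tword; set s := of_word _ _.
suff -> : s = 1%g by exact: tperm1.
have ew : swap_word 0 0 n m = iota 0 N by rewrite /swap_word /= add0n -nmN iotaD.
by apply/permP => i; apply: val_inj; rewrite /= /s of_wordE ?ew // nth_iota // perm1 add0n.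
Qed.

Definition dilate (a : R) (x : tseries T) : tseries T := fun k => a ^+ k *: x k.

Lemma grouplike_dilate a (x : tseries T) : grouplike x -> grouplike (dilate a x).
Proof.
move=> /grouplikeP[x0 xr]; apply/grouplikeP; split; first by rewrite /dilate scale1r.
move=> N n m; rewrite /shuffle_rel /dilate (linearZ' (tmulto_linearl _ _)) (linearZ' (tmulto_linearr _ _)).
rewrite (linearZ' (Del_clinear _ _ _ _).1) xr scalerA -exprD.
have [<-//|nmN] := (n + m =P N)%N.
by rewrite /Del ifN_eq ?scaler0 //; apply/eqP.
Qed.

Definition tsexp (v : V) : tseries T := fun k => (k`!%:R)^-1 *: pt T k (nseq k v).

(** All splits of v ... v give the same tensor; there are binomially many, which is the ratio of the
    factorials of both sides. *)
Lemma grouplike_tsexp v : grouplike (tsexp v).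
Proof.
apply/grouplikeP; split; first by rewrite /tsexp /= fact0 invr1 scale1r.
move=> N n m; rewrite /shuffle_rel /tsexp.
have [nmN|nmN] := (n + m =P N)%N; last by rewrite tmulto_neq // /Del ifN_eq //; apply/eqP.
rewrite (linearZ' (tmulto_linearl _ _)) (linearZ' (tmulto_linearr _ _)) (linearZ' (Del_clinear _ _ _ _).1).
rewrite tmulto_pt ?size_nseq // -nseqD nmN Del_pt ?size_nseq //.
rewrite big_seq_cond (eq_bigr (fun=> pt T N (nseq N v))); last first.
  move=> ab /andP[/splits_perm abp _]; congr (pt T N _).
  have /all_pred1P -> : all (pred1 v) (ab.1 ++ ab.2).
    by rewrite (perm_all _ abp) all_nseq /= eqxx orbT.
  by rewrite (perm_size abp) size_nseq.
rewrite -big_seq_cond big_const_seq.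
rewrite (@eq_in_count _ _ (fun ab => size ab.1 == n)); last first.
  move=> ab /(allP (splits_size _)); rewrite size_nseq -nmN => /eqP h /=.
  by case: eqP h => //= -> /addnI ->; rewrite eqxx.
rewrite splits_count size_nseq iter_addr_0 -[X in _ = _ *: X]scaler_nat !scalerA; congr (_ *: _).
rewrite -nmN -(bin_fact (leq_addr m n)) addKn !natrM.
have fact_neq0 k : (k`!%:R : R) != 0 by rewrite pnatr_eq0 -lt0n fact_gt0.
have bin_neq0 : ('C(n + m, n)%:R : R) != 0 by rewrite pnatr_eq0 -lt0n bin_gt0 leq_addr.
by field; rewrite bin_neq0 !fact_neq0.
Qed.

End Grouplike.

(** * Iterated shuffle identity and multilinear evaluation *)

Section IteratedShuffles.
Variables (R : realType) (V : completeNormedModType R) (T : tensor_powers V).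

Lemma block_word_perm k N r : perm_eq r (iota 0 N) ->
  perm_eq (iota 0 k ++ map (addn k) r) (iota 0 (k + N)).
Proof. by move=> pr; rewrite iotaD perm_cat2l add0n -[X in iota X N]addn0 iotaDl perm_map. Qed.

Lemma block_wordE (A : Type) (x0 : A) s t r :
  [seq nth x0 (s ++ t) j | j <- iota 0 (size s) ++ map (addn (size s)) r] = s ++ [seq nth x0 t j | j <- r].
Proof.
rewrite map_cat; congr (_ ++ _); first exact: (nth_iota_cat x0 [::] s t).
rewrite -map_comp; apply: eq_map => j /=.
by rewrite nth_cat ltnNge leq_addr /= addKn.
Qed.

(** By the recursion of [shuffle_words_cons]: unshuffle the first block, then permute only the
    remaining letters. *)
Lemma shufop_cons k ks (z : T (k + sumn ks)) :
  shufop (k :: ks) z = \sum_(r <- shuffle_words ks)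
    tword (iota 0 k ++ map (addn k) r) (Del k (sumn ks) z).
Proof.
set N := (k + sumn ks)%N.
move: z; apply: (@clinear_pt_eq _ _ T (T N) N (fun z => shufop (k :: ks) z) (fun z =>
  \sum_(r <- shuffle_words ks) tword (iota 0 k ++ map (addn k) r) (Del k (sumn ks) z))) => [||s sN].
- exact: shufop_clinear.
- by apply: clinear_sum => r _; exact/clinear_tword/Del_clinear.
rewrite shufop_pt // (perm_big _ (shuffle_words_cons _ _)) /= big_allpairs_dep /= big_filter.
rewrite Del_pt //.
have es : s = map (nth 0 s) (iota 0 N) by rewrite -[LHS](mkseq_nth 0) sN.
under [RHS]eq_bigr => r _ do rewrite (linear_sum' (@tword_linear _ _ _ _ _)).
rewrite [RHS]exchange_big /= [in RHS]es splits_map big_map /=.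
rewrite big_seq_cond [RHS]big_seq_cond; apply: eq_big => [[a b]|[a b] /= /andP[abN /eqP ak]].
  case abN : (_ \in _) => //=; rewrite !size_map.
  have /eqP /= := allP (splits_size _) _ abN; rewrite size_iota.
  by case: eqP => //= -> /addnI ->; rewrite eqxx.
have /eqP /= sab := allP (splits_size _) _ abN; rewrite size_iota ak in sab.
have sb : size b = sumn ks by move/addnI: sab.
rewrite big_seq [RHS]big_seq; apply: eq_bigr => r; rewrite mem_shuffle_words => /andP[pr _].
rewrite tword_pt ?block_word_perm //; congr (pt T N _).
have -> : k = size [seq s`_i | i <- a] by rewrite size_map.
rewrite block_wordE map_cat; congr (_ ++ _); rewrite -map_comp; apply/eq_in_map => j jr /=.
rewrite (nth_map 0%N) //.
by move: jr; rewrite (perm_mem pr) mem_iota sb.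
Qed.

Lemma tword_block k N r (u : T k) (z : T N) : perm_eq r (iota 0 N) ->
  tword (iota 0 k ++ map (addn k) r) (tmul u z) = tmul u (tword r z).
Proof.
move=> pr; rewrite -!tmulto_tmul.
move: u; apply: (@clinear_pt_eq _ _ T (T (k + N)) k (fun u => tword (iota 0 k ++ map (addn k) r) (tmulto (k + N) u z))
  (fun u => tmulto (k + N) u (tword r z))) => [||s sk].
- exact/clinear_tword/tmulto_clinearl.
- exact/tmulto_clinearl.
move: z; apply: (@clinear_pt_eq _ _ T (T (k + N)) N (fun z => tword (iota 0 k ++ map (addn k) r) (tmulto (k + N) (pt T k s) z))
  (fun z => tmulto (k + N) (pt T k s) (tword r z))) => [||t tN].
- exact/clinear_tword/tmulto_clinearr.
- exact/clinear_tmultor/tword_clinear.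
rewrite !tword_pt // !tmulto_pt // tword_pt ?block_word_perm // -sk.
by rewrite block_wordE.
Qed.

Fixpoint tprod (x : tseries T) (ks : seq nat) : T (sumn ks) :=
  match ks return T (sumn ks) with
  | [::] => x 0%N
  | k :: ks' => tmul (x k) (tprod x ks')
  end.

Lemma shufop_tprod (x : tseries T) ks : grouplike x -> shufop ks (x (sumn ks)) = tprod x ks.
Proof.
move=> /grouplikeP[x0 xr]; elim: ks => [|k ks IH].
  rewrite /shufop /= big_seq1 /tword; set s := of_word _ _.
  have -> : s = 1%g by apply/permP => -[].
  exact: tperm1.
rewrite /= shufop_cons -xr tmulto_tmul -IH /shufop -!tmulto_tmul tmulto_sumr.
rewrite big_seq [RHS]big_seq; apply: eq_bigr => r; rewrite mem_shuffle_words => /andP[pr _].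
by rewrite !tmulto_tmul tword_block.
Qed.

Variables (U : completeNormedModType R).

(** The maps of a tensor product have sources of different orders; paired with their order they form
    a list. *)
Definition slot := {k : nat & T k -> U}.
Definition slot_deg (c : slot) : nat := tag c.
Definition slot_app (c : slot) : T (slot_deg c) -> U := tagged c.

(** The list is treated from the left: the current component is replaced by a pure tensor by
    density, then frozen into [F] and [Psi], which stay continuous and linear in the remaining
    factors. *)
Lemma tprod_multilinear (Z : normedModType R) (cs : seq slot)
    (F : T (sumn (map slot_deg cs)) -> Z) (Psi : seq U -> Z) (x : tseries T) :
  x 0%N = pt T 0 [::] ->
  (forall c0 i, (i < size cs)%N -> clinear (@slot_app (nth c0 cs i))) ->
  clinear F ->
  (forall s t, (size s + (size t).+1 = size cs)%N -> clinear (fun u => Psi (s ++ u :: t))) ->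
  (forall vs : seq (seq V), shape vs = map slot_deg cs ->
     F (pt T _ (flatten vs)) = Psi [seq slot_app (pt T (slot_deg cv.1) cv.2) | cv <- zip cs vs]) ->
  F (tprod x (map slot_deg cs)) = Psi [seq slot_app (x (slot_deg c)) | c <- cs].
Proof.
move=> x0; elim: cs F Psi => [|c cs IH] F Psi csC FC PsiC FPsi.
  by have := FPsi [::] erefl; rewrite /= x0.
rewrite /= -tmulto_tmul.
set N' := sumn _; set k := slot_deg c.
suff h (u : T k) : F (tmulto (k + N') u (tprod x (map slot_deg cs))) =
    Psi (@slot_app c u :: [seq slot_app (x (slot_deg c)) | c <- cs]) by exact: h.
move: u; apply: (@clinear_pt_eq _ _ T Z k (fun u => F (tmulto (k + N') u (tprod x (map slot_deg cs))))
  (fun u => Psi (@slot_app c u :: [seq slot_app (x (slot_deg c)) | c <- cs]))) => [||s sk].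
- exact/(clinear_comp FC)/tmulto_clinearl.
- apply: (@clinear_comp _ _ _ _ (fun u => Psi (u :: _)) (@slot_app c)).
    by apply: (PsiC [::]); rewrite /= size_map.
  exact: (csC c 0%N).
apply: (IH (fun z => F (tmulto (k + N') (pt T k s) z)) (fun us => Psi (@slot_app c (pt T k s) :: us))).
- by move=> c0 i ilt; apply: (csC c0 i.+1).
- exact/(clinear_comp FC)/tmulto_clinearr.
- by move=> s1 t1 st; apply: (PsiC (_ :: s1)); rewrite /= -st.
- move=> vs shvs; have := FPsi (s :: vs); rewrite /= sk shvs => /(_ erefl) <-.
  by rewrite tmulto_pt.
Qed.

End IteratedShuffles.

Section Slots.
Variables (R : realType) (V : completeNormedModType R) (T : tensor_powers V).

Lemma pt1_bounded : linear_bounded 1 (fun v : V => pt T 1 [:: v]).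
Proof.
split=> [a x y|v]; last by rewrite mul1r /pt ptens1_norm.
have e (z : V) : pt T 1 [:: z] = ptens T [eta (fun _ : 'I_1 => 0 : V) with ord0 |-> z].
  by congr (ptens T _); apply/funext => i; rewrite /= ord1 eqxx.
by rewrite !e ptens_multilinear.
Qed.

Lemma pt_cons l v s : pt T l.+1 (v :: s) = tmulto l.+1 (pt T 1 [:: v]) (pt T l s).
Proof. by rewrite tmulto_pt. Qed.

Lemma pt_slot l s t : (size s + (size t).+1 = l)%N -> clinear (fun v => pt T l (s ++ v :: t)).
Proof.
move=> sl.
have -> : (fun v => pt T l (s ++ v :: t)) =
    fun v => tmulto l (pt T (size s) s) (tmulto (size t).+1 (pt T 1 [:: v]) (pt T (size t) t)).
  by apply/funext => v; rewrite -pt_cons tmulto_pt.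
exact/clinear_tmultor/clinear_tmultol/(linear_bounded_clinear pt1_bounded).
Qed.

Lemma ecast_pt n m (e : n = m) s : ecast k (T k) e (pt T n s) = pt T m s.
Proof. by subst m. Qed.

Lemma ecast_clinear n m (e : n = m) : clinear (fun z : T n => ecast k (T k) e z).
Proof. by subst m; exact: clinear_id. Qed.

Lemma ecast_series n m (e : n = m) (x : tseries T) : ecast k (T k) e (x n) = x m.
Proof. by subst m. Qed.

Lemma ecast_shufop n m (e : n = m) ks (x : tseries T) :
  ecast k (T k) e (shufop ks (x n)) = shufop ks (x m).
Proof. by subst m. Qed.

End Slots.

Section TensorMaps.
Variables (R : realType) (V U : completeNormedModType R).
Variables (TV : tensor_powers V) (TU : tensor_powers U).

Lemma sum_shufflesn l (k : 'I_l -> nat) (y : TV (\sum_i k i)%N) :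
  \sum_(s in shufflesn k) tperm (s^-1)%g y = shufop [seq k q | q <- enum 'I_l] y.
Proof.
transitivity (\sum_(s in shufflesn k) tword (inverse_word s) y).
  by apply: eq_bigr => s _; rewrite tword_inverse_word.
rewrite (sum_shuffles (ks := [seq k q | q <- enum 'I_l]) (fun r => tword r y)) //.
  by rewrite sumnE big_map big_enum.
exact: shufflesn_index.
Qed.

(** The shuffle operator turns x^(k_1 + ... + k_l) into x^(k_1) (x) ... (x) x^(k_l), on which a
    tensor map acts factor by factor. Hence every term of [tpoly] is a tensor product of values of
    the form. *)
Lemma is_tensor_map_grouplike l (k : 'I_l -> nat) (c : forall i, TV (k i) -> U)
    (F : TV (\sum_i k i)%N -> TU l) (x : tseries TV) :
  (forall i, clinear (c i)) -> is_tensor_map c F -> grouplike x ->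
  F (\sum_(s in shufflesn k) tperm (s^-1)%g (x (\sum_i k i)%N)) =
  ptens TU (fun i => c i (x (k i))).
Proof.
move=> cC [FC Fpt] gx; rewrite sum_shufflesn.
pose cs : seq (slot TV U) := [seq Tagged (fun k => TV k -> U) (c q) | q <- enum 'I_l].
have ks_cs : [seq k q | q <- enum 'I_l] = map (@slot_deg _ _ TV U) cs.
  by rewrite /cs -[RHS]map_comp.
have e : sumn (map (@slot_deg _ _ TV U) cs) = (\sum_i k i)%N.
  by rewrite -ks_cs sumnE big_map big_enum.
(* The order is a sum over indices on one side and the sum of a list on the other; the cast is
   absorbed into the linear map [F]. *)
rewrite -(ecast_shufop e) ks_cs shufop_tprod //.
have szc : size cs = l by rewrite size_map size_enum_ord.
have nthc c0 (q : 'I_l) : nth c0 cs q = Tagged (fun k => TV k -> U) (c q).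
  by rewrite (nth_map q) ?size_enum_ord // nth_ord_enum.
have [x0 _] := (grouplikeP x).1 gx.
rewrite (@tprod_multilinear _ _ _ _ _ cs (fun z => F (ecast k (TV k) e z)) (pt TU l)) //.
- by rewrite ptE /cs -[in LHS]map_comp.
- move=> c0 q; rewrite szc => ql; rewrite (nthc c0 (Ordinal ql)).
  exact: cC.
- exact: (clinear_comp FC (ecast_clinear _ _)).
- by move=> s t; rewrite szc; exact: pt_slot.
move=> vs shvs; rewrite ecast_pt Fpt; congr (ptens TU _); apply/funext => q.
have szv : size vs = l by rewrite -(size_map size) -/(shape vs) shvs size_map.
have ql := ltn_ord q.
rewrite (nth_map (Tagged (fun k => TV k -> U) (c q), [::])); last first.
  by rewrite size_zip szc szv minnn.
rewrite nth_zip ?szc ?szv // nthc /slot_app /slot_deg /=; congr (c q _); congr (ptens TV _).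
apply/funext => j.
have h : tagnat.Rank q j = flatten_index (shape vs) q j :> nat.
  by rewrite shvs -ks_cs flatten_index_ord ?(ltnW ql) // tagnat.RankEsum.
have jq : (j < nth 0 (shape vs) q)%N.
  by rewrite shvs -ks_cs (nth_map q) ?size_enum_ord // nth_ord_enum.
rewrite -[LHS]/(nth 0 (flatten vs) (tagnat.Rank q j)) h.
by rewrite nth_flatten flatten_indexKl // flatten_indexKr.
Qed.

End TensorMaps.

(** * Uniqueness of the homogeneous components *)

Section Uniqueness.
Variables (R : realType) (V : completeNormedModType R) (T : tensor_powers V).

(** Subtracting 2^n times the value at a from the value at 2 a removes the leading term and
    multiplies the coefficient of degree k by 2^k - 2^n, nonzero for k < n. *)
Lemma polynomial_eq0 (Z : lmodType R) n (w : nat -> Z) :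
  (forall a : R, \sum_(k < n) a ^+ k *: w k = 0) -> forall k, (k < n)%N -> w k = 0.
Proof.
elim: n w => // n IH w h.
have low k : (k < n)%N -> w k = 0.
  move=> kn; have : (2 ^+ k - 2 ^+ n : R) *: w k = 0.
    apply: (IH (fun k => (2 ^+ k - 2 ^+ n : R) *: w k)) => // a.
    have := h (2 * a); rewrite big_ord_recr /= => h2.
    have := h a; rewrite big_ord_recr /= => /(congr1 (fun z => 2 ^+ n *: z)).
    rewrite scaler0 scalerDr scalerA -exprMn => h1.
    transitivity ((\sum_(i < n) (2 * a) ^+ i *: w i + (2 * a) ^+ n *: w n) -
      (2 ^+ n *: (\sum_(i < n) a ^+ i *: w i) + (2 * a) ^+ n *: w n)); last by rewrite h1 h2 subr0.
    rewrite opprD addrACA subrr addr0 scaler_sumr -sumrB; apply: eq_bigr => i _.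
    by rewrite !scalerA -scalerBl exprMn; congr (_ *: _); ring.
  move/eqP; rewrite scaler_eq0 => /orP[|/eqP//].
  by rewrite subr_eq0 lt_eqF // ltr_eXn2l // ltr1n.
move=> k; rewrite ltnS leq_eqVlt => /orP[/eqP->|/low//].
have := h 1; rewrite big_ord_recr /= expr1n scale1r big1 ?add0r // => i _.
by rewrite low // scaler0.
Qed.

(* For all real [a], [c] vanishes on the component of order k+1 of x (x) exp(a v);
   the coefficient of [a] is c(x_k (x) v), whence an induction on the order. *)
Lemma clinear_grouplike_eq0 (Z : normedModType R) k (c : T k -> Z) : clinear c ->
  (forall x, grouplike x -> c (x k) = 0) -> forall y, c y = 0.
Proof.
elim: k c => [|k IH] c cC hc.
  apply: (@clinear_pt_eq _ _ T Z 0 c (fun=> 0)) => //; first exact: clinear0.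
  move=> s /size0nil ->; rewrite -(hc _ (grouplike_tsexp T 0)).
  by rewrite /tsexp /= invr1 scale1r.
apply: (@clinear_pt_eq _ _ T Z k.+1 c (fun=> 0)) => //; first exact: clinear0.
move=> s sk; case/lastP: s sk => // s v; rewrite size_rcons => -[sk].
suff h : forall y : T k, c (tmulto k.+1 y (pt T 1 [:: v])) = 0.
  by rewrite -cats1 -[RHS](h (pt T k s)) tmulto_pt // addn1.
apply: IH.
  apply: (clinear_comp cC); exact: tmulto_clinearl.
move=> x gx.
pose w m := c (tmulto k.+1 (x (k.+1 - m)%N) (tsexp T v m)).
have := @polynomial_eq0 Z k.+2 w _ 1%N isT; rewrite /w subn1 /= /tsexp /= invr1 scale1r.
apply => a.
have := hc _ (grouplikeM gx (grouplike_dilate a (grouplike_tsexp T v))).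
rewrite (tsmulE (K := k.+2)) // exchange_big /= (linear_sum' cC.1) => h0.
rewrite -[RHS]h0; apply: eq_bigr => m _.
have mk := ltn_ord m.
have kmk : (k.+1 - m < k.+2)%N by rewrite ltnS leq_subr.
rewrite (bigD1 (Ordinal kmk)) //= big1 ?addr0; last first.
  move=> i im; rewrite tmulto_neq // => e; move/negP: im; apply; apply/eqP/val_inj => /=.
  by have := congr1 (subn^~ m) e; rewrite addnK.
by rewrite /dilate [in RHS](linearZ' (tmulto_linearr _ _)) [in RHS](linearZ' cC.1).
Qed.

(** Dilating a group-like series multiplies its order k by a^k and keeps it group-like, so the
    orders separate as coefficients of a polynomial in a. *)
Lemma homogeneous_unique (Z : normedModType R) D (c : forall k, T k -> Z) :
  (forall k, (k < D)%N -> clinear (c k)) ->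
  (forall x, grouplike x -> \sum_(k < D) c k (x k) = 0) ->
  forall k, (k < D)%N -> forall y, c k y = 0.
Proof.
move=> cC hc k kD; apply: (clinear_grouplike_eq0 (cC _ kD)) => x gx.
apply: (@polynomial_eq0 Z D (fun k => c k (x k)) _ k kD) => a.
rewrite -[RHS](hc _ (grouplike_dilate a gx)); apply: eq_bigr => i _.
by rewrite /dilate (linearZ' (cC _ (ltn_ord i)).1).
Qed.

Variable U : completeNormedModType R.

Lemma coefsP n (f : tseries T -> U) : in_E n f -> is_coefs n (coefs n f) f.
Proof. by move=> [c hc]; rewrite /coefs; case: xgetP => [g _ //|/(_ c)]. Qed.

Lemma coefs_unique n (f : tseries T -> U) c : is_coefs n c f ->
  forall k, (1 <= k <= n)%N -> forall y, coefs n f k y = c k y.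
Proof.
move=> hc; have [dC df] := coefsP (ex_intro _ c hc); have [cC cf] := hc => k /andP[k1 kn] y.
apply/eqP; rewrite -subr_eq0; apply/eqP.
case: k k1 kn y => // k _ kn y.
pose e k (y : T k) := if (k == 0)%N then 0 else coefs n f k y - c k y.
have eE j : (j < n.+1)%N -> clinear (e j).
  move=> jn; case: j jn => [|j] jn; first exact: clinear0.
  by apply: clinearB; [exact: dC|exact: cC].
apply: (@homogeneous_unique U n.+1 e eE _ k.+1) => // x gx.
rewrite big_ord_recl /= /e /= add0r.
have := df x gx; rewrite cf // => /eqP; rewrite eq_sym -subr_eq0 => /eqP h.
by rewrite -[RHS]h -sumrB big_add1 big_mkord; apply: eq_bigr.
Qed.

End Uniqueness.

(** * Fréchet derivatives *)

Section MeanValue.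
Variables (R : realType) (W : normedModType R).
Implicit Types (g : R -> W) (d : W).

Definition deriv_at g (t : R) d := forall eps : R, 0 < eps ->
  exists2 delta : R, 0 < delta &
    forall s, `|s| < delta -> `|g (t + s) - g t - s *: d| <= eps * `|s|.

Lemma deriv_atD g1 g2 t d1 d2 : deriv_at g1 t d1 -> deriv_at g2 t d2 ->
  deriv_at (fun t => g1 t + g2 t) t (d1 + d2).
Proof.
move=> h1 h2 eps eps0; have e2 : 0 < eps / 2 by rewrite divr_gt0.
have [a a0 ha] := h1 _ e2; have [b b0 hb] := h2 _ e2.
exists (Num.min a b); first by rewrite lt_min a0.
move=> s; rewrite lt_min => /andP[/ha k1 /hb k2].
have -> : g1 (t + s) + g2 (t + s) - (g1 t + g2 t) - s *: (d1 + d2) =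
  (g1 (t + s) - g1 t - s *: d1) + (g2 (t + s) - g2 t - s *: d2).
  by rewrite scalerDr; zmod_eq.
by apply: le_trans (ler_normD _ _) _; rewrite [eps]splitr mulrDl; exact: lerD.
Qed.

Lemma deriv_atZ (a : R) g t d : deriv_at g t d -> deriv_at (fun t => a *: g t) t (a *: d).
Proof.
move=> h eps eps0; have a1 : 0 < `|a| + 1 by rewrite ltr_wpDl.
have [b b0 hb] := h _ (divr_gt0 eps0 a1); exists b => // s /hb k.
rewrite scalerA mulrC -scalerA -!scalerBr normrZ.
apply: (@le_trans _ _ ((`|a| + 1) * (eps / (`|a| + 1) * `|s|))).
  by apply: ler_pM => //; rewrite lerDl.
by rewrite mulrA mulrCA divff ?mulr1 ?gt_eqF.
Qed.

Lemma deriv_atN g t d : deriv_at g t d -> deriv_at (fun t => - g t) t (- d).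
Proof.
move=> /(deriv_atZ (-1)); rewrite scaleN1r.
by have -> : (fun t => -1 *: g t) = (fun t => - g t) by apply/funext => s; rewrite scaleN1r.
Qed.

Lemma deriv_atB g1 g2 t d1 d2 : deriv_at g1 t d1 -> deriv_at g2 t d2 ->
  deriv_at (fun t => g1 t - g2 t) t (d1 - d2).
Proof. by move=> h1 h2; apply: deriv_atD => //; exact: deriv_atN. Qed.

Lemma deriv_at_cst (v : W) t : deriv_at (fun _ => v) t 0.
Proof. by move=> eps e0; exists 1 => // s _; rewrite subrr scaler0 subr0 normr0 mulr_ge0 // ltW. Qed.

Lemma deriv_at_sum I (r : seq I) (g : I -> R -> W) (d : I -> W) t :
  (forall i, deriv_at (g i) t (d i)) ->
  deriv_at (fun t => \sum_(i <- r) g i t) t (\sum_(i <- r) d i).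
Proof.
move=> h; elim: r => [|i r IH].
  have -> : (fun t => \sum_(i <- [::]) g i t) = (fun=> 0) by apply/funext => s; rewrite big_nil.
  by rewrite big_nil; exact: deriv_at_cst.
have -> : (fun t => \sum_(i <- i :: r) g i t) = (fun t => g i t + \sum_(i <- r) g i t).
  by apply/funext => s; rewrite big_cons.
by rewrite big_cons; exact: deriv_atD.
Qed.

Lemma deriv_at_exp r (v : W) t : deriv_at (fun t => t ^+ r *: v) t ((r%:R * t ^+ r.-1) *: v).
Proof.
elim: r => [|r IH].
  by rewrite mul0r scale0r; under [X in deriv_at X]eq_fun do rewrite expr0; exact: deriv_at_cst.
move=> eps eps0; set p := t ^+ r *: v; set p' := (r%:R * t ^+ r.-1) *: v in IH.
have c0 : 0 < `|t| + 1 by rewrite ltr_wpDl.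
have [a a0 ha] := IH _ (divr_gt0 eps0 (mulr_gt0 (ltr0n R 2) c0)).
set n := `|p'| + eps.
have n0 : 0 < n by rewrite /n ltr_wpDl.
exists (Num.min 1 (Num.min a (eps / 2 / n))).
  by rewrite !lt_min ltr01 a0 !divr_gt0.
move=> s; rewrite !lt_min => /and3P[s1 sa sn].
have {}ha := ha _ sa; set q := (t + s) ^+ r *: v - p - s *: p' in ha.
have -> : (t + s) ^+ r.+1 *: v - t ^+ r.+1 *: v - s *: ((r.+1%:R * t ^+ r.+1.-1) *: v) =
   (t + s) *: q + (s * s) *: p'.
  rewrite /q /p /p' !scalerBr !scalerA -!scalerBl -scalerDl; congr (_ *: _).
  rewrite !exprS /=; case: r {IH ha q p p' sn n n0} => [|r]; first by rewrite expr0; ring.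
  by rewrite /= !exprS -!natr1; ring.
clearbody p'.
apply: le_trans (ler_normD _ _) _; rewrite !normrZ [eps]splitr mulrDl; apply: lerD.
  have ts : `|t + s| <= `|t| + 1 by apply: le_trans (ler_normD _ _) _; rewrite lerD2l ltW.
  apply: le_trans (ler_pM _ _ ts ha) _ => //.
  by rewrite le_eqVlt; apply/orP; left; apply/eqP; field; rewrite gt_eqF.
apply: (@le_trans _ _ ((`|p'| * `|s|) * `|s|)).
  by rewrite le_eqVlt; apply/orP; left; apply/eqP; rewrite ?normrM; ring.
apply: ler_wpM2r => //.
have pn : `|p'| <= n by rewrite /n lerDl ltW.
apply: (@le_trans _ _ (n * (eps / 2 / n))).
  by apply: ler_pM => //; rewrite ltW.
by rewrite mulrCA divff ?mulr1 ?gt_eqF.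
Qed.

(** For e > 0 let c be the supremum of the t in [0, T] at which the bound holds with slope K + e.
    Differentiability at c bounds the slope near c by K + e: used on the left, it shows that c
    satisfies the bound; used on the right, that the bound would pass beyond c if c < T. *)
Lemma mean_value g (dg : R -> W) (T K : R) : 0 <= T ->
  (forall t, 0 <= t <= T -> deriv_at g t (dg t)) ->
  (forall t, 0 <= t <= T -> `|dg t| <= K) ->
  `|g T - g 0| <= K * T.
Proof.
move=> T0 dgP dgK; have K0 : 0 <= K by apply: le_trans (dgK 0 _); rewrite // lexx.
rewrite -subr_le0; apply/ler_addgt0Pl => e0 e0P; rewrite addr0.
have T1 : 0 < T + 1 by rewrite ltr_wpDl.
pose e := e0 / (T + 1); have eP : 0 < e by rewrite divr_gt0.
suff h : `|g T - g 0| <= (K + e) * T.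
  rewrite lerBlDr; apply: le_trans h _; rewrite mulrDl addrC lerD2r /e.
  rewrite -mulrA -[leRHS]mulr1 ler_pM2l // mulrC ler_pdivrMr // mul1r lerDl //.
pose S := [set t : R | 0 <= t <= T /\ `|g t - g 0| <= (K + e) * t].
have S0 : S 0 by split; rewrite ?lexx ?T0 // subrr normr0 mulr0.
have Sub : ubound S T by move=> t [/andP[]].
have hS : has_sup S by split; [exists 0|exists T].
pose c := sup S.
have c0 : 0 <= c by apply: ub_le_sup; [exists T|].
have cT : c <= T by apply: ge_sup; [exists 0|].
have cin : 0 <= c <= T by rewrite c0.
have [d d0 hd] := dgP _ cin _ eP.
have lip s : `|s| < d -> `|g (c + s) - g c| <= (K + e) * `|s|.
  move=> /hd h; rewrite -[g (c + s) - g c](subrK (s *: dg c)).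
  apply: le_trans (ler_normD _ _) _; rewrite addrC mulrDl; apply: lerD => //.
  by rewrite normrZ mulrC ler_wpM2r // dgK.
have Ke : 0 <= K + e by rewrite addr_ge0 // ltW.
have Sc : `|g c - g 0| <= (K + e) * c.
  have [t [tT tS] ct] := sup_adherent d0 hS.
  have tc : t <= c by apply: ub_le_sup; [exists T|].
  rewrite -/c in ct.
  have := lip (t - c); rewrite (addrC c) subrK distrC ger0_norm ?subr_ge0 // => /(_ _) h.
  rewrite -[g c - g 0](subrKA (g t)); apply: le_trans (ler_normD _ _) _.
  apply: (@le_trans _ _ ((K + e) * (c - t) + (K + e) * t)); last by rewrite -mulrDr subrK.
  by apply: lerD => //; rewrite distrC; apply: h; lra.
have [->//|cneT] := eqVneq T c; have cltT : c < T by rewrite lt_neqAle eq_sym cneT.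
pose s := Num.min (d / 2) (T - c).
have s0 : 0 < s by rewrite lt_min divr_gt0 // subr_gt0.
have sd : s < d by rewrite gt_min; apply/orP; left; lra.
have sT : s <= T - c by rewrite ge_min lexx orbT.
have : S (c + s).
  split; first by apply/andP; split; lra.
  rewrite -[g _ - g 0](subrKA (g c)); apply: le_trans (ler_normD _ _) _.
  rewrite addrC mulrDr; apply: lerD => //.
  by have := lip s; rewrite (ger0_norm (ltW s0)); apply.
move=> /(ub_le_sup (ex_intro _ T Sub)); rewrite -/c; lra.
Qed.

End MeanValue.

Section ScalarPart.
Variables (R : realType) (U : completeNormedModType R) (TU : tensor_powers U).

Lemma pt0_norm : `|pt TU 0 [::]| = 1. Proof. exact: ptens0_norm. Qed.

Lemma pt0_neq0 : pt TU 0 [::] != 0.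
Proof. by rewrite -normr_eq0 pt0_norm oner_neq0. Qed.

Lemma ptens0E (v : 'I_0 -> U) : ptens TU v = pt TU 0 [::].
Proof. by congr (ptens TU _); apply/funext => -[]. Qed.

(** Algebraic tensors of order 0 are multiples of the unit. Those close to w have bounded
    coefficients, so they lie in the image of a segment, which is compact and hence closed, and
    contains w. *)
Lemma tpow0_scalar (w : TU 0%N) : exists a : R, w = a *: pt TU 0 [::].
Proof.
set one := pt TU 0 [::].
pose r := `|w| + 1.
pose K := (fun a : R => a *: one) @` [set` `[- r, r]].
have Kc : compact K.
  apply: continuous_compact; last exact: segment_compact.
  apply: continuous_subspaceT => a.
  by apply: cvgZr_tmp; exact: cvg_id.
have cK : closed K by apply: compact_closed => //; exact: norm_hausdorff.
suff : closure K w.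
  by move/cK => [a _ <-]; exists a.
have : closure [set x : TU 0%N | exists m (c : 'I_m -> R) (v : 'I_m -> 'I_0 -> U),
      x = \sum_j c j *: ptens TU (v j)] w by rewrite ptens_dense.
move=> wS A Aw; have [y [[m [c [v yE]]]]] := wS _ (filterI Aw (nbhsx_ballx w 1 ltr01)).
rewrite -ball_normE /= => -[Ay wy]; exists y; split=> //.
exists (\sum_j c j).
  rewrite /= in_itv /= -ler_norml.
  have : `|y| <= r.
    have -> : y = w - (w - y) by rewrite opprB addrC subrK.
    by apply: le_trans (ler_normB _ _) _; rewrite lerD2l ltW.
  have -> : y = (\sum_j c j) *: one.
    by rewrite yE scaler_suml; apply: eq_bigr => j _; rewrite ptens0E.
  by rewrite normrZ pt0_norm mulr1.
by rewrite yE scaler_suml; apply: eq_bigr => j _; rewrite ptens0E.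
Qed.

Lemma scalar_partE (w : TU 0%N) : w = scalar_part w *: pt TU 0 [::].
Proof.
rewrite /scalar_part; case: xgetP => [a _ /= {1}->|]; first by rewrite ptens0E.
by have [a wa] := tpow0_scalar w => /(_ a); rewrite /= ptens0E; case.
Qed.

Lemma scalar_part1 : scalar_part (pt TU 0 [::]) = 1.
Proof.
have := scalar_partE (pt TU 0 [::]); rewrite -[LHS]scale1r => /eqP.
by rewrite -subr_eq0 -scalerBl scaler_eq0 (negPf pt0_neq0) orbF subr_eq0 => /eqP.
Qed.

Lemma scalar_part_bounded : linear_bounded 1 (fun w : TU 0%N => scalar_part w : R).
Proof.
split=> [a x y|w].
  have e : (scalar_part (a *: x + y) - (a * scalar_part x + scalar_part y)) *: pt TU 0 [::] = 0.
    rewrite scalerBl -scalar_partE scalerDl -scalerA -!scalar_partE.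
    by rewrite subrr.
  by move/eqP: e; rewrite scaler_eq0 (negPf pt0_neq0) orbF subr_eq0 => /eqP.
by rewrite mul1r [in leRHS](scalar_partE w) normrZ pt0_norm mulr1.
Qed.

End ScalarPart.

Section Frechet.
Variables (R : realType) (U W : completeNormedModType R) (TU : tensor_powers U).
Variables (phi : U -> W) (N : nat).
Hypothesis phiN : frechet_differentiable TU phi N.

Local Notation D l u w := (frechet phi (TU := TU) (l := l) u w).
Local Notation "e @@ w" := (tmulto _ (pt TU 1 [:: e]) w) (at level 30).

Lemma frechet_nextP l u : (l < N)%N ->
  is_frechet (frechet phi (TU := TU) (l := l)) u (frechet phi (l := l.+1) u).
Proof.
by move=> lN /=; case: xgetP => // h; have [B /h] := phiN lN u.
Qed.

Lemma frechet_clinear l u : (l <= N)%N -> clinear (frechet phi (TU := TU) (l := l) u).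
Proof.
case: l => [|l] lN; last by have [] := frechet_nextP u lN.
have [sL sK] := scalar_part_bounded TU.
apply: (@linear_bounded_clinear _ _ _ `|phi u|); split=> [a x y|w] /=.
  by rewrite sL scalerDl scalerA.
rewrite normrZ mulrC ler_wpM2l //.
by have := sK w; rewrite mul1r.
Qed.

Lemma pt1E (e : U) : ptens TU (fun _ : 'I_1 => e) = pt TU 1 [:: e].
Proof. by congr (ptens TU _); apply/funext => i; rewrite ord1. Qed.

Lemma frechet_expansion l u eps : (l < N)%N -> 0 < eps ->
  exists2 delta : R, 0 < delta & forall e (w : TU l), `|e| < delta ->
    `|D l (u + e) w - D l u w - D l.+1 u (e @@ w)| <= eps * `|e| * `|w|.
Proof.
move=> lN eps0; have [BC /(_ _ eps0)] := frechet_nextP u lN.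
move=> /nbhs_ballP [d /= d0 hd]; exists d => // e w ed.
have := hd e; rewrite -ball_normE /= sub0r normrN => /(_ ed) h.
pose f (w : TU l) := D l (u + e) w - D l u w - D l.+1 u (tmul (ptens TU (fun _ : 'I_1 => e)) w).
have fC : clinear f.
  apply: clinearB; first by apply: clinearB; apply: frechet_clinear; exact: ltnW.
  apply: (clinear_comp BC).
  apply: (@linear_bounded_clinear _ _ _ `|ptens TU (fun _ : 'I_1 => e)|).
  by split; [exact: (@tmul_linearr _ _ TU 1 l)|move=> x; exact: (@tmul_norm _ _ TU 1 l)].
have [_ /(_ w) fw] := clinear_linear_bounded fC.
have -> : e @@ w = tmul (ptens TU (fun _ : 'I_1 => e)) w by rewrite pt1E -tmulto_tmul.
by apply: le_trans fw _; apply: ler_wpM2r.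
Qed.

Lemma ten_clinearl (l : nat) (w : TU l) : clinear (fun e : U => e @@ w : TU l.+1).
Proof. exact/clinear_tmultol/(linear_bounded_clinear (pt1_bounded TU)). Qed.

Lemma ten_norm l (e : U) (w : TU l) : `|e @@ w : TU l.+1| <= `|e| * `|w|.
Proof.
apply: le_trans (tmulto_norm _ _ _) _; apply: ler_wpM2r => //.
by have [_ /(_ e)] := pt1_bounded TU; rewrite mul1r.
Qed.

Lemma tenZ l (a : R) (e : U) (w : TU l) : (a *: e) @@ w = a *: (e @@ w) :> TU l.+1.
Proof. exact: (linearZ' (ten_clinearl w).1). Qed.

Lemma frechet_curve l u e (w : TU l) t : (l < N)%N ->
  deriv_at (fun t : R => D l (u + t *: e) w) t (D l.+1 (u + t *: e) (e @@ w)).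
Proof.
move=> lN eps eps0.
have c0 : 0 < `|e| * `|w| + 1 by rewrite ltr_wpDl // mulr_ge0.
have [d d0 hd] := frechet_expansion (u + t *: e) lN (divr_gt0 eps0 c0).
have e1 : 0 < `|e| + 1 by rewrite ltr_wpDl.
exists (d / (`|e| + 1)); first by rewrite divr_gt0.
move=> s; rewrite ltr_pdivlMr // => sd.
have se : `|s *: e| < d.
  by rewrite normrZ; apply: le_lt_trans sd; rewrite ler_wpM2l // lerDl.
have := hd _ w se; rewrite tenZ (linearZ' (frechet_clinear _ _).1) //.
have -> : u + t *: e + s *: e = u + (t + s) *: e by rewrite -addrA -scalerDl.
move=> h; apply: le_trans h _; rewrite normrZ.
apply: (@le_trans _ _ (eps * `|s| * ((`|e| * `|w|) / (`|e| * `|w| + 1)))).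
  by rewrite le_eqVlt; apply/orP; left; apply/eqP; field; rewrite gt_eqF.
rewrite -[leRHS]mulr1; apply: ler_wpM2l; first by rewrite mulr_ge0 // ltW.
by rewrite ler_pdivrMr // mul1r lerDl.
Qed.

(** The difference of D^l at u + t h and at u is followed along t k. The mean value inequality
    brings in D^(l+1) at two points close to u; in their expansions at u the linear terms differ by
    t h, and this is the second derivative. *)
Lemma second_difference l u h k (w : TU l) eps : (l.+1 < N)%N -> 0 < eps ->
  exists2 delta : R, 0 < delta & forall t : R, 0 < t -> t < delta ->
    `|D l (u + t *: h + t *: k) w - D l (u + t *: h) w - D l (u + t *: k) w + D l u w
      - (t * t) *: D l.+2 u (h @@ (k @@ w : TU l.+1))| <= eps * (t * t).
Proof.
(* The sum of the norms of the two points at which D^(l+1) is expanded is at most t (|h| + 2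
   |k|). *)
move=> lN eps0; pose c := (`|h| + 2 * `|k|) * `|k @@ w : TU l.+1|.
have c0 : 0 <= c by rewrite mulr_ge0 // addr_ge0 // mulr_ge0.
have c1 : 0 < c + 1 by rewrite ltr_wpDl.
have [d d0 hd] := frechet_expansion u lN (divr_gt0 eps0 c1).
have n1 : 0 < `|h| + `|k| + 1 by rewrite ltr_wpDl // addr_ge0.
exists (d / (`|h| + `|k| + 1)); first by rewrite divr_gt0.
move=> t t0; rewrite ltr_pdivlMr // => td.
set B := D l.+2 u (h @@ (k @@ w : TU l.+1)).
pose B2 e := D l.+2 u (e @@ (k @@ w : TU l.+1)).
have B2C : clinear B2 := clinear_comp (frechet_clinear u lN) (ten_clinearl (k @@ w : TU l.+1)).
have lN' : (l < N)%N by exact: ltnW.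
pose g s := D l (u + t *: h + s *: (t *: k)) w - D l (u + s *: (t *: k)) w - s *: ((t * t) *: B).
pose dg s := D l.+1 (u + t *: h + s *: (t *: k)) ((t *: k) @@ w)
   - D l.+1 (u + s *: (t *: k)) ((t *: k) @@ w) - (t * t) *: B.
have -> : D l (u + t *: h + t *: k) w - D l (u + t *: h) w - D l (u + t *: k) w + D l u w - (t * t) *: B = g 1 - g 0.
  rewrite /g !scale1r !scale0r !addr0.
  by zmod_eq.
have gP s : 0 <= s <= 1 -> deriv_at g s (dg s).
  move=> _; apply: deriv_atB; first by apply: deriv_atB; exact: frechet_curve.
  have := @deriv_at_exp _ W 1 ((t * t) *: B) s; rewrite expr0 mulr1 scale1r.
  by have -> : (fun t0 : R => t0 ^+ 1 *: (t * t *: B)) = (fun t0 => t0 *: (t * t *: B)) by apply/funext.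
suff dgK s : 0 <= s <= 1 -> `|dg s| <= eps * (t * t).
  by have := mean_value ler01 gP dgK; rewrite mulr1.
move=> /andP[s0 s1].
pose r e := D l.+1 (u + e) (k @@ w) - D l.+1 u (k @@ w) - B2 e.
have rE e : `|e| <= t * (`|h| + `|k|) -> `|r e| <= eps / (c + 1) * `|e| * `|k @@ w : TU l.+1|.
  move=> et; apply: hd; apply: le_lt_trans et _.
  by apply: lt_trans td; rewrite ltr_pM2l // ltrDl.
have -> : dg s = t *: (r (t *: h + s *: (t *: k)) - r (s *: (t *: k))).
  rewrite /dg /r !tenZ !(linearZ' (frechet_clinear _ _).1) // -scalerA -!scalerBr; congr (_ *: _).
  rewrite (_ : B = B2 h) // (linearD' B2C.1) (linearZ' B2C.1 t h).
  rewrite [u + (_ + _)]addrA.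
  zmod_eq.
have -> : eps * (t * t) = t * (eps * t) by ring.
rewrite normrZ gtr0_norm // ler_pM2l //.
have hk : 0 <= `|h| + `|k| by exact: addr_ge0.
have sk : `|s *: (t *: k)| <= t * `|k|.
  by rewrite !normrZ (ger0_norm s0) (gtr0_norm t0) -[leRHS]mul1r ler_wpM2r // mulr_ge0 // ltW.
have n2 : `|s *: (t *: k)| <= t * (`|h| + `|k|).
  by apply: le_trans sk _; rewrite ler_pM2l // lerDr.
have n3 : `|t *: h + s *: (t *: k)| <= t * (`|h| + `|k|).
  by apply: le_trans (ler_normD _ _) _; rewrite mulrDr normrZ (gtr0_norm t0) lerD2l.
apply: le_trans (ler_normB _ _) _.
apply: le_trans (lerD (rE _ n3) (rE _ n2)) _.
rewrite -mulrDl -mulrDr -mulrA.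
apply: (@le_trans _ _ (eps / (c + 1) * (t * c))).
  rewrite ler_pM2l ?divr_gt0 // /c mulrA ler_wpM2r //.
  have -> : t * (`|h| + 2 * `|k|) = t * (`|h| + `|k|) + t * `|k| by ring.
  exact: lerD.
have -> : eps / (c + 1) * (t * c) = eps * t * (c / (c + 1)) by field; rewrite gt_eqF.
rewrite -[leRHS]mulr1 ler_pM2l ?mulr_gt0 //.
by rewrite ler_pdivrMr // mul1r lerDl.
Qed.

End Frechet.

Lemma deriv_at_unique (R : realType) (W : normedModType R) (g : R -> W) t d d' :
  deriv_at g t d -> deriv_at g t d' -> d = d'.
Proof.
move=> h h'; apply/eqP; rewrite -subr_eq0 -normr_le0; apply/ler_addgt0Pl => e e0; rewrite addr0.
have e2 : 0 < e / 2 by rewrite divr_gt0.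
have [a a0 ha] := h _ e2; have [b b0 hb] := h' _ e2.
pose s := Num.min a b / 2.
have m0 : 0 < Num.min a b by rewrite lt_min a0.
have s0 : 0 < s by rewrite divr_gt0.
have sm : s < Num.min a b by rewrite /s; lra.
move: sm; rewrite lt_min => /andP[sa sb].
have := ha s; have := hb s; rewrite gtr0_norm // => /(_ sb) kb /(_ sa) ka.
have : `|s *: (d - d')| <= e * s.
  have -> : s *: (d - d') = (g (t + s) - g t - s *: d') - (g (t + s) - g t - s *: d).
    by rewrite scalerBr; zmod_eq.
  apply: le_trans (ler_normB _ _) _; rewrite [e]splitr mulrDl; exact: lerD.
by rewrite normrZ gtr0_norm // mulrC ler_pM2r.
Qed.

Section FrechetSymmetry.
Variables (R : realType) (U W : completeNormedModType R) (TU : tensor_powers U).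
Variables (phi : U -> W) (N : nat).
Hypothesis phiN : frechet_differentiable TU phi N.

Local Notation D l u w := (frechet phi (TU := TU) (l := l) u w).
Local Notation "e @@ w" := (tmulto _ (pt TU 1 [:: e]) w) (at level 30).

(** The second difference along t h and t k is symmetric in h and k, and both sides are its limit
    after division by t^2. *)
Lemma frechet_swap l u h k (w : TU l) : (l.+1 < N)%N ->
  D l.+2 u (h @@ (k @@ w : TU l.+1)) = D l.+2 u (k @@ (h @@ w : TU l.+1)).
Proof.
move=> lN; set B1 := LHS; set B2 := RHS.
apply/eqP; rewrite -subr_eq0 -normr_le0; apply/ler_addgt0Pl => e e0; rewrite addr0.
have e2 : 0 < e / 2 by rewrite divr_gt0.
have [a a0 ha] := second_difference phiN u h k w lN e2.
have [b b0 hb] := second_difference phiN u k h w lN e2.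
pose s := Num.min a b / 2.
have m0 : 0 < Num.min a b by rewrite lt_min a0.
have s0 : 0 < s by rewrite divr_gt0.
have sm : s < Num.min a b by rewrite /s; lra.
move: sm; rewrite lt_min => /andP[sa sb].
have {}ha := ha _ s0 sa; have {}hb := hb _ s0 sb.
rewrite -/B1 in ha; rewrite -/B2 in hb.
have : `|(s * s) *: (B1 - B2)| <= e * (s * s).
  rewrite [u + _ + _]addrAC in hb.
  move: ha hb; set x1 := D l _ w; set x2 := D l _ w; set x3 := D l _ w; set x4 := D l _ w => ha hb.
  clearbody x1 x2 x3 x4 B1 B2.
  have -> : (s * s) *: (B1 - B2) = (x1 - x3 - x2 + x4 - (s * s) *: B2) - (x1 - x2 - x3 + x4 - (s * s) *: B1).
    by rewrite scalerBr; zmod_eq.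
  apply: le_trans (ler_normB _ _) _; rewrite [e]splitr mulrDl; exact: lerD.
by rewrite normrZ gtr0_norm ?mulr_gt0 // mulrC ler_pM2r ?mulr_gt0.
Qed.

(** Both sides are the derivative along e of the same function of the base point. *)
Lemma frechet_pt_tail l e s t : (l < N)%N ->
  (forall u, D l u (pt TU l s) = D l u (pt TU l t)) ->
  forall u, D l.+1 u (pt TU l.+1 (e :: s)) = D l.+1 u (pt TU l.+1 (e :: t)).
Proof.
move=> lN st u; rewrite !(pt_cons TU l e).
have h1 := frechet_curve phiN u e (pt TU l s) 0 lN.
have h2 := frechet_curve phiN u e (pt TU l t) 0 lN.
rewrite scale0r addr0 in h1 h2.
apply: deriv_at_unique h1 _.
by have -> : (fun t0 : R => D l (u + t0 *: e) (pt TU l s)) = (fun t0 : R => D l (u + t0 *: e) (pt TU l t)) by apply/funext => r.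
Qed.

(** [frechet_swap] exchanges x with its neighbour y; the rest of the move takes place behind y,
    where symmetry in order l applies. *)
Lemma frechet_pt_insert l x s t : (l < N)%N -> (size s + size t)%N = l ->
  (forall u s t, size s = l -> perm_eq s t -> D l u (pt TU l s) = D l u (pt TU l t)) ->
  forall u, D l.+1 u (pt TU l.+1 (x :: s ++ t)) = D l.+1 u (pt TU l.+1 (s ++ x :: t)).
Proof.
case: s => [//|y s]; case: l => [|l'] lN // [sl] IH u.
transitivity (D l'.+2 u (pt TU l'.+2 (y :: x :: s ++ t))).
  by rewrite !(pt_cons TU l'.+1) !(pt_cons TU l') frechet_swap.
apply: frechet_pt_tail => // v; apply: IH.
  by rewrite /= size_cat sl.
by rewrite -cat1s perm_sym -[x :: t]cat1s perm_catCA.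
Qed.

Lemma frechet_pt_perm l u s t : (l <= N)%N -> size s = l -> perm_eq s t ->
  D l u (pt TU l s) = D l u (pt TU l t).
Proof.
elim: l u s t => [|l IH] u s t lN sl pst.
  by move: sl pst => /size0nil ->; rewrite perm_sym => /perm_nilP ->.
case: s sl pst => // x s [sl] pst.
have xt : x \in t by rewrite -(perm_mem pst) inE eqxx.
case/splitPr: xt pst => t1 t2 pst.
have pst' : perm_eq s (t1 ++ t2).
  by move: pst; rewrite -[x :: t2]cat1s perm_sym perm_catCA perm_sym /= perm_cons.
have IH' v s' t' : size s' = l -> perm_eq s' t' -> D l v (pt TU l s') = D l v (pt TU l t').
  by move=> h1 h2; apply: IH => //; exact: ltnW.
rewrite -frechet_pt_insert //; last by rewrite -size_cat -(perm_size pst').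
by apply: frechet_pt_tail => // v; apply: IH'.
Qed.

Lemma frechet_nseq_cons m r u e (w : TU m) :
  D (r + m.+1) u (tmulto (r + m.+1) (pt TU r (nseq r e)) (e @@ w : TU m.+1)) =
  D (r.+1 + m) u (tmulto (r.+1 + m) (pt TU r.+1 (nseq r.+1 e)) w).
Proof.
rewrite addnS -[RHS]/(D (r + m).+1 u (tmulto (r + m).+1 (pt TU r.+1 (nseq r.+1 e)) w)).
congr (frechet phi u _).
transitivity (tmulto (r + m).+1 (tmulto (r + 1) (pt TU r (nseq r e)) (pt TU 1 [:: e])) w).
  exact: (esym (@tmultoA _ _ TU (r + m).+1 r 1 m (pt TU r (nseq r e)) (pt TU 1 [:: e]) w)).
by rewrite tmulto_pt ?size_nseq // -(nseqD r 1) addn1.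
Qed.

(** The t-derivative of the remainder of order m at w is the remainder of order m + 1 at e (x) w, so
    the mean value inequality gives an induction on j = n - m. For j = 0 the remainder is the
    Hoelder difference; the powers of t are bounded by 1. *)
Lemma frechet_taylor_aux n u e (H : R) j m (t : R) (w : TU m) : (n <= N)%N ->
  (m + j)%N = n -> 0 <= H ->
  (forall t (w : TU n), 0 <= t <= 1 -> `|D n (u + t *: e) w - D n u w| <= H * `|w|) ->
  0 <= t <= 1 ->
  `|D m (u + t *: e) w - \sum_(r < j.+1) t ^+ r *: ((r`!%:R)^-1 *:
      D (r + m) u (tmulto (r + m) (pt TU r (nseq r e)) w))| <= H * `|e| ^+ j * `|w|.
Proof.
move=> nN + H0 hH; elim: j m t w => [|j IH] m t w mj t01.
  rewrite addn0 in mj; subst m.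
  by rewrite big_ord1 /= expr0 scale1r invr1 scale1r tmulto1l mulr1 hH.
have mN : (m < N)%N by rewrite (leq_trans _ nN) // -mj addnS ltnS leq_addr.
pose A r : W := (r`!%:R)^-1 *: D (r + m) u (tmulto (r + m) (pt TU r (nseq r e)) w).
pose g (t : R) := D m (u + t *: e) w - \sum_(r < j.+2) t ^+ r *: A r.
pose dg (t : R) := D m.+1 (u + t *: e) (e @@ w) - \sum_(r < j.+2) (r%:R * t ^+ r.-1) *: A r.
have gP s : 0 <= s <= t -> deriv_at g s (dg s).
  move=> _; apply: deriv_atB; first exact: (frechet_curve phiN).
  by apply: deriv_at_sum => r; exact: deriv_at_exp.
have g0 : g 0 = 0.
  rewrite /g big_ord_recl /= expr0 scale1r scale0r addr0 /A /= invr1 scale1r tmulto1l.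
  by rewrite big1 ?addr0 ?subrr // => i _; rewrite expr0n /= scale0r.
rewrite -[X in `|X|]/(g t) -[g t]subr0 -g0.
have /andP[t0 t1] := t01.
apply: (@le_trans _ _ (H * `|e| ^+ j.+1 * `|w| * t)); last first.
  by rewrite ler_piMr // !mulr_ge0 // exprn_ge0.
apply: (mean_value t0 gP) => s /andP[s0 st].
have := IH m.+1 s (e @@ w) _ _; rewrite -mj addnS addSn => /(_ erefl) h.
have s01 : 0 <= s <= 1 by rewrite s0 (le_trans st t1).
have {h} := h s01.
have -> : D m.+1 (u + s *: e) (e @@ w) - \sum_(r < j.+1) s ^+ r *: ((r`!%:R)^-1 *:
   D (r + m.+1) u (tmulto (r + m.+1) (pt TU r (nseq r e)) (e @@ w : TU m.+1))) = dg s.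
  rewrite /dg; congr (_ - _); rewrite [RHS]big_ord_recl [X in _ = X + _](_ : _ = 0) ?add0r; last by rewrite mul0r scale0r.
  apply: eq_bigr => r _; rewrite frechet_nseq_cons lift0.
  have -> : A r.+1 = (r.+1`!%:R)^-1 *: D (r.+1 + m) u (tmulto (r.+1 + m) (pt TU r.+1 (nseq r.+1 e)) w) by [].
  rewrite !scalerA; congr (_ *: _); rewrite factS natrM invfM -pred_Sn.
  have r0 : (r.+1%:R : R) != 0 by rewrite pnatr_eq0.
  by field; rewrite nat1r r0 pnatr_eq0 -lt0n fact_gt0.
move=> h; apply: le_trans h _.
rewrite exprSr -!mulrA ler_wpM2l // ler_wpM2l ?exprn_ge0 //.
exact: ten_norm.
Qed.

Lemma frechet_taylor n u e (H : R) m (w : TU m) : (n <= N)%N ->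
  (m <= n)%N -> 0 <= H ->
  (forall t (w : TU n), 0 <= t <= 1 -> `|D n (u + t *: e) w - D n u w| <= H * `|w|) ->
  `|D m (u + e) w - \sum_(r < (n - m).+1) (r`!%:R)^-1 *:
      D (r + m) u (tmulto (r + m) (pt TU r (nseq r e)) w)| <= H * `|e| ^+ (n - m) * `|w|.
Proof.
move=> nN mn H0 hH; have := frechet_taylor_aux w nN (subnKC mn) H0 hH.
move=> /(_ 1); rewrite ler01 lexx scale1r => /(_ isT).
by under eq_bigr do rewrite expr1n scale1r.
Qed.

Lemma frechet_lipschitz l u e (K : R) (w : TU l) : (l < N)%N ->
  (forall t (w : TU l.+1), 0 <= t <= 1 -> `|D l.+1 (u + t *: e) w| <= K * `|w|) -> 0 <= K ->
  `|D l (u + e) w - D l u w| <= K * `|e| * `|w|.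
Proof.
move=> lN hK K0.
have := @mean_value R W (fun t : R => D l (u + t *: e) w) (fun t => D l.+1 (u + t *: e) (e @@ w)) 1 (K * `|e| * `|w|) ler01.
rewrite scale1r scale0r addr0 mulr1; apply=> [t _|t t01]; first exact: (frechet_curve phiN).
apply: le_trans (hK _ _ t01) _; rewrite -mulrA ler_wpM2l //; exact: ten_norm.
Qed.

End FrechetSymmetry.

(** * Sewing *)

Section Sewing.
Variables (R : realType) (U : completeNormedModType R).
Variables (mu : R -> R -> U).
Variables (w : R -> R -> R) (C theta : R).
Hypothesis w_ge0 : forall s t, 0 <= s -> s <= t -> t <= 1 -> 0 <= w s t.
Hypothesis w_diag : forall s, 0 <= s -> s <= 1 -> w s s = 0.
Hypothesis w_add : forall s u t, 0 <= s -> s <= u -> u <= t -> t <= 1 -> w s u + w u t <= w s t.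
Hypothesis theta1 : 1 < theta.
Hypothesis C_ge0 : 0 <= C.

Fixpoint rsum (s : R) (D : seq R) : U :=
  if D is x :: D' then mu s x + rsum x D' else 0.

Lemma rsum_cat s D1 D2 : rsum s (D1 ++ D2) = rsum s D1 + rsum (last s D1) D2.
Proof. by elim: D1 s => [|x D1 IH] s /=; rewrite ?add0r // IH addrA. Qed.

Lemma path_ge_last (s : R) D x : path <%R s D -> x \in s :: D -> s <= x <= last s D.
Proof.
elim: D s x => [|y D IH] s x /=; first by rewrite inE => _ /eqP->; rewrite lexx.
move=> /andP[sy pD]; rewrite inE => /orP[/eqP->|].
  by rewrite lexx /=; have /andP[_] := IH y y pD (mem_head _ _); apply: le_trans; exact: ltW.
by move/(IH _ _ pD)/andP => [yx ->]; rewrite andbT (le_trans (ltW sy)).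
Qed.

Lemma path_le_last (s : R) D : path <%R s D -> s <= last s D.
Proof. by move=> pD; have /andP[] := path_ge_last pD (mem_head _ _). Qed.

Lemma w_le s s' t' t : 0 <= s -> s <= s' -> s' <= t' -> t' <= t -> t <= 1 -> w s' t' <= w s t.
Proof.
move=> s0 ss' st' tt' t1.
have h1 : w s s' + w s' t <= w s t by apply: w_add => //; exact: le_trans tt'.
have h2 : w s' t' + w t' t <= w s' t by apply: w_add => //; exact: le_trans ss'.
have h3 : 0 <= w s s' by apply: w_ge0 => //; apply: le_trans t1; exact: le_trans tt'.
have h4 : 0 <= w t' t by apply: w_ge0 => //; apply: le_trans st'; exact: le_trans ss'.
lra.
Qed.

(** [D1] accumulates points while the control from s stays at most h. At the first x with w s x > h,
    superadditivity leaves w x t <= h; if there is none, x is the endpoint t, where w t t = 0. *)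
Lemma half_split (s t h : R) D1 D : path <%R s (D1 ++ D) -> last s (D1 ++ D) = t ->
  0 <= s -> t <= 1 -> D <> [::] -> w s (last s D1) <= h -> w s t <= 2 * h -> 0 <= h ->
  exists E1 x E2, [/\ D1 ++ D = E1 ++ x :: E2, w s (last s E1) <= h & w x t <= h].
Proof.
move=> pD lD s0 t1 + + wh h0; elim: D D1 pD lD => // x D IH D1 pD lD _ wD1.
have xin : s <= x <= t.
  by rewrite -lD; apply: (path_ge_last pD); rewrite inE mem_cat mem_head !orbT.
have /andP[sx xt] := xin.
have add := w_add s0 sx xt t1.
have [wx|wx] := leP (w s x) h; last first.
  by exists D1, x, D; split => //; lra.
case: D IH pD lD => [|y D] IH pD lD.
  exists D1, x, [::]; split => //.
  have -> : x = t by rewrite -lD last_cat.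
  by rewrite w_diag // (le_trans s0) // (le_trans sx).
have pD' : path <%R s (rcons D1 x ++ y :: D) by rewrite cat_rcons.
have lD' : last s (rcons D1 x ++ y :: D) = t by rewrite cat_rcons.
have [//||E1 [z [E2 [e1 e2 e3]]]] := IH _ pD' lD'; first by rewrite last_rcons.
by exists E1, z, E2; split => //; rewrite -e1 cat_rcons.
Qed.

(** The solution k of k = 2 * 2^-theta * k + 2 * C: two parts with half the control, and two uses of
    almost additivity. *)
Definition sew_const : R := 2 * C / (1 - 2 * 2^-1 `^ theta).

Lemma half_pow_lt1 : 2 * 2^-1 `^ theta < 1 :> R.
Proof.
have h0 : (0 : R) < 2^-1 by rewrite invr_gt0.
rewrite mulrC -ltr_pdivlMr // mul1r /powR gt_eqF //.
rewrite -[ltRHS](lnK (x := 2^-1)) ?posrE // ltr_expR.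
rewrite -[ltRHS]mul1r ltr_nM2r // ln_lt0 // h0 /= invf_lt1 // ltr1n //.
Qed.

Lemma sew_const_ge0 : 0 <= sew_const.
Proof. by rewrite divr_ge0 ?mulr_ge0 // subr_ge0 ltW // half_pow_lt1. Qed.

Hypothesis almost_additive : forall s u t, 0 <= s -> s <= u -> u <= t -> t <= 1 ->
  `|mu s t - mu s u - mu u t| <= C * w s t `^ theta.

Lemma mu_diag s : 0 <= s -> s <= 1 -> mu s s = 0.
Proof.
move=> s0 s1; have := almost_additive s0 (lexx _) (lexx _) s1.
rewrite w_diag // powR0 ?mulr0; last by rewrite gt_eqF // (lt_trans ltr01).
by rewrite subrr sub0r normrN normr_le0 => /eqP.
Qed.

(* The partition is cut at the last point up to which the control is at most half
   its total: by superadditivity the control of both sides is at most one half. *)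
Lemma sew_bound s D : path <%R s D -> 0 <= s -> last s D <= 1 ->
  `|rsum s D - mu s (last s D)| <= sew_const * w s (last s D) `^ theta.
Proof.
have [k] := ubnP (size D); elim: k s D => // k IH s D Dk pD s0 t1.
set t := last s D in t1 *.
have st : s <= t by exact: path_le_last.
have w0 := w_ge0 s0 st t1.
have th0 : 0 <= theta by rewrite ltW // (lt_trans ltr01).
case: D Dk pD @t t1 st w0 => [|x D] Dk pD t t1 st w0.
  by rewrite /= mu_diag // subrr normr0 mulr_ge0 ?sew_const_ge0 // powR_ge0.
have h1 : w s (last s [::]) <= w s t / 2 by rewrite /= w_diag ?divr_ge0 // (le_trans st).
have h2 : w s t <= 2 * (w s t / 2) by rewrite mulrCA divff // mulr1.
have h3 : 0 <= w s t / 2 by rewrite divr_ge0.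
have nD : x :: D <> [::] by [].
have [E1 [y [E2 [e1 e2 e3]]]] := @half_split s t _ [::] (x :: D) pD erefl s0 t1 nD h1 h2 h3.
rewrite cat0s in e1.
have tE : last y E2 = t by rewrite /t e1 last_cat.
move: Dk pD; rewrite e1 cat_path size_cat /= addnS => Dk /and3P[pE1 ay pE2].
set a := last s E1 in ay e2 *.
have sa : s <= a by exact: path_le_last.
have yt : y <= t by rewrite -tE; exact: path_le_last.
have a1 : a <= 1 by rewrite (le_trans _ t1) // (le_trans (ltW ay)).
have a0 : 0 <= a by rewrite (le_trans s0).
have y0 : 0 <= y by rewrite (le_trans a0) // ltW.
have y1 : y <= 1 by exact: le_trans t1.
have k1 : (size E1 < k)%N := leq_ltn_trans (leq_addr (size E2) (size E1)) Dk.
have k2 : (size E2 < k)%N := leq_ltn_trans (leq_addl (size E1) (size E2)) Dk.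
have b1 := IH _ _ k1 pE1 s0 a1.
have b2 : `|rsum y E2 - mu y t| <= sew_const * w y t `^ theta.
  by rewrite -tE; apply: IH => //; rewrite tE.
rewrite rsum_cat /= -/a.
have c1 := almost_additive s0 sa (le_trans (ltW ay) yt) t1.
have c2 := almost_additive a0 (ltW ay) yt t1.
have wat : w a t <= w s t by apply: w_le => //; apply: le_trans yt; exact: ltW.
have wat0 : 0 <= w a t by apply: w_ge0 => //; apply: le_trans yt; exact: ltW.
have wsa0 : 0 <= w s a by exact: w_ge0.
have wyt0 : 0 <= w y t by exact: w_ge0.
set p := w s t `^ theta.
have p0 : 0 <= p by exact: powR_ge0.
have mono u v : 0 <= u -> u <= v -> u `^ theta <= v `^ theta.
  by move=> u0 uv; apply: ge0_ler_powR; rewrite ?nnegrE //; exact: le_trans uv.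
have c2' : `|mu a t - mu a y - mu y t| <= C * p.
  by apply: le_trans c2 _; rewrite ler_wpM2l // mono.
have half : (w s t / 2) `^ theta = 2^-1 `^ theta * p by rewrite mulrC powRM // invr_ge0.
have b1' : `|rsum s E1 - mu s a| <= sew_const * (2^-1 `^ theta * p).
  by apply: le_trans b1 _; rewrite ler_wpM2l ?sew_const_ge0 // -half mono.
have b2' : `|rsum y E2 - mu y t| <= sew_const * (2^-1 `^ theta * p).
  by apply: le_trans b2 _; rewrite ler_wpM2l ?sew_const_ge0 // -half mono.
have -> : rsum s E1 + (mu a y + rsum y E2) - mu s t =
  (rsum s E1 - mu s a) + (rsum y E2 - mu y t) - (mu s t - mu s a - mu a t) - (mu a t - mu a y - mu y t).
  by clear; move: (rsum s E1) (rsum y E2) (mu a y) (mu s t) (mu s a) (mu y t) (mu a t) => *; zmod_eq.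
apply: (@le_trans _ _ (sew_const * (2^-1 `^ theta * p) + sew_const * (2^-1 `^ theta * p) + C * p + C * p)).
  apply: le_trans (ler_normB _ _) _; apply: lerD => //.
  apply: le_trans (ler_normB _ _) _; apply: lerD => //.
  by apply: le_trans (ler_normD _ _) _; apply: lerD.
rewrite le_eqVlt; apply/orP; left; apply/eqP.
rewrite /sew_const; field.
by rewrite gt_eqF // subr_gt0 half_pow_lt1.
Qed.

(** Each cell of the coarse partition costs a multiple of w^theta by [sew_bound], and w^theta <=
    delta^(theta - 1) w there; the w of the cells add up by superadditivity. *)
Lemma refine_bound (delta : R) s D D' : 0 <= delta ->
  path <%R s D -> path <%R s D' -> subseq D D' -> last s D = last s D' ->
  0 <= s -> last s D <= 1 -> path (fun a b => w a b <= delta) s D ->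
  `|rsum s D' - rsum s D| <= sew_const * delta `^ (theta - 1) * w s (last s D).
Proof.
move=> d0; elim: D s D' => [|x D IH] s D' /= pD pD' sub lD s0 t1.
  case: D' pD' sub lD => [|y D'] /=; first by rewrite subrr normr0 w_diag // ?mulr0.
  move=> /andP[sy pD'] _ lD; have := path_le_last pD'.
  by rewrite -lD leNgt sy.
case/andP: pD => sx pD /andP[wx wD].
have xD' : x \in D' by apply: (mem_subseq sub); exact: mem_head.
case/splitPr: xD' pD' sub lD => E1 E2 pD' sub lD.
have pE : path <%R s (rcons E1 x) /\ path <%R x E2.
  by move: pD'; rewrite -cat_rcons cat_path last_rcons => /andP[].
have xnE : x \notin E1.
  have := @sorted_uniq _ _ (@lt_trans _ R) (@ltxx _ R) (s :: E1 ++ x :: E2) pD'; rewrite /= => /andP[_].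
  by rewrite cat_uniq => /and3P[_ /norP[]].
have subE : subseq D E2.
  move: sub; rewrite -cat_rcons; elim: E1 xnE {pD' lD pE} => [|z E1 IHE] /=.
    by rewrite eqxx.
  rewrite inE negb_or => /andP[/negPf xz xE]; rewrite xz; exact: IHE.
rewrite last_cat /= in lD.
have x0 : 0 <= x by rewrite (le_trans s0) // ltW.
have xt : x <= last x D by exact: path_le_last.
have st : s <= x by exact: ltW.
have IHx := IH x E2 pD pE.2 subE lD x0 t1 wD.
have := sew_bound pE.1 s0; rewrite last_rcons => /(_ (le_trans xt t1)) b1.
rewrite -cat_rcons rsum_cat last_rcons.
have -> : rsum s (rcons E1 x) + rsum x E2 - (mu s x + rsum x D) =
  (rsum s (rcons E1 x) - mu s x) + (rsum x E2 - rsum x D).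
  by move: (rsum s _) (rsum x _) (mu s x) (rsum x D) => *; zmod_eq.
apply: le_trans (ler_normD _ _) _.
have wsx := w_ge0 s0 st (le_trans xt t1).
have pw : w s x `^ theta <= delta `^ (theta - 1) * w s x.
  have [->|wn0] := eqVneq (w s x) 0; first by rewrite powR0 ?mulr0 // gt_eqF // (lt_trans ltr01).
  have -> : w s x `^ theta = w s x `^ (theta - 1) * w s x.
    by rewrite -[X in _ * X]powRr1 // -powRD ?subrK // wn0 implybT.
  apply: ler_wpM2r => //; apply: ge0_ler_powR; rewrite ?nnegrE ?subr_ge0 //; exact: ltW.
apply: (@le_trans _ _ (sew_const * delta `^ (theta - 1) * (w s x + w x (last x D)))).
  rewrite mulrDr; apply: lerD => //.
  by apply: le_trans b1 _; rewrite -mulrA ler_wpM2l // sew_const_ge0.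
apply: ler_wpM2l; last exact: w_add.
by rewrite mulr_ge0 ?sew_const_ge0 ?powR_ge0.
Qed.

(** The summation of [refine_bound] for a path [I] whose increments are known to be close to [mu].
    It identifies the limit directly, and is applied to I = phi(h) for the composed form. *)
Lemma increment_bound (I : R -> U) (C' delta : R) s D : 0 <= delta -> 0 <= C' ->
  (forall s t, 0 <= s -> s < t -> t <= 1 -> `|I t - I s - mu s t| <= C' * w s t `^ theta) ->
  path <%R s D -> 0 <= s -> last s D <= 1 -> path (fun a b => w a b <= delta) s D ->
  `|rsum s D - (I (last s D) - I s)| <= C' * delta `^ (theta - 1) * w s (last s D).
Proof.
move=> d0 C'0 hI; elim: D s => [|x D IH] s /=.
  by move=> _ s0 s1 _; rewrite !subrr normr0 w_diag ?mulr0.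
move=> /andP[sx pD] s0 t1 /andP[wx wD].
have x0 : 0 <= x by rewrite (le_trans s0) // ltW.
have xt : x <= last x D by exact: path_le_last.
have st : s <= x by exact: ltW.
have x1 := le_trans xt t1.
have IHx := IH x pD x0 t1 wD.
have -> : mu s x + rsum x D - (I (last x D) - I s) =
  (rsum x D - (I (last x D) - I x)) - (I x - I s - mu s x).
  by move: (rsum x D) (I x) (I s) (mu s x) (I (last x D)) => *; zmod_eq.
apply: le_trans (ler_normB _ _) _.
have wsx := w_ge0 s0 st (le_trans xt t1).
have pw : w s x `^ theta <= delta `^ (theta - 1) * w s x.
  have [->|wn0] := eqVneq (w s x) 0; first by rewrite powR0 ?mulr0 // gt_eqF // (lt_trans ltr01).
  have -> : w s x `^ theta = w s x `^ (theta - 1) * w s x.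
    by rewrite -[X in _ * X]powRr1 // -powRD ?subrK // wn0 implybT.
  apply: ler_wpM2r => //; apply: ge0_ler_powR; rewrite ?nnegrE ?subr_ge0 //; exact: ltW.
apply: (@le_trans _ _ (C' * delta `^ (theta - 1) * (w s x + w x (last x D)))).
  rewrite mulrDr addrC; apply: lerD => //.
  apply: le_trans (hI _ _ s0 sx x1) _; rewrite -mulrA ler_wpM2l //.
apply: ler_wpM2l; last exact: w_add.
by rewrite mulr_ge0 ?powR_ge0.
Qed.

End Sewing.

(** * Partitions and the mesh filter *)

Section Partitions.
Variable R : realType.
Implicit Types (s t d : R) (D : seq R).

Definition mesh_lt d s D := path (fun a b => b - a < d) s D.

(** Steps of length d / 2, the last one possibly shorter, keep the mesh strictly below d. *)
Lemma fine_partition s t d : 0 < d -> s <= t ->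
  exists D, [/\ path <%R s D, last s D = t & mesh_lt d s D].
Proof.
move=> d0 st; have d2 : 0 < d / 2 by rewrite divr_gt0.
have [n] : exists n : nat, t - s <= n%:R * (d / 2).
  exists (Num.bound ((t - s) / (d / 2))); rewrite -ler_pdivrMr //.
  by apply/ltW/archi_boundP; rewrite divr_ge0 ?subr_ge0 // ltW.
elim: n s st => [|n IH] s st.
  by rewrite mul0r subr_le0 => ts; exists [::]; split => //=; apply/eqP; rewrite eq_le st ts.
move=> hn; have [sd|sd] := leP t (s + d / 2).
  have [->|sn] := eqVneq s t; first by exists [::].
  exists [:: t]; split => //=; first by rewrite lt_neqAle sn st.
  by rewrite /mesh_lt /= andbT; lra.
have [||D [h1 h2 h3]] := IH (s + d / 2); first exact: ltW.
  by move: hn; rewrite -natr1 mulrDl mul1r; lra.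
exists (s + d / 2 :: D); split => //=; first by rewrite ltrDl d2.
by rewrite /mesh_lt /=; apply/andP; split => //; lra.
Qed.

Lemma common_refinement s D D' : path <%R s D -> path <%R s D' -> last s D = last s D' ->
  exists E, [/\ path <%R s E, last s E = last s D, subseq D E & subseq D' E].
Proof.
have [n] := ubnP (size D + size D'); elim: n s D D' => // n IH s D D' szn pD pD' lD.
case: D szn pD lD => [|x D] szn pD lD.
  case: D' szn pD' lD => [|y D'] szn pD' lD; first by exists [::].
  have := path_le_last (path_sorted pD' : path <%R y D').
  by move: pD' lD => /= /andP[sy _] <-; rewrite leNgt sy.
case: D' szn pD' lD => [|y D'] szn pD' lD.
  have := path_le_last (path_sorted pD : path <%R x D).
  by move: pD lD => /= /andP[sx _] ->; rewrite leNgt sx.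
rewrite /= in szn pD pD' lD; move: pD pD' => /andP[sx pD] /andP[sy pD'].
have [xy|yx|xy] := ltgtP x y.
- have szn' : (size D + size (y :: D') < n)%N by [].
  have pyD : path <%R x (y :: D') by rewrite /= xy.
  have [E [h1 h2 h3 h4]] := IH x D (y :: D') szn' pD pyD lD.
  exists (x :: E); split => //=; first by rewrite sx.
    by rewrite eqxx.
  exact: (subseq_trans h4 (subseq_cons _ _)).
- have szn' : (size (x :: D) + size D' < n)%N by move: szn; rewrite addnS.
  have pxD : path <%R y (x :: D) by rewrite /= yx.
  have [E [h1 h2 h3 h4]] := IH y (x :: D) D' szn' pxD pD' lD.
  exists (y :: E); split => //=; first by rewrite sy.
    exact: (subseq_trans h3 (subseq_cons _ _)).
  by rewrite eqxx.
- subst y; have szn' : (size D + size D' < n)%N.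
    by move: szn; rewrite addSn addnS ltnS; exact: ltnW.
  have [E [h1 h2 h3 h4]] := IH x D D' szn' pD pD' lD.
  by exists (x :: E); split => //=; rewrite ?sx ?eqxx.
Qed.

Lemma mesh_to0P t (P : set (seq R)) : mesh_to0 t P <->
  exists2 d, 0 < d & forall D, path <%R 0 D -> last 0 D = t -> mesh_lt d 0 D -> P D.
Proof.
split=> [[d /= d0 h]|[d d0 h]]; exists d => //.
  move=> D pD lD mD; apply: h; split; first by split => //; apply/eqP.
  by move=> i iD; move/(pathP t): mD; apply.
move=> D [[pD /eqP lD] mD]; apply: h => //.
by apply/(pathP t) => i /mD.
Qed.

Lemma mesh_to0_proper t : 0 <= t -> ProperFilter (mesh_to0 t).
Proof.
move=> t0; apply: filter_from_proper.
  apply: filter_from_filter; first by exists 1 => /=.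
  move=> d d' /= d0 d0'; exists (Num.min d d') => /=; first by rewrite lt_min d0.
  by move=> D [pD mD]; split; split => // i /mD; rewrite lt_min => /andP[].
move=> d /= d0; have [D [pD lD mD]] := fine_partition d0 t0.
exists D; split; first by split => //; apply/eqP.
by move=> i iD; move/(pathP t): mD; apply.
Qed.

Lemma powR_small (K eps a : R) : 0 <= K -> 0 < eps -> 0 < a ->
  exists2 delta : R, 0 < delta & K * delta `^ a < eps.
Proof.
move=> K0 e0 a0; have K1 : 0 < K + 1 by rewrite ltr_wpDl.
exists ((eps / (K + 1)) `^ a^-1); first by rewrite powR_gt0 // divr_gt0.
rewrite -powRrM mulVf ?gt_eqF // powRr1; last by rewrite ltW // divr_gt0.
by rewrite mulrCA -[ltRHS]mulr1 ltr_pM2l // ltr_pdivrMr // mul1r ltrDl.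
Qed.

End Partitions.

(** * Convergence of the Riemann sums *)

Section SewingLimit.
Variables (R : realType) (U : completeNormedModType R).
Variables (mu : R -> R -> U).
Variables (w : R -> R -> R) (C theta : R).
Hypothesis w_ge0 : forall s t, 0 <= s -> s <= t -> t <= 1 -> 0 <= w s t.
Hypothesis w_diag : forall s, 0 <= s -> s <= 1 -> w s s = 0.
Hypothesis w_add : forall s u t, 0 <= s -> s <= u -> u <= t -> t <= 1 -> w s u + w u t <= w s t.
Hypothesis theta1 : 1 < theta.
Hypothesis w_small : forall delta : R, 0 < delta -> exists2 d : R, 0 < d &
  forall a b, 0 <= a -> a <= b -> b <= 1 -> b - a < d -> w a b <= delta.

Lemma mesh_small d delta s D : (forall a b, 0 <= a -> a <= b -> b <= 1 -> b - a < d -> w a b <= delta) ->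
  path <%R s D -> 0 <= s -> last s D <= 1 -> mesh_lt d s D ->
  path (fun a b => w a b <= delta) s D.
Proof.
move=> h; elim: D s => //= x D IH s /andP[sx pD] s0 t1 /andP[sxd mD].
have x0 : 0 <= x by rewrite (le_trans s0) // ltW.
have xt : x <= last x D by exact: path_le_last.
by rewrite h ?(ltW sx) ?(le_trans xt) //= IH.
Qed.

Lemma increment_cvg (I : R -> U) (C' : R) t : 0 <= C' -> 0 <= t -> t <= 1 ->
  (forall s t, 0 <= s -> s < t -> t <= 1 -> `|I t - I s - mu s t| <= C' * w s t `^ theta) ->
  rsum mu 0 D @[D --> mesh_to0 t] --> I t - I 0.
Proof.
move=> C0 t0 t1 hI; have := mesh_to0_proper t0 => F.
apply/cvgrPdist_lt => eps e0.
have th0 : 0 < theta - 1 by rewrite subr_gt0.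
have [delta d0 hd] := powR_small (mulr_ge0 C0 (w_ge0 (lexx 0) t0 t1)) e0 th0.
have [d dP hw] := w_small d0.
apply/mesh_to0P; exists d => // D pD lD mD /=; rewrite distrC.
have t1' : last 0 D <= 1 by rewrite lD.
have := increment_bound w_ge0 w_diag w_add theta1 (ltW d0) C0 hI pD (lexx 0) t1'.
rewrite lD => /(_ (mesh_small hw pD (lexx 0) t1' mD)) h.
by apply: le_lt_trans h _; rewrite mulrAC; exact: hd.
Qed.

Hypothesis C_ge0 : 0 <= C.
Hypothesis almost_additive : forall s u t, 0 <= s -> s <= u -> u <= t -> t <= 1 ->
  `|mu s t - mu s u - mu u t| <= C * w s t `^ theta.

(** Cauchy criterion: two fine partitions are compared through a common refinement. *)
Lemma sewing_cvg t : 0 <= t -> t <= 1 -> cvg (rsum mu 0 D @[D --> mesh_to0 t]).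
Proof.
move=> t0 t1; have := mesh_to0_proper t0 => F.
apply/cauchy_cvgP/cauchy_exP => eps e0.
have K0 := sew_const_ge0 theta1 C_ge0.
have th0 : 0 < theta - 1 by rewrite subr_gt0.
have [delta d0 hd] := powR_small (mulr_ge0 K0 (w_ge0 (lexx 0) t0 t1)) (divr_gt0 e0 (ltr0n R 2)) th0.
have [d dP hw] := w_small d0.
have [D0 [pD0 lD0 mD0]] := fine_partition dP t0.
exists (rsum mu 0 D0); apply/mesh_to0P; exists d => // D pD lD mD.
rewrite -ball_normE /=.
have [E [pE lE sD0 sD]] := common_refinement pD0 pD (etrans lD0 (esym lD)).
rewrite lD0 in lE.
have bound D1 : path <%R 0 D1 -> last 0 D1 = t -> mesh_lt d 0 D1 -> subseq D1 E ->
    `|rsum mu 0 E - rsum mu 0 D1| < eps / 2.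
  move=> pD1 lD1 mD1 sD1; have t1' : last 0 D1 <= 1 by rewrite lD1.
  have := refine_bound w_ge0 w_diag w_add theta1 C_ge0 almost_additive (ltW d0) pD1 pE sD1.
  rewrite lD1 lE => /(_ erefl (lexx 0) t1).
  move=> /(_ (mesh_small hw pD1 (lexx 0) t1' mD1)) h.
  by apply: le_lt_trans h _; rewrite mulrAC; exact: hd.
have -> : rsum mu 0 D0 - rsum mu 0 D = (rsum mu 0 E - rsum mu 0 D) - (rsum mu 0 E - rsum mu 0 D0).
  by move: (rsum mu 0 D) (rsum mu 0 D0) (rsum mu 0 E) => *; zmod_eq.
apply: le_lt_trans (ler_normB _ _) _; rewrite [eps]splitr; apply: ltrD; exact: bound.
Qed.

Definition sewn t : U := lim (rsum mu 0 D @[D --> mesh_to0 t]).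

Lemma sewn_near t eps : 0 <= t -> t <= 1 -> 0 < eps -> exists2 d : R, 0 < d &
  forall D, path <%R 0 D -> last 0 D = t -> mesh_lt d 0 D -> `|sewn t - rsum mu 0 D| < eps.
Proof.
move=> t0 t1 e0; have F := mesh_to0_proper t0.
have /cvgrPdist_lt/(_ _ e0) : rsum mu 0 D @[D --> mesh_to0 t] --> sewn t := sewing_cvg t0 t1.
by move/mesh_to0P.
Qed.

Lemma sewn0 : sewn 0 = 0.
Proof.
apply/eqP; rewrite -normr_le0; apply/ler_addgt0Pl => eps e0; rewrite addr0.
have [d d0 h] := sewn_near (lexx 0) ler01 e0.
by have := h [::] isT erefl isT; rewrite subr0 => /ltW.
Qed.

(** Fine partitions of [0, s] and of [s, t] join to one of [0, t], so the difference of the Riemann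
    sums is a sum over [s, t], to which [sew_bound] applies. *)
Lemma sewn_bound s t : 0 <= s -> s <= t -> t <= 1 ->
  `|sewn t - sewn s - mu s t| <= sew_const C theta * w s t `^ theta.
Proof.
move=> s0 st t1; have s1 := le_trans st t1; have t0 := le_trans s0 st.
apply/ler_addgt0Pl => eps e0; have e2 : 0 < eps / 2 by rewrite divr_gt0.
have [d d0 hd] := sewn_near t0 t1 e2; have [d' d0' hd'] := sewn_near s0 s1 e2.
have m0 : 0 < Num.min d d' by rewrite lt_min d0.
have [D [pD lD mD]] := fine_partition m0 s0.
have [E [pE lE mE]] := fine_partition m0 st.
have sub1 x F : mesh_lt (Num.min d d') x F -> mesh_lt d x F.
  by apply: sub_path => a b; rewrite lt_min => /andP[].
have sub2 x F : mesh_lt (Num.min d d') x F -> mesh_lt d' x F.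
  by apply: sub_path => a b; rewrite lt_min => /andP[].
have h1 : `|sewn t - rsum mu 0 (D ++ E)| < eps / 2.
  apply: hd; first by rewrite cat_path pD lD pE.
    by rewrite last_cat lD.
  by rewrite /mesh_lt cat_path lD; apply/andP; split; apply: sub1.
have h2 := hd' D pD lD (sub2 _ _ mD).
rewrite rsum_cat lD in h1.
have := sew_bound w_ge0 w_diag w_add theta1 C_ge0 almost_additive pE s0; rewrite lE => /(_ t1) h3.
have -> : sewn t - sewn s - mu s t = (sewn t - (rsum mu 0 D + rsum mu s E)) - (sewn s - rsum mu 0 D) + (rsum mu s E - mu s t).
  by clear; move: (sewn t) (sewn s) (rsum mu 0 D) (rsum mu s E) (mu s t) => *; zmod_eq.
apply: le_trans (ler_normD _ _) _; apply: lerD => //.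
apply: le_trans (ler_normB _ _) _; rewrite [eps]splitr; apply: lerD; exact: ltW.
Qed.

End SewingLimit.

(** * Graded functions on the group *)

Section FfunCons.
Variables (T : finType) (l : nat).

Definition ffun_cons (k0 : T) (k : {ffun 'I_l -> T}) : {ffun 'I_l.+1 -> T} :=
  [ffun i => if unlift ord0 i is Some j then k j else k0].

Lemma ffun_cons0 k0 k : ffun_cons k0 k ord0 = k0.
Proof. by rewrite ffunE unlift_none. Qed.

Lemma ffun_consS k0 k j : ffun_cons k0 k (lift ord0 j) = k j.
Proof. by rewrite ffunE liftK. Qed.

Lemma big_ffun_cons (B : nmodType) (G : {ffun 'I_l.+1 -> T} -> B) :
  \sum_k G k = \sum_k0 \sum_k G (ffun_cons k0 k).
Proof.
rewrite pair_big /= (reindex (fun p => ffun_cons p.1 p.2)) //=.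
exists (fun k => (k ord0, [ffun j => k (lift ord0 j)])) => [[k0 k] _|k _] /=.
  by rewrite ffun_cons0; congr (_, _); apply/ffunP => j; rewrite ffunE ffun_consS.
apply/ffunP => i; rewrite ffunE; case: unliftP => [j ->|->] //.
by rewrite ffunE.
Qed.
End FfunCons.

Section PtensSums.
Variables (R : realType) (U : completeNormedModType R) (TU : tensor_powers U).

Lemma ptens_cons l (v : 'I_l.+1 -> U) :
  ptens TU v = tmulto l.+1 (pt TU 1 [:: v ord0]) (ptens TU (fun j => v (lift ord0 j))).
Proof.
rewrite [in RHS]ptE tmulto_pt // ptE enum_ordSl /=; congr (pt TU _ (_ :: _)).
by rewrite -[in LHS]map_comp.
Qed.

Lemma ptens_sum_ffun l m (a : 'I_l -> 'I_m -> U) :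
  ptens TU (fun i => \sum_(k < m) a i k) =
  \sum_(k : {ffun 'I_l -> 'I_m}) ptens TU (fun i => a i (k i)).
Proof.
elim: l a => [|l IH] a.
  have k0 : {ffun 'I_0 -> 'I_m} := [ffun i : 'I_0 => match i with Ordinal _ h => match notF h with end end].
  rewrite (big_pred1 k0) => [|k]; last by rewrite /=; symmetry; apply/eqP/ffunP => -[].
  by congr (ptens TU _); apply/funext => -[].
rewrite ptens_cons (IH (fun j => a (lift ord0 j))) big_ffun_cons tmulto_sumr exchange_big.
apply: eq_bigr => k _.
have [lin1 _] := pt1_bounded TU.
rewrite (linear_sum' lin1) tmulto_suml; apply: eq_bigr => k0 _.
rewrite [RHS]ptens_cons ffun_cons0; congr (tmulto _ _ (ptens TU _)).
by apply/funext => j; rewrite ffun_consS.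
Qed.

Lemma ptens_norm l (v : 'I_l -> U) : `|ptens TU v| <= \prod_i `|v i|.
Proof.
elim: l v => [|l IH] v; first by rewrite big_ord0 ptens0_norm.
rewrite ptens_cons big_ord_recl; apply: le_trans (tmulto_norm _ _ _) _.
apply: ler_pM => //.
by have [_ /(_ (v ord0))] := pt1_bounded TU; rewrite mul1r.
Qed.

Lemma pt_nseqE l (v : U) : pt TU l (nseq l v) = ptens TU (fun _ : 'I_l => v).
Proof. by congr (ptens TU _); apply/funext => i; rewrite nth_nseq ltn_ord. Qed.

End PtensSums.

Section Graded.
Variables (R : realType) (V : completeNormedModType R) (TV : tensor_powers V).
Variable q : R.
Hypothesis q_gt0 : 0 < q.

Section Target.
Variable Z : normedModType R.
Implicit Types F G : tseries TV -> Z.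

Definition homog (J : nat) (K : R) F :=
  exists2 c : TV J -> Z, linear_bounded K c & forall x, grouplike x -> F x = c (x J).

(* The degree [J] part is measured after rescaling by [q ^ J], which makes the
   best constant [K] submultiplicative in the sense of [graded_prod]. *)
Definition graded (D : nat) (K : R) F :=
  exists2 c : forall J, TV J -> Z,
    (forall J, (J < D)%N -> linear_bounded (K / q ^+ J) (c J)) &
    forall x, grouplike x -> F x = \sum_(J < D) c J (x J).

Lemma graded_ext D K F G : (forall x, grouplike x -> F x = G x) -> graded D K F -> graded D K G.
Proof. by move=> FG [c cK hc]; exists c => // x gx; rewrite -FG // hc. Qed.

Lemma graded_le D K K' F : K <= K' -> graded D K F -> graded D K' F.
Proof.
move=> KK [c cK hc]; exists c => // J JD; apply: linear_bounded_le (cK J JD).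
by rewrite ler_wpM2r // invr_ge0 exprn_ge0 // ltW.
Qed.

Lemma homog_le J K K' F : K <= K' -> homog J K F -> homog J K' F.
Proof. by move=> KK [c cK hc]; exists c => //; exact: linear_bounded_le cK. Qed.

Lemma graded0 D K : 0 <= K -> graded D K (fun=> 0).
Proof.
move=> K0; exists (fun J _ => 0) => [J _|x _]; last by rewrite big1.
by apply: linear_bounded_le (linear_bounded0 _ _); rewrite divr_ge0 // exprn_ge0 // ltW.
Qed.

Lemma gradedD D K K' F G : graded D K F -> graded D K' G ->
  graded D (K + K') (fun x => F x + G x).
Proof.
move=> [c cK hc] [d dK hd]; exists (fun J y => c J y + d J y).
  by move=> J JD; rewrite mulrDl; apply: linear_boundedD; [exact: cK|exact: dK].
by move=> x gx; rewrite hc // hd // big_split.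
Qed.

Lemma gradedN D K F : graded D K F -> graded D K (fun x => - F x).
Proof.
move=> [c cK hc]; exists (fun J y => - c J y).
  by move=> J JD; apply: linear_boundedN; exact: cK.
by move=> x gx; rewrite hc // sumrN.
Qed.

Lemma gradedB D K K' F G : graded D K F -> graded D K' G ->
  graded D (K + K') (fun x => F x - G x).
Proof. by move=> hF hG; apply: gradedD => //; exact: gradedN. Qed.

Lemma gradedZ D K (a : R) F : graded D K F -> graded D (`|a| * K) (fun x => a *: F x).
Proof.
move=> [c cK hc]; exists (fun J y => a *: c J y).
  by move=> J JD; rewrite -mulrA; apply: linear_boundedZ; exact: cK.
by move=> x gx; rewrite hc // scaler_sumr.
Qed.

Lemma graded_sum D I (r : seq I) (Q : pred I) (K : I -> R) (F : I -> tseries TV -> Z) :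
  (forall i, Q i -> graded D (K i) (F i)) ->
  graded D (\sum_(i <- r | Q i) K i) (fun x => \sum_(i <- r | Q i) F i x).
Proof.
move=> h; elim: r => [|i r IH].
  by rewrite big_nil; apply: graded_ext (graded0 D (lexx 0)) => x _; rewrite big_nil.
rewrite big_cons; case: ifP => Qi.
  by apply: graded_ext (gradedD (h i Qi) IH) => x _; rewrite big_cons Qi.
by apply: graded_ext IH => x _; rewrite big_cons Qi.
Qed.

Lemma homog_graded D J K F : (J < D)%N -> 0 <= K -> homog J (K / q ^+ J) F -> graded D K F.
Proof.
move=> JD K0 [c cK hc].
exists (fun J' (y : TV J') => if J' =P J is ReflectT e then c (ecast k (TV k) e y) else 0).
  move=> J' J'D; case: eqP => [e|_]; first by subst J'; rewrite /=.
  by apply: linear_bounded_le (linear_bounded0 _ _); rewrite divr_ge0 // exprn_ge0 // ltW.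
move=> x gx; rewrite (bigD1 (Ordinal JD)) //= big1 ?addr0; last first.
  move=> i ij; case: eqP => // e; move/negP: ij; case.
  by apply/eqP/val_inj.
rewrite hc //; case: eqP => // e.
by rewrite ecast_series.
Qed.

(** The component of order 0 of a group-like series is the unit, so constants are homogeneous of
    degree 0. *)
Lemma homog_cst (v : Z) : homog 0 `|v| (fun=> v).
Proof.
exists (fun y => scalar_part y *: v).
  have [sL sK] := scalar_part_bounded TV; split=> [a x y|y].
    by rewrite sL scalerDl scalerA.
  by rewrite normrZ mulrC ler_wpM2l //; have := sK y; rewrite mul1r.
by move=> x /grouplikeP[-> _]; rewrite scalar_part1 scale1r.
Qed.

Lemma graded_cst D K (v : Z) : `|v| <= K -> graded D.+1 K (fun=> v).
Proof.
move=> vK; apply: (@homog_graded _ 0); rewrite ?(le_trans _ vK) //.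
by rewrite expr0 divr1; exact: homog_le (homog_cst v).
Qed.

End Target.

(** The order k of b x is the sum of b^(k-J) (x) x^J, and |b^(k-J)| <= q^(k-J) = q^k / q^J is the
    weight required in degree J. *)
Lemma graded_shift (Z : normedModType R) D k K (F : tseries TV -> Z) (b : tseries TV) :
  (k < D)%N -> 0 <= K -> grouplike b -> (forall i, `|b i| <= q ^+ i) ->
  homog k K F -> graded D (K * q ^+ k) (fun x => F (tsmul b x)).
Proof.
move=> kD K0 gb bq [c [cL cK] hc].
have qn0 j : 0 < q ^+ j by exact: exprn_gt0.
exists (fun J (y : TV J) => c (tmulto k (b (k - J)%N) y)).
  move=> J JD; split.
    by apply: linear_compf cL _; exact: tmulto_linearr.
  move=> y; have [Jk|Jk] := leqP J k; last first.
    rewrite tmulto_neq ?(linear0' cL) ?normr0; last by lia.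
    by rewrite !mulr_ge0 // ?invr_ge0 ltW.
  apply: le_trans (cK _) _; rewrite -!mulrA ler_wpM2l //.
  apply: le_trans (tmulto_norm _ _ _) _; rewrite mulrA ler_wpM2r //.
  have -> : q ^+ k / q ^+ J = q ^+ (k - J).
    by rewrite -[X in q ^+ X / _](subnK Jk) exprD mulfK // gt_eqF.
  exact: bq.
move=> x gx; rewrite hc; last exact: grouplikeM.
rewrite (tsmulE (K := D)) // exchange_big /= (linear_sum' cL); apply: eq_bigr => J _.
have [Jk|Jk] := leqP J k; last first.
  rewrite [in RHS]tmulto_neq; last by lia.
  rewrite big1 // => i _; rewrite tmulto_neq //; lia.
have kJ : (k - J < D)%N by lia.
rewrite (bigD1 (Ordinal kJ)) //= big1 ?addr0 // => i iJ.
rewrite tmulto_neq // => e; move/negP: iJ; apply; apply/eqP/val_inj => /=.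
by rewrite -e addnK.
Qed.

Section Products.
Variables (U : completeNormedModType R) (TU : tensor_powers U).
Hypothesis compat : tensor_compatible TV TU.
Variable Z : normedModType R.

(** On group-like series the product is a tensor map applied after the shuffle operator. The
    factorial bounds the number of shuffles, each of which acts isometrically; compatibility bounds
    the tensor map. *)
Lemma homog_prod l (k : 'I_l -> nat) (K : 'I_l -> R) (F : 'I_l -> tseries TV -> U)
    (A : TU l -> Z) KA : 0 <= KA -> linear_bounded KA A ->
  (forall i, homog (k i) (K i) (F i)) -> (forall i, 0 <= K i) ->
  homog (\sum_i k i) ((\sum_i k i)`!%:R * (KA * \prod_i K i)) (fun x => A (ptens TU (fun i => F i x))).
Proof.
move=> KA0 hA hF K0.
have hF' i : exists c : TV (k i) -> U, linear_bounded (K i) c /\ forall x, grouplike x -> F i x = c (x (k i)).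
  by have [c h1 h2] := hF i; exists c.
pose c i := projT1 (cid (hF' i)).
have cK i : linear_bounded (K i) (c i) := (projT2 (cid (hF' i))).1.
have cF i x : grouplike x -> F i x = c i (x (k i)) := (projT2 (cid (hF' i))).2 x.
have cC i : clinear (c i) := linear_bounded_clinear (cK i).
have [G hG GK] := compat cC.
set N := (\sum_i k i)%N.
exists (fun y => A (G (\sum_(s in shufflesn k) tperm (s^-1)%g y))); last first.
  move=> x gx; rewrite (is_tensor_map_grouplike cC hG gx); congr (A (ptens TU _)).
  by apply/funext => i; rewrite cF.
have prodK : \prod_i opnorm (c i) <= \prod_i K i.
  by apply: ler_prod => i _; rewrite opnorm_ge0 opnorm_le.
have G0 : 0 <= \prod_i K i by exact: prodr_ge0.
have GB : linear_bounded (\prod_i K i) G.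
  apply: linear_bounded_le (clinear_linear_bounded hG.1).
  exact: le_trans prodK.
have SB : linear_bounded N`!%:R (fun y : TV N => \sum_(s in shufflesn k) tperm (s^-1)%g y).
  have := @linear_bounded_sum _ (TV N) (TV N) _ (index_enum _) (mem (shufflesn k)) (fun _ => 1) (fun s y => tperm (s^-1)%g y).
  move=> h; apply: linear_bounded_le (h _); last first.
    by move=> s _; split; [exact: tperm_linear|move=> x; rewrite tperm_norm mul1r].
  by rewrite sumr_const ler_nat -card_Sn; exact: max_card.
rewrite mulrC; apply: (linear_bounded_comp (g := fun y => A (G y))) SB.
  exact: mulr_ge0.
exact: linear_bounded_comp.
Qed.

Variable n : nat.

(** At most (n+1)^n choices of a degree in each of l <= n factors, and at most (n n)! shuffles for
    each choice. *)
Definition prod_const : R := (n.+1 ^ n * (n * n)`!)%:R.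

(** Expanded by multilinearity, the weights q^-k_i multiply to q^-(k_1 + ... + k_l), so the
    constants multiply regardless of the degrees. *)
Lemma graded_prod l (K : 'I_l -> R) (F : 'I_l -> tseries TV -> U) (A : TU l -> Z) KA :
  (l <= n)%N -> 0 <= KA -> linear_bounded KA A ->
  (forall i, graded n.+1 (K i) (F i)) -> (forall i, 0 <= K i) ->
  graded (n * n).+1 (prod_const * (KA * \prod_i K i)) (fun x => A (ptens TU (fun i => F i x))).
Proof.
move=> ln KA0 hA hF K0.
have hF' i : exists c : forall J, TV J -> U,
   (forall J, (J < n.+1)%N -> linear_bounded (K i / q ^+ J) (c J)) /\
   (forall x, grouplike x -> F i x = \sum_(J < n.+1) c J (x J)).
  by have [c h1 h2] := hF i; exists c.
pose c i := projT1 (cid (hF' i)).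
have cK i J : (J < n.+1)%N -> linear_bounded (K i / q ^+ J) (c i J) := (projT2 (cid (hF' i))).1 J.
have cF i x : grouplike x -> F i x = \sum_(J < n.+1) c i J (x J) := (projT2 (cid (hF' i))).2 x.
have P0 : 0 <= KA * \prod_i K i by rewrite mulr_ge0 // prodr_ge0.
set P := KA * _ in P0 *.
have h (k : {ffun 'I_l -> 'I_n.+1}) : graded (n * n).+1 ((n * n)`!%:R * P)
    (fun x => A (ptens TU (fun i => c i (k i) (x (k i))))).
  have kn : (\sum_i k i <= n * n)%N.
    apply: (@leq_trans (\sum_(i < l) n)); first by apply: leq_sum => i _; rewrite -ltnS.
    by rewrite sum_nat_const card_ord leq_mul2r ln orbT.
  apply: (@homog_graded _ _ (\sum_i k i)%N); [by []|exact: mulr_ge0|].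
  have h1 i : homog (k i) (K i / q ^+ k i) (fun x => c i (k i) (x (k i))).
    by exists (c i (k i)) => //; exact: cK.
  have h2 i : 0 <= K i / q ^+ k i by rewrite divr_ge0 // exprn_ge0 // ltW.
  have hp := @homog_prod l (fun i => nat_of_ord (k i)) _ _ A KA KA0 hA h1 h2.
  apply: homog_le hp.
  rewrite prodf_div /= -expr_sum !mulrA ler_wpM2r //.
    by rewrite invr_ge0 exprn_ge0 // ltW.
  by rewrite -!mulrA ler_wpM2r // ler_nat leq_fact.
have := graded_sum (index_enum {ffun 'I_l -> 'I_n.+1}) (Q := predT) (fun k _ => h k).
rewrite sumr_const => hs.
apply: (@graded_ext _ _ _ _ _ _ (graded_le _ hs)) => [x gx|].
  rewrite -(linear_sum' hA.1) -(ptens_sum_ffun TU (fun i (J : 'I_n.+1) => c i J (x J))); congr (A (ptens TU _)).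
  by apply/funext => i; rewrite cF.
rewrite -[leLHS]mulr_natl mulrA ler_wpM2r // /prod_const natrM ler_wpM2r // ler_nat.
by rewrite card_ffun !card_ord leq_pexp2l.
Qed.

End Products.
End Graded.

(** * The local estimate *)

Section SymmetricExpansion.
Variables (R : realType) (U W : lmodType R) (n : nat) (G : nat -> seq U -> W).
Hypothesis G_perm : forall l s t, (l <= n)%N -> size s = l -> perm_eq s t -> G l s = G l t.
Hypothesis G_add : forall l a b s, (l <= n)%N -> (size s).+1 = l ->
  G l (a + b :: s) = G l (a :: s) + G l (b :: s).

(** Generalized to i vectors e and j vectors y already separated, so that an induction can split the
    k remaining sums one by one. *)
Lemma sym_binomial_aux (e y : U) k : forall i j, (i + j + k <= n)%N ->
  G (i + j + k) (nseq i e ++ nseq j y ++ nseq k (e + y)) =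
  \sum_(m < k.+1) G (i + j + k) (nseq (i + (k - m)) e ++ nseq (j + m) y) *+ 'C(k, m).
Proof.
elim: k => [|k IH] i j ijn.
  by rewrite big_ord1 bin0 mulr1n subnn !addn0 cats0.
have p1 (a : U) : perm_eq (nseq i e ++ nseq j y ++ a :: nseq k (e + y))
     (a :: nseq i e ++ nseq j y ++ nseq k (e + y)).
  by rewrite catA -[a :: nseq k _]cat1s perm_catCA -catA.
have sz : size (nseq i e ++ nseq j y ++ (e + y) :: nseq k (e + y)) = (i + j + k.+1)%N.
  by rewrite !size_cat !size_nseq /= size_nseq addnA.
have sz1 : (size (nseq i e ++ nseq j y ++ nseq k (e + y))).+1 = (i + j + k.+1)%N.
  by rewrite !size_cat !size_nseq addnA addnS.
rewrite -[nseq k.+1 _]/(e + y :: nseq k (e + y)) (G_perm ijn sz (p1 _)) (G_add _ _ ijn sz1).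
have e1 : (i + j + k.+1 = i.+1 + j + k)%N by rewrite addnS !addSn.
have e2 : (i + j + k.+1 = i + j.+1 + k)%N by rewrite !addnS !addSn.
have IH1 := IH i.+1 j; rewrite -e1 in IH1; rewrite IH1 // {IH1}.
have -> : G (i + j + k.+1) (y :: nseq i e ++ nseq j y ++ nseq k (e + y)) =
   G (i + j + k.+1) (nseq i e ++ nseq j.+1 y ++ nseq k (e + y)).
  apply: G_perm => //; rewrite -?sz1 //.
  by rewrite -cat1s perm_catCA.
have IH2 := IH i j.+1; rewrite -e2 in IH2; rewrite IH2 // {IH2}.
rewrite [in RHS]big_ord_recl bin0 mulr1n subn0 /=.
under [in RHS]eq_bigr => m _ do rewrite /bump /= add1n binS mulrnDr subSS.
rewrite big_split /= addrA; congr (_ + _); last first.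
  by apply: eq_bigr => m _; rewrite [(j + m.+1)%N]addnS.
rewrite big_ord_recl bin0 mulr1n subn0 /= !addn0 [(i + k.+1)%N]addnS; congr (_ + _).
rewrite [RHS]big_ord_recr /= bin_small // mulr0n addr0.
apply: eq_bigr => m _; rewrite /bump /= add1n.
rewrite -cat_cons -[e :: nseq _ e]/(nseq (i + (k - m.+1)).+1 e) -[(i + (k - m.+1)).+1]addnS; congr (G _ (nseq _ _ ++ nseq _ _) *+ _).
by congr (_ + _)%N; have := ltn_ord m; rewrite -subSn // subSS.
Qed.

Lemma sym_binomial (e y : U) l : (l <= n)%N ->
  G l (nseq l (e + y)) = \sum_(m < l.+1) G l (nseq (l - m) e ++ nseq m y) *+ 'C(l, m).
Proof. by move=> ln; have := @sym_binomial_aux e y l 0 0; rewrite !add0n; apply. Qed.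

(** After the binomial expansion the terms are regrouped by the number m of vectors y, using C(r +
    m, m) / (r + m)! = 1 / (r! m!). *)
Lemma sym_taylor (e y : U) :
  \sum_(1 <= l < n.+1) (l`!%:R : R)^-1 *: G l (nseq l (e + y)) -
  \sum_(1 <= l < n.+1) (l`!%:R : R)^-1 *: G l (nseq l e) =
  \sum_(1 <= m < n.+1) (m`!%:R : R)^-1 *:
    \sum_(r < (n - m).+1) (r`!%:R : R)^-1 *: G (r + m)%N (nseq r e ++ nseq m y).
Proof.
pose F l m := (l`!%:R : R)^-1 *: (G l (nseq (l - m) e ++ nseq m y) *+ 'C(l, m)).
transitivity (\sum_(1 <= l < n.+1) \sum_(1 <= m < n.+1 | (m <= l)%N) F l m).
  rewrite -sumrB; apply: eq_big_nat => l /andP[l1 ln].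
  rewrite sym_binomial // -scalerBr big_ord_recl bin0 mulr1n subn0 /= cats0 addrC addrA addNr add0r.
  rewrite scaler_sumr [RHS](_ : _ = \sum_(1 <= m < l.+1) F l m).
    by rewrite big_add1 big_mkord.
  rewrite [RHS](big_nat_widen _ _ n.+1) //.
rewrite (exchange_big_dep_nat xpredT) //=; apply: eq_big_nat => m /andP[m1 mn].
transitivity (\sum_(m <= l < n.+1) F l m).
  by rewrite [RHS](big_nat_widenl _ 1).
rewrite -{1}[m]add0n big_addn subSn // big_mkord scaler_sumr; apply: eq_bigr => r _.
rewrite /F addnK -[X in _ *: X = _]scaler_nat !scalerA; congr (_ *: _).
have := bin_fact (leq_addl r m); rewrite addnK => /(congr1 (fun k => k%:R : R)).
rewrite !natrM => h.
have nz k : (k`!%:R : R) != 0 by rewrite pnatr_eq0 -lt0n fact_gt0.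
rewrite -h; field; rewrite !nz /= pnatr_eq0 -lt0n bin_gt0 leq_addl //.
Qed.

End SymmetricExpansion.

Section Telescope.
Variables (R : realType) (U : completeNormedModType R) (TU : tensor_powers U).

Definition mixed m (j : nat) (y z d : U) (i : 'I_m) : U :=
  if (i < j)%N then z else if i == j :> nat then d else y.

(** The factors y are replaced by z one at a time; by multilinearity each replacement costs a tensor
    with a single factor y - z. *)
Lemma ptens_telescope m (y z : U) :
  pt TU m (nseq m y) - pt TU m (nseq m z) = \sum_(j < m) ptens TU (mixed j y z (y - z) : 'I_m -> U).
Proof.
pose S j := ptens TU (fun i : 'I_m => if (i < j)%N then z else y).
have -> : pt TU m (nseq m y) = S 0%N by rewrite pt_nseqE.
have -> : pt TU m (nseq m z) = S m.
  by rewrite pt_nseqE; congr (ptens TU _); apply/funext => i; rewrite ltn_ord.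
have := telescope_sumr S (leq0n m); rewrite big_mkord => h.
rewrite -opprB -h -sumrN; apply: eq_bigr => j _; rewrite opprB.
pose v : 'I_m -> U := mixed j y z 0.
have vE (a : U) : mixed j y z a = [eta v with j |-> a].
  apply/funext => i; rewrite /v /mixed /=; case: (ltngtP i j) => ij.
  - by case: eqP ij => // ->; rewrite ltnn.
  - by case: eqP ij => // ->; rewrite ltnn.
  - by rewrite (val_inj ij) eqxx.
have -> : S j = ptens TU [eta v with j |-> y].
  rewrite -vE; congr (ptens TU _); apply/funext => i.
  by rewrite /mixed; case: ltngtP.
have -> : S j.+1 = ptens TU [eta v with j |-> z].
  rewrite -vE; congr (ptens TU _); apply/funext => i.
  by rewrite /mixed ltnS; case: ltngtP.
rewrite vE; have -> : y - z = -1 *: z + y by rewrite scaleN1r addrC.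
by rewrite ptens_multilinear scaleN1r addrC.
Qed.

Lemma prod_mixed (m : nat) (j : 'I_m) (K E : R) :
  \prod_(i < m) (if i == j then E else K) = K ^+ m.-1 * E.
Proof.
rewrite (bigD1 j) //= eqxx mulrC; congr (_ * _).
rewrite (eq_bigr (fun _ => K)); last by move=> i /negPf ->.
by rewrite prodr_const cardC1 card_ord.
Qed.

Lemma pt_nseq_sub_norm m (y z : U) (K E : R) : `|y| <= K -> `|z| <= K -> `|y - z| <= E ->
  `|pt TU m (nseq m y) - pt TU m (nseq m z)| <= m%:R * (K ^+ m.-1 * E).
Proof.
move=> yK zK yzE; rewrite ptens_telescope; apply: le_trans (ler_norm_sum _ _ _) _.
have -> : m%:R * (K ^+ m.-1 * E) = \sum_(j < m) (K ^+ m.-1 * E).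
  by rewrite sumr_const card_ord mulr_natl.
apply: ler_sum => j _; apply: le_trans (ptens_norm _ _) _.
rewrite -(prod_mixed j); apply: ler_prod => i _; rewrite normr_ge0 /= /mixed.
case: ltngtP => ij.
- by case: eqP ij => // ->; rewrite ltnn.
- by case: eqP ij => // ->; rewrite ltnn.
- by rewrite (val_inj ij) eqxx.
Qed.

End Telescope.

Section Tails.
Variables (R : realType) (U : completeNormedModType R) (TU : tensor_powers U).
Variables (n : nat) (X : Type).
Implicit Type F : nat -> X -> U.

Definition form_sum F x : U := \sum_(1 <= k < n.+1) F k x.

Definition trunc_power F l x : TU l :=
  \sum_(k : {ffun 'I_l -> 'I_n.+1} | [forall i, (0 < k i)%N] && (\sum_i k i <= n)%N)
    ptens TU (fun i => F (k i) x).

Definition tail_power F l x : TU l :=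
  \sum_(k : {ffun 'I_l -> 'I_n.+1} | [forall i, (0 < k i)%N] && ~~ (\sum_i k i <= n)%N)
    ptens TU (fun i => F (k i) x).

(** Forms have no part of degree 0: it is added as 0 in order to expand over all degrees, and
    multi-indices with a zero entry then drop out. *)
Lemma pt_form_sum F l x : pt TU l (nseq l (form_sum F x)) = trunc_power F l x + tail_power F l x.
Proof.
rewrite pt_nseqE.
have -> : form_sum F x = \sum_(k < n.+1) (if k == 0 :> nat then 0 else F k x).
  rewrite big_ord_recl /= add0r /form_sum big_add1 big_mkord; exact: eq_bigr.
rewrite (ptens_sum_ffun TU (fun _ (k : 'I_n.+1) => if k == 0 :> nat then 0 else F k x)).
rewrite (bigID (fun k : {ffun 'I_l -> 'I_n.+1} => [forall i, (0 < k i)%N])) /=.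
rewrite [X in _ + X]big1 ?addr0; last first.
  move=> k; rewrite negb_forall => /existsP[i]; rewrite -eqn0Ngt => ki.
  apply/eqP; rewrite -normr_le0; apply: le_trans (ptens_norm _ _) _.
  by rewrite (bigD1 i) //= ki normr0 mul0r.
rewrite (bigID (fun k : {ffun 'I_l -> 'I_n.+1} => (\sum_i k i <= n)%N)) /=.
by congr (_ + _); apply: eq_bigr => k /andP[/forallP k0 _]; congr (ptens TU _); apply/funext => i;
  rewrite gtn_eqF.
Qed.

End Tails.

Lemma grouplike1 (R : realType) (V : completeNormedModType R) (TV : tensor_powers V) :
  grouplike (tsone TV).
Proof.
have -> : tsone TV = tsexp TV 0; last exact: grouplike_tsexp.
apply: functional_extensionality_dep => -[|k]; first by rewrite tsone0 /tsexp invr1 scale1r.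
rewrite /tsexp /=; have -> : pt TV k.+1 (0 :: nseq k 0) = 0; last by rewrite scaler0.
by rewrite pt_cons (linear0' (pt1_bounded TV).1) tmulto0l.
Qed.

(* [kappa] is a bound for the increments of the path in U, in units of [M q],
   and [Q] a bound for [q]. *)
Definition local_const (R : realType) (n : nat) (kappa Q : R) : R :=
  prod_const R n * (n.+1 ^ n.+1)%:R * kappa ^+ n.+1 * Q ^+ (n * n + n.+1).

Section LocalEstimate.
Variables (R : realType) (V U W : completeNormedModType R).
Variables (TV : tensor_powers V) (TU : tensor_powers U).
Hypothesis compat : tensor_compatible TV TU.
Variables (phi : U -> W) (N n : nat).
Hypothesis phiN : frechet_differentiable TU phi N.
Hypothesis nN : (n <= N)%N.
Variables (q Q rho kappa M Mh L H : R).
Hypotheses (q_gt0 : 0 < q) (qQ : q <= Q) (Q_ge1 : 1 <= Q).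
Hypotheses (M_ge0 : 0 <= M) (L_ge0 : 0 <= L) (H_ge0 : 0 <= H).
Hypothesis MMh : forall i, (1 <= i <= n)%N -> M ^+ i <= Mh.
Hypotheses (rho_ge0 : 0 <= rho) (rho_n : rho <= n.+1%:R).
Hypothesis kappa_ge1 : 1 <= kappa.
Hypothesis kappa_n : 2 * n%:R * Q ^+ n <= kappa.

Local Notation qrho := (q `^ rho).
Local Notation D l u w := (frechet phi (TU := TU) (l := l) u w).
Local Notation K := (kappa * M * q).
Local Notation Kr := (kappa * M * qrho).

(** The common size of all error terms: [L] bounds derivatives of [phi], [Mh] powers of [M], and
    q^rho, with rho = p theta in the application, stands for omega(s,t)^theta. *)
Definition local_bound : R := local_const n kappa Q * (L * Mh * qrho).
Local Notation E := local_bound.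

Let q_ge0 : 0 <= q. Proof. exact: ltW. Qed.
Let Q_ge0 : 0 <= Q. Proof. exact: le_trans Q_ge1. Qed.
Let kappa_ge0 : 0 <= kappa. Proof. exact: le_trans kappa_ge1. Qed.
Let qrho_ge0 : 0 <= qrho. Proof. exact: powR_ge0. Qed.
Let K_ge0 : 0 <= K. Proof. by rewrite !mulr_ge0. Qed.
Let Kr_ge0 : 0 <= Kr. Proof. by rewrite !mulr_ge0. Qed.
Let pc_ge0 : 0 <= prod_const R n. Proof. by []. Qed.

Lemma q_pow_le i j : (i <= j)%N -> q ^+ i <= Q ^+ j.
Proof.
move=> ij; apply: (@le_trans _ _ (Q ^+ i)); first exact: lerXn2r.
exact: ler_weXn2l.
Qed.

(** As rho <= n + 1, every surplus of degree beyond n is worth a factor q^rho, up to a power of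
    [Q]. *)
Lemma q_pow_rho : q ^+ n.+1 <= Q ^+ n.+1 * qrho.
Proof.
have -> : q ^+ n.+1 = q `^ (n.+1%:R - rho) * qrho.
  rewrite -powRD ?subrK ?powR_mulrn //.
  by rewrite (gt_eqF q_gt0) implybT.
apply: ler_wpM2r => //.
apply: (@le_trans _ _ (Q `^ (n.+1%:R - rho))).
  by apply: ge0_ler_powR; rewrite ?nnegrE ?subr_ge0.
by rewrite -powR_mulrn //; apply: ler_powR => //; rewrite gerBl.
Qed.

(** The estimates below are brought to the product form on the left, which [E] dominates factor by
    factor. *)
Lemma local_bound_ge (c x : R) (i j : nat) : 0 <= c -> c <= (n.+1 ^ n.+1)%:R ->
  (j <= n.+1)%N -> (1 <= i <= n)%N -> 0 <= x -> x <= Q ^+ (n * n + n.+1) ->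
  prod_const R n * c * L * kappa ^+ j * M ^+ i * x * qrho <= E.
Proof.
move=> c0 cn jn hi x0 xQ; rewrite /local_bound /local_const.
have -> : prod_const R n * (n.+1 ^ n.+1)%:R * kappa ^+ n.+1 * Q ^+ (n * n + n.+1) * (L * Mh * qrho) =
  prod_const R n * (n.+1 ^ n.+1)%:R * L * kappa ^+ n.+1 * Mh * Q ^+ (n * n + n.+1) * qrho by ring.
have Mi0 : 0 <= M ^+ i by exact: exprn_ge0.
have k0 j' : 0 <= kappa ^+ j' by exact: exprn_ge0.
apply: ler_wpM2r => //; apply: ler_pM => //; first by rewrite !mulr_ge0.
apply: ler_pM; rewrite ?MMh ?mulr_ge0 //.
apply: ler_pM; rewrite ?mulr_ge0 //; last exact: ler_weXn2l.
by apply: ler_wpM2r => //; apply: ler_wpM2l.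
Qed.

Lemma n_le_const i : (i <= n)%N -> i%:R <= (n.+1 ^ n.+1)%:R :> R.
Proof.
move=> ni; rewrite ler_nat (leq_trans ni) // (leq_trans (leqnSn n)) //.
by rewrite -[leqLHS]expn1 leq_pexp2l.
Qed.

Lemma local_bound_ge0 : (0 < n)%N -> 0 <= E.
Proof.
move=> n0; have hi : (1 <= 1 <= n)%N by [].
have := @local_bound_ge 0 0 1 0 (lexx 0) _ (leq0n _) hi (lexx 0) _.
by rewrite !(mulr0, mul0r); apply => //; rewrite exprn_ge0.
Qed.

Lemma graded_sum_nat (Z : normedModType R) Dg a c (B : R) (F : nat -> tseries TV -> Z) :
  (forall i, (a <= i < c)%N -> graded q Dg B (F i)) ->
  graded q Dg ((c - a)%:R * B) (fun x => \sum_(a <= i < c) F i x).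
Proof.
move=> h; apply: (graded_ext (F := fun x => \sum_(a <= i < c | (a <= i < c)%N && true) F i x)).
  by move=> x _; rewrite -big_nat_cond.
have h' i : (a <= i < c)%N && true -> graded q Dg B (F i) by rewrite andbT; exact: h.
have hs := graded_sum q_gt0 (index_iota a c) h'; apply: (graded_le q_gt0 _ hs).
by rewrite -big_nat_cond big_const_nat iter_addr_0 mulr_natl.
Qed.

Lemma graded_scale_le1 (Z : normedModType R) Dg (B a : R) (F : tseries TV -> Z) : 0 <= B ->
  0 <= a <= 1 -> graded q Dg B F -> graded q Dg B (fun x => a *: F x).
Proof.
move=> B0 /andP[a0 a1] /(gradedZ a); apply: graded_le => //.
by rewrite ger0_norm // ler_piMl.
Qed.

Lemma inv_fact_le1 k : 0 <= (k`!%:R : R)^-1 <= 1.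
Proof.
rewrite invr_ge0 ler0n /= invf_le1 ?ler1n ?ltr0n; exact: fact_gt0.
Qed.

(* [F k] is the component of order [k] of a form evaluated along the path. *)
Lemma tail_graded (F : nat -> tseries TV -> U) l (A : TU l -> W) :
  (1 <= l <= n)%N -> linear_bounded L A ->
  (forall k, (1 <= k <= n)%N -> graded q n.+1 (M * q ^+ k) (F k)) ->
  graded q (n * n).+1 E (fun x => A (tail_power TU n F l x)).
Proof.
move=> /andP[l1 ln] hA hF.
have n0 : (0 < n)%N by exact: leq_trans ln.
pose E1 := prod_const R n * (L * (M ^+ l * (Q ^+ (n * n + n.+1) * qrho))).
have E10 : 0 <= E1 by rewrite !mulr_ge0 // ?exprn_ge0.
have h (k : {ffun 'I_l -> 'I_n.+1}) : [forall i, (0 < k i)%N] && ~~ (\sum_i k i <= n)%N ->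
    graded q (n * n).+1 E1 (fun x => A (ptens TU (fun i => F (k i) x))).
  move=> /andP[/forallP k0]; rewrite -ltnNge => kn.
  have hk i : graded q n.+1 (M * q ^+ k i) (F (k i)) by apply: hF; rewrite k0 -ltnS ltn_ord.
  have := graded_prod q_gt0 compat ln L_ge0 hA hk; rewrite -/(prod_const R n) => hp.
  apply: (graded_le q_gt0 _ (hp _)) => [|i]; last by rewrite mulr_ge0 // exprn_ge0.
  rewrite /E1 ler_wpM2l // ler_wpM2l // big_split /= prodr_const card_ord -expr_sum.
  apply: ler_wpM2l; first exact: exprn_ge0.
  have kn2 : (\sum_i k i <= n * n)%N.
    apply: (@leq_trans (\sum_(i < l) n)); first by apply: leq_sum => i _; rewrite -ltnS.
    by rewrite sum_nat_const card_ord leq_mul2r ln orbT.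
  (* The total degree is at least n + 1: the factor q^(n+1) yields q^rho and the rest is bounded by
     a power of [Q]. *)
  rewrite -(subnK kn) exprD exprD -mulrA; apply: ler_pM; rewrite ?exprn_ge0 //.
    by apply: q_pow_le; rewrite leq_subLR (leq_trans kn2) // leq_addl.
  exact: q_pow_rho.
have hs := graded_sum q_gt0 (index_enum {ffun 'I_l -> 'I_n.+1}) h.
apply: (@graded_ext _ _ _ _ _ _ _ _ _ _ (graded_le q_gt0 _ hs)) => [x _|].
  by rewrite /tail_power (linear_sum' hA.1).
apply: (@le_trans _ _ (\sum_(k : {ffun 'I_l -> 'I_n.+1}) E1)).
  rewrite big_mkcond; apply: ler_sum => k _; by case: ifP.
rewrite sumr_const card_ffun !card_ord /E1 -mulr_natl.
have hc : (n.+1 ^ l)%:R <= (n.+1 ^ n.+1)%:R :> R by rewrite ler_nat leq_pexp2l // leqW.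
have hl : (1 <= l <= n)%N by rewrite l1.
have := @local_bound_ge (n.+1 ^ l)%:R (Q ^+ (n * n + n.+1)) l 0 (ler0n _ _) hc (leq0n _) hl (exprn_ge0 _ Q_ge0) (lexx _).
apply: le_trans; rewrite le_eqVlt; apply/orP; left; apply/eqP; rewrite expr0.
by ring.
Qed.

Variables (u v : U).
Hypothesis hu : forall l, (l <= n)%N -> linear_bounded L (frechet phi (TU := TU) (l := l) u).
Hypothesis hv : forall l, (l <= n)%N -> linear_bounded L (frechet phi (TU := TU) (l := l) v).
Hypothesis holder : forall t (w : TU n), 0 <= t <= 1 ->
  `|D n (u + t *: (v - u)) w - D n u w| <= H * `|w|.
Hypothesis holder_small : H * K ^+ n <= L * kappa ^+ n.+1 * Q ^+ n.+1 * Mh * qrho.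
Hypothesis vu : `|v - u| <= K.

Variables (f g : nat -> tseries TV -> U) (b : tseries TV).
Hypothesis hf : forall k, (1 <= k <= n)%N -> homog k M (f k).
Hypothesis hg : forall k, (1 <= k <= n)%N -> homog k M (g k).
Hypothesis gb : grouplike b.
Hypothesis hb : forall i, `|b i| <= q ^+ i.

Let e := v - u.
Let e0 := form_sum n f b.
Let y x := form_sum n f (tsmul b x) - e0.
Let z x := form_sum n g x.

Hypothesis e_e0 : `|e - e0| <= Kr.
Hypothesis y_z : graded q n.+1 Kr (fun x => y x - z x).

Lemma form_value_le k : (1 <= k <= n)%N -> `|f k b| <= M * q ^+ k.
Proof.
move=> kn; have [c [_ cK] hc] := hf kn; rewrite hc //.
by apply: le_trans (cK _) _; apply: ler_wpM2l => //; exact: hb.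
Qed.

Lemma q_pow_le_linear k : (1 <= k <= n)%N -> M * q ^+ k <= M * q * Q ^+ n.
Proof.
case: k => // k /= kn; rewrite exprS -mulrA ler_wpM2l // ler_wpM2l //.
by apply: q_pow_le; exact: ltnW.
Qed.

Lemma n_sum_le : n%:R * (M * q * Q ^+ n) + n%:R * (M * q * Q ^+ n) <= K.
Proof.
have -> : n%:R * (M * q * Q ^+ n) + n%:R * (M * q * Q ^+ n) = (2 * n%:R * Q ^+ n) * (M * q) by ring.
by rewrite -[leRHS]mulrA ler_wpM2r // mulr_ge0.
Qed.

Lemma n_sum_ge0 : 0 <= n%:R * (M * q * Q ^+ n).
Proof. by rewrite !mulr_ge0 // exprn_ge0. Qed.

Lemma form_at_increment_le_sum : `|e0| <= n%:R * (M * q * Q ^+ n).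
Proof.
apply: le_trans (ler_norm_sum _ _ _) _.
apply: (@le_trans _ _ (\sum_(1 <= k < n.+1) M * q * Q ^+ n)).
  rewrite big_nat_cond [leRHS]big_nat_cond; apply: ler_sum => k /andP[kn _].
  exact: le_trans (form_value_le kn) (q_pow_le_linear kn).
by rewrite big_const_nat iter_addr_0 subSS subn0 mulr_natl.
Qed.

Lemma form_at_increment_le : `|e0| <= K.
Proof.
by apply: le_trans form_at_increment_le_sum (le_trans _ n_sum_le); rewrite lerDl n_sum_ge0.
Qed.

Lemma shift_graded k : (1 <= k <= n)%N -> graded q n.+1 (M * q ^+ k) (fun x => f k (tsmul b x)).
Proof.
by move=> kn; apply: (graded_shift q_gt0) => //; [rewrite ltnS; case/andP: kn|exact: hf].
Qed.

Lemma z_graded : graded q n.+1 K z.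
Proof.
apply: (graded_le q_gt0 _ (graded_sum_nat (B := M * q * Q ^+ n) _)).
  by rewrite subSS subn0; apply: le_trans n_sum_le; rewrite lerDl n_sum_ge0.
move=> k kn; apply: (graded_le q_gt0 (q_pow_le_linear kn)).
apply: (homog_graded q_gt0 (J := k)); first by case/andP: kn.
  by rewrite mulr_ge0 // exprn_ge0.
by rewrite mulfK ?gt_eqF ?exprn_gt0 //; exact: hg.
Qed.

Lemma y_graded : graded q n.+1 K y.
Proof.
apply: (graded_le q_gt0 n_sum_le); apply: gradedB.
  apply: (graded_le q_gt0 _ (graded_sum_nat (B := M * q * Q ^+ n) _)); rewrite ?subSS ?subn0 //.
  by move=> k kn; apply: (graded_le q_gt0 (q_pow_le_linear kn)); exact: shift_graded.
by apply: graded_cst => //; exact: form_at_increment_le_sum.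
Qed.

(* With y = f(b .) - f(b), z = g, e = v - u and e0 = f(b), the difference of the
   polynomials P_v(z) and P_u(e0 + y) - P_u(e0) is cut into z against y, the Taylor
   remainder in e, and e against e0; the tails of degree > n are bounded apart. *)
Lemma power_difference m : (1 <= m <= n)%N ->
  graded q (n * n).+1 E (fun x => D m v (pt TU m (nseq m (z x))) - D m v (pt TU m (nseq m (y x)))).
Proof.
move=> /andP[m1 mn]; have hA := hv mn.
have h (j : 'I_m) : graded q (n * n).+1 (prod_const R n * (L * (K ^+ m.-1 * Kr)))
   (fun x => D m v (ptens TU (mixed j (y x) (z x) (y x - z x) : 'I_m -> U))).
  have hK (i : 'I_m) : graded q n.+1 (if i == j then Kr else K)
      (fun x => mixed j (y x) (z x) (y x - z x) i).
    rewrite /mixed; case: ltngtP => ij.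
    - by rewrite ifN_eq; [exact: z_graded|case: eqP ij => // ->; rewrite ltnn].
    - by rewrite ifN_eq; [exact: y_graded|case: eqP ij => // ->; rewrite ltnn].
    - by rewrite (val_inj ij) eqxx.
  have := graded_prod q_gt0 compat mn L_ge0 hA hK; rewrite prod_mixed; apply.
  by move=> i; case: ifP.
have hs := graded_sum q_gt0 (index_enum 'I_m) (Q := predT) (fun j _ => h j).
apply: (@graded_ext _ _ _ _ _ _ _ _ _ _ (gradedN (graded_le q_gt0 _ hs))) => [x _|].
  by rewrite -(linear_sum' hA.1) -ptens_telescope -(linearB' hA.1) -(linearN' hA.1) opprB.
rewrite sumr_const card_ord -mulr_natl.
have hx : q ^+ m.-1 <= Q ^+ (n * n + n.+1).
  by apply: q_pow_le; rewrite (leq_trans (leq_pred m)) // (leq_trans mn) // (leq_trans (leqnSn n)) // leq_addl.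
have hm : (1 <= m <= n)%N by rewrite m1.
have := @local_bound_ge m%:R (q ^+ m.-1) m m (ler0n _ _) (n_le_const mn) (leqW mn) hm (exprn_ge0 _ q_ge0) hx.
apply: le_trans; rewrite le_eqVlt; apply/orP; left; apply/eqP.
by case: (m) m1 => // m' _; rewrite /= !exprMn !exprS; ring.
Qed.

(** D^m phi at v is expanded at u up to order n. The remainder H |e|^(n-m) meets m factors y of size
    K, hence H K^n for every m, which [holder_small] controls. *)
Lemma taylor_remainder m : (1 <= m <= n)%N ->
  graded q (n * n).+1 E (fun x => D m v (pt TU m (nseq m (y x))) -
    \sum_(r < (n - m).+1) (r`!%:R : R)^-1 *: D (r + m) u (pt TU (r + m) (nseq r e ++ nseq m (y x)))).
Proof.
move=> /andP[m1 mn].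
pose A (w : TU m) := D m v w - \sum_(r < (n - m).+1) (r`!%:R)^-1 *:
      D (r + m) u (tmulto (r + m) (pt TU r (nseq r e)) w).
have AL : linear A.
  apply: (clinearB (linear_bounded_clinear (hv mn)) _).1.
  apply: clinear_sum => r _; apply: clinearZ.
  apply: clinear_comp; last exact: tmulto_clinearr.
  apply: linear_bounded_clinear (hu _); have := ltn_ord r; rewrite ltnS -(leq_add2r m) subnK //.
have AB : linear_bounded (H * `|e| ^+ (n - m)) A.
  split=> // w; have := frechet_taylor phiN w nN mn H_ge0 holder.
  by have -> : u + (v - u) = v by rewrite addrC subrK.
have hy := graded_prod q_gt0 compat mn _ AB (fun _ : 'I_m => y_graded) (fun _ => K_ge0).
have {}hy := hy (mulr_ge0 H_ge0 (exprn_ge0 _ (normr_ge0 _))).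
apply: (@graded_ext _ _ _ _ _ _ _ _ _ _ (graded_le q_gt0 _ hy)) => [x _|].
  rewrite /A -pt_nseqE; congr (_ - _); apply: eq_bigr => r _.
  by rewrite tmulto_pt ?size_nseq.
rewrite prodr_const card_ord.
apply: (@le_trans _ _ (prod_const R n * (H * K ^+ n))).
  apply: ler_wpM2l => //; rewrite -[leLHS]mulrA; apply: ler_wpM2l => //.
  rewrite -[X in _ <= K ^+ X](subnK mn) exprD; apply: ler_wpM2r; first exact: exprn_ge0.
  by apply: lerXn2r; rewrite ?nnegrE.
apply: (@le_trans _ _ (prod_const R n * (L * kappa ^+ n.+1 * Q ^+ n.+1 * Mh * qrho))).
  exact: ler_wpM2l.
have Mh0 : 0 <= Mh by apply: le_trans (MMh (i := m) _); rewrite ?exprn_ge0 // m1.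
rewrite /local_bound /local_const.
have -> : prod_const R n * (L * kappa ^+ n.+1 * Q ^+ n.+1 * Mh * qrho) =
   prod_const R n * 1 * kappa ^+ n.+1 * Q ^+ n.+1 * (L * Mh * qrho) by ring.
apply: ler_wpM2r; first by rewrite !mulr_ge0.
apply: ler_pM; rewrite ?mulr_ge0 ?exprn_ge0 //; last by apply: ler_weXn2l => //; rewrite leq_addl.
apply: ler_wpM2r; first exact: exprn_ge0.
by apply: ler_wpM2l => //; rewrite ler1n expn_gt0.
Qed.

(** Telescoping e^(x) r against e0^(x) r leaves one factor of size Kr = kappa M q^rho among factors
    of size K; for r = 0 nothing changes. *)
Lemma base_difference m r : (1 <= m)%N -> (r + m <= n)%N ->
  graded q (n * n).+1 E (fun x => D (r + m) u (pt TU (r + m) (nseq r e ++ nseq m (y x))) -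
    D (r + m) u (pt TU (r + m) (nseq r e0 ++ nseq m (y x)))).
Proof.
move=> m1 rmn; have mn : (m <= n)%N by apply: leq_trans rmn; exact: leq_addl.
pose A (w : TU m) := D (r + m) u (tmulto (r + m) (pt TU r (nseq r e) - pt TU r (nseq r e0)) w).
have AB : linear_bounded (L * (r%:R * (K ^+ r.-1 * Kr))) A.
  apply: linear_bounded_comp => //; first exact: hu.
  apply: linear_bounded_le (tmulto_boundedr _ _ _).
  by apply: pt_nseq_sub_norm => //; exact: form_at_increment_le.
have c0 : 0 <= L * (r%:R * (K ^+ r.-1 * Kr)) by rewrite !mulr_ge0 // exprn_ge0.
have hy := graded_prod q_gt0 compat mn c0 AB (fun _ : 'I_m => y_graded) (fun _ => K_ge0).
apply: (@graded_ext _ _ _ _ _ _ _ _ _ _ (graded_le q_gt0 _ hy)) => [x _|].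
  rewrite /A -pt_nseqE (linearB' (tmulto_linearl _ _)) (linearB' (hu rmn).1).
  by rewrite !tmulto_pt ?size_nseq.
rewrite prodr_const card_ord.
have n0 : (0 < n)%N by exact: leq_trans mn.
case: r rmn {A AB c0 hy} => [|r] rmn; first by rewrite !(mul0r, mulr0) local_bound_ge0.
have rn : (r.+1 <= n)%N by apply: leq_trans rmn; exact: leq_addr.
have hx : q ^+ (r + m) <= Q ^+ (n * n + n.+1).
  by apply: q_pow_le; rewrite (leq_trans (leqnSn _)) // (leq_trans rmn) // (leq_trans (leqnSn n)) // leq_addl.
have hm : (1 <= r.+1 + m <= n)%N by [].
have := @local_bound_ge r.+1%:R (q ^+ (r + m)) (r.+1 + m) (r.+1 + m) (ler0n _ _) (n_le_const rn) (leqW rmn) hm (exprn_ge0 _ q_ge0) hx.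
apply: le_trans; rewrite le_eqVlt; apply/orP; left; apply/eqP.
by rewrite /= addSn !exprS !exprD !exprMn; ring.
Qed.

Definition composed_power (F : nat -> tseries TV -> U) (u : U) (x : tseries TV) : W :=
  \sum_(1 <= l < n.+1) (l`!%:R : R)^-1 *: D l u (trunc_power TU n F l x).

Local Notation G := (fun l s => D l u (pt TU l s)).

Lemma frechet_sym_taylor (a c : U) :
  \sum_(1 <= l < n.+1) (l`!%:R : R)^-1 *: D l u (pt TU l (nseq l (a + c))) -
  \sum_(1 <= l < n.+1) (l`!%:R : R)^-1 *: D l u (pt TU l (nseq l a)) =
  \sum_(1 <= m < n.+1) (m`!%:R : R)^-1 *:
    \sum_(r < (n - m).+1) (r`!%:R : R)^-1 *: D (r + m)%N u (pt TU (r + m) (nseq r a ++ nseq m c)).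
Proof.
apply: (@sym_taylor R U W n G) => [l s t ln sl|l a' b' s ln sl].
  by apply: (frechet_pt_perm phiN) => //; exact: leq_trans nN.
have sC : clinear (fun x => pt TU l ([::] ++ x :: s)) by exact: pt_slot.
by rewrite (linearD' sC.1 a' b') (linearD' (hu ln).1).
Qed.

Lemma composed_powerE F (w : U) x : (forall l, (l <= n)%N -> linear (frechet phi (TU := TU) (l := l) w)) ->
  composed_power F w x =
  \sum_(1 <= l < n.+1) (l`!%:R : R)^-1 *: D l w (pt TU l (nseq l (form_sum n F x))) -
  \sum_(1 <= l < n.+1) (l`!%:R : R)^-1 *: D l w (tail_power TU n F l x).
Proof.
move=> wL; rewrite -sumrB; apply: eq_big_nat => l /andP[_ ln].
by rewrite -scalerBr pt_form_sum (linearD' (wL l ln)) addrK.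
Qed.

(** The count n (n + 6): for each of the n orders m, one [power_difference], one [taylor_remainder]
    and at most n + 1 terms [base_difference]; besides, three sums of n tails, for g, for f shifted
    by b and for f at b. *)
Theorem local_graded : (0 < n)%N ->
  graded q (n * n).+1 ((n * (n + 6))%:R * E)
    (fun x => composed_power g v x - (composed_power f u (tsmul b x) - composed_power f u b)).
Proof.
move=> n0; have E0 := local_bound_ge0 n0.
pose main m x := (m`!%:R : R)^-1 *: (
   (D m v (pt TU m (nseq m (z x))) - D m v (pt TU m (nseq m (y x)))) +
   (D m v (pt TU m (nseq m (y x))) -
    \sum_(r < (n - m).+1) (r`!%:R : R)^-1 *: D (r + m) u (pt TU (r + m) (nseq r e ++ nseq m (y x)))) +
   \sum_(r < (n - m).+1) (r`!%:R : R)^-1 *: (D (r + m) u (pt TU (r + m) (nseq r e ++ nseq m (y x))) -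
    D (r + m) u (pt TU (r + m) (nseq r e0 ++ nseq m (y x))))).
pose tl (w : U) (F : nat -> tseries TV -> U) l x := (l`!%:R : R)^-1 *: D l w (tail_power TU n F l x).
have hmain m : (1 <= m < n.+1)%N -> graded q (n * n).+1 (n.+3%:R * E) (main m).
  move=> m1n; have /andP[m1 mn] := m1n; apply: graded_scale_le1; [exact: mulr_ge0|exact: inv_fact_le1|].
  have -> : n.+3%:R * E = E + E + n.+1%:R * E by rewrite -!natr1; ring.
  apply: gradedD; first by apply: gradedD; [exact: power_difference|exact: taylor_remainder].
  have hr (r : 'I_(n - m).+1) : graded q (n * n).+1 E (fun x => (r`!%:R : R)^-1 *:
     (D (r + m) u (pt TU (r + m) (nseq r e ++ nseq m (y x))) -
      D (r + m) u (pt TU (r + m) (nseq r e0 ++ nseq m (y x))))).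
    apply: graded_scale_le1 => //; first exact: inv_fact_le1.
    apply: base_difference => //; have := ltn_ord r; rewrite ltnS -(leq_add2r m) subnK //.
  have := graded_sum q_gt0 (index_enum 'I_(n - m).+1) (Q := predT) (fun r _ => hr r).
  apply: graded_le => //; rewrite sumr_const card_ord -[leLHS]mulr_natl ler_wpM2r // ler_nat.
  by rewrite ltnS leq_subr.
have htl w F l : (1 <= l < n.+1)%N -> linear_bounded L (frechet phi (TU := TU) (l := l) w) ->
    (forall k, (1 <= k <= n)%N -> graded q n.+1 (M * q ^+ k) (F k)) ->
    graded q (n * n).+1 E (tl w F l).
  move=> ln wB hF; apply: graded_scale_le1 => //; first exact: inv_fact_le1.
  exact: tail_graded.
have g1 : graded q (n * n).+1 (n%:R * (n.+3%:R * E)) (fun x => \sum_(1 <= m < n.+1) main m x).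
  by have := graded_sum_nat hmain; rewrite subSS subn0.
have h2 l : (1 <= l < n.+1)%N -> graded q (n * n).+1 E (tl v g l).
  move=> l1n; apply: htl => //; first by apply: hv; case/andP: l1n.
  move=> k kn; apply: (homog_graded q_gt0 (J := k)); first by case/andP: kn.
    by rewrite mulr_ge0 // exprn_ge0.
  by rewrite mulfK ?gt_eqF ?exprn_gt0 //; exact: hg.
have h3 l : (1 <= l < n.+1)%N -> graded q (n * n).+1 E (fun x => tl u f l (tsmul b x)).
  move=> l1n; apply: (htl u (fun k x => f k (tsmul b x))) => //; first by apply: hu; case/andP: l1n.
  exact: shift_graded.
have h4 l : (1 <= l < n.+1)%N -> graded q (n * n).+1 E (fun _ : tseries TV => tl u f l b).
  move=> l1n; apply: (graded_ext (F := tl u (fun k _ => f k b) l)) => //.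
  apply: htl => //; first by apply: hu; case/andP: l1n.
  by move=> k kn; apply: graded_cst => //; exact: form_value_le.
have g2 := graded_sum_nat h2; have g3 := graded_sum_nat h3; have g4 := graded_sum_nat h4.
rewrite !subSS !subn0 in g2 g3 g4.
have := gradedD (gradedB g1 g2) (gradedB g3 g4).
have -> : n%:R * (n.+3%:R * E) + n%:R * E + (n%:R * E + n%:R * E) = (n * (n + 6))%:R * E.
  by rewrite natrM natrD -!natr1; ring.
apply: graded_ext => x _.
rewrite (composed_powerE _ _ (fun l ln => (hv ln).1)) !(composed_powerE _ _ (fun l ln => (hu ln).1)).
have sh : form_sum n f (tsmul b x) = e0 + y x by rewrite /y addrC subrK.
rewrite sh -/e0 -/(z x).
have := frechet_sym_taylor e0 (y x).
set S1 := \sum_(1 <= l < n.+1) _ *: D l u (pt TU l (nseq l (e0 + y x))).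
set S2 := \sum_(1 <= l < n.+1) _ *: D l u (pt TU l (nseq l e0)).
set S3 := RHS.
set S4 := \sum_(1 <= l < n.+1) _ *: D l v (pt TU l (nseq l (z x))).
move=> h12; have -> : S1 = S3 + S2 by rewrite -h12 subrK.
have -> : \sum_(1 <= m < n.+1) main m x = S4 - S3.
  rewrite /S4 /S3 -sumrB; apply: eq_bigr => m _; rewrite /main -scalerBr; congr (_ *: _).
  set T1 := D m v _; set T2 := D m v _.
  under [X in _ + _ + X]eq_bigr => r _ do rewrite scalerBr.
  rewrite sumrB; set T3 := \sum_(r < _) _; set T4 := \sum_(r < _) _.
  by clearbody T1 T2 T3 T4; zmod_eq.
rewrite /tl; clearbody S2 S3 S4; clear g1 g2 g3 g4 hmain htl h12 h2 h3 h4.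
move: (\sum_(1 <= l < n.+1) _ *: D l v (tail_power _ _ _ _ x)) => Z1.
move: (\sum_(1 <= l < n.+1) _ *: D l u (tail_power _ _ _ _ (tsmul b x))) => Z2.
move: (\sum_(1 <= l < n.+1) _ *: D l u (tail_power _ _ _ _ b)) => Z3.
by zmod_eq.
Qed.

Lemma graded_at_one (Z : normedModType R) Dg B (F : tseries TV -> Z) :
  graded q Dg.+1 B F -> `|F (tsone TV)| <= B.
Proof.
move=> [c cK hc]; have g1 := grouplike1 TV.
rewrite hc // big_ord_recl big1 ?addr0; last first.
  move=> i _; have [cL _] := cK _ (ltn_ord (lift ord0 i)).
  exact: (linear0' cL).
have [_ /(_ (tsone TV 0%N))] := cK 0%N (ltn0Sn _).
by rewrite expr0 divr1 tsone0 pt0_norm mulr1.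
Qed.

Lemma frechet0E (w : U) : D 0 w (pt TU 0 [::]) = phi w.
Proof. by rewrite /= scalar_part1 scale1r. Qed.

(** The count 2 n + 1: one Taylor remainder of [phi] itself, n exchanges of e for e0, n tails at b.
    Tails are constants here, and bounding a constant graded function at the unit bounds its
    norm. *)
Theorem local_scalar : (0 < n)%N ->
  `|phi v - phi u - composed_power f u b| <= (2 * n).+1%:R * E.
Proof.
move=> n0; have E0 := local_bound_ge0 n0.
have pc1 : 1 <= prod_const R n by rewrite ler1n muln_gt0 expn_gt0 fact_gt0.
have h1 : `|phi v - \sum_(r < n.+1) (r`!%:R : R)^-1 *: D r u (pt TU r (nseq r e))| <= E.
  have := frechet_taylor phiN (pt TU 0 [::]) nN (leq0n n) H_ge0 holder.
  have -> : u + (v - u) = v by rewrite addrC subrK.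
  rewrite subn0 frechet0E pt0_norm mulr1.
  under eq_bigr => r _ do rewrite addn0 tmulto1r.
  move=> h; apply: le_trans h _.
  apply: (@le_trans _ _ (H * K ^+ n)).
    by apply: ler_wpM2l => //; apply: lerXn2r; rewrite ?nnegrE.
  apply: le_trans holder_small _; rewrite /local_bound /local_const.
  have Mh0 : 0 <= Mh by apply: le_trans (MMh (i := 1) _); rewrite ?exprn_ge0.
  have -> : L * kappa ^+ n.+1 * Q ^+ n.+1 * Mh * qrho = 1 * kappa ^+ n.+1 * Q ^+ n.+1 * (L * Mh * qrho) by ring.
  apply: ler_wpM2r; first by rewrite !mulr_ge0.
  apply: ler_pM; rewrite ?mulr_ge0 ?exprn_ge0 //; last by apply: ler_weXn2l => //; rewrite leq_addl.
  apply: ler_wpM2r; first exact: exprn_ge0.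
  by rewrite -[leLHS]mulr1; apply: ler_pM => //; rewrite ler1n expn_gt0.
have h2 r : (1 <= r < n.+1)%N -> `|D r u (pt TU r (nseq r e)) - D r u (pt TU r (nseq r e0))| <= E.
  move=> /andP[r1 rn]; have [DL DK] := hu (rn : (r <= n)%N).
  rewrite -(linearB' DL); apply: le_trans (DK _) _.
  apply: (@le_trans _ _ (L * (r%:R * (K ^+ r.-1 * Kr)))).
    by apply: ler_wpM2l => //; apply: pt_nseq_sub_norm => //; exact: form_at_increment_le.
  have hx : q ^+ r.-1 <= Q ^+ (n * n + n.+1).
    by apply: q_pow_le; rewrite (leq_trans (leq_pred r)) // (leq_trans (rn : (r <= n)%N)) // (leq_trans (leqnSn n)) // leq_addl.
  have hr : (1 <= r <= n)%N by rewrite r1.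
  have := @local_bound_ge r%:R (q ^+ r.-1) r r (ler0n _ _) (n_le_const rn) (leqW rn) hr (exprn_ge0 _ q_ge0) hx.
  apply: le_trans.
  apply: (@le_trans _ _ (1 * (L * (r%:R * (K ^+ r.-1 * Kr))))); first by rewrite mul1r.
  apply: (@le_trans _ _ (prod_const R n * (L * (r%:R * (K ^+ r.-1 * Kr))))).
    by apply: ler_wpM2r => //; rewrite !mulr_ge0 // exprn_ge0.
  rewrite le_eqVlt; apply/orP; left; apply/eqP.
  by case: (r) r1 => // r' _; rewrite /= !exprMn !exprS; ring.
have h3 l : (1 <= l < n.+1)%N -> `|D l u (tail_power TU n f l b)| <= E.
  move=> l1n; have := @tail_graded (fun k _ => f k b) l _ l1n (hu (l := l) _).
  have ln : (l <= n)%N by case/andP: l1n.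
  move=> /(_ ln) h; apply: (@graded_at_one W (n * n) E (fun _ => D l u (tail_power TU n f l b))).
  by apply: h => k kn; apply: graded_cst => //; exact: form_value_le.
have sumE (F : nat -> W) : (forall l, (1 <= l < n.+1)%N -> `|F l| <= E) ->
    `|\sum_(1 <= l < n.+1) (l`!%:R : R)^-1 *: F l| <= n%:R * E.
  move=> hF; apply: le_trans (ler_norm_sum _ _ _) _.
  apply: (@le_trans _ _ (\sum_(1 <= l < n.+1) E)).
    rewrite big_nat_cond [leRHS]big_nat_cond; apply: ler_sum => l /andP[/hF hl _].
    have /andP[i0 i1] := inv_fact_le1 l.
    by rewrite normrZ ger0_norm // -[leRHS]mul1r; apply: ler_pM.
  by rewrite big_const_nat iter_addr_0 subSS subn0 mulr_natl.
have k2 := sumE _ h2; have k3 := sumE _ h3.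
have -> : phi v - phi u - composed_power f u b =
  (phi v - \sum_(r < n.+1) (r`!%:R : R)^-1 *: D r u (pt TU r (nseq r e))) +
  \sum_(1 <= l < n.+1) (l`!%:R : R)^-1 *: (D l u (pt TU l (nseq l e)) - D l u (pt TU l (nseq l e0))) +
  \sum_(1 <= l < n.+1) (l`!%:R : R)^-1 *: D l u (tail_power TU n f l b).
  rewrite (composed_powerE _ _ (fun l ln => (hu ln).1)) -/e0.
  rewrite -(big_mkord xpredT (fun r => (r`!%:R : R)^-1 *: D r u (pt TU r (nseq r e)))).
  rewrite (big_ltn (ltn0Sn n)) frechet0E invr1 scale1r.
  under [X in _ = _ + X + _]eq_bigr => l _ do rewrite scalerBr.
  rewrite sumrB.
  move: (\sum_(1 <= l < n.+1) _ *: D l u (pt TU l (nseq l e))) => Z1.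
  move: (\sum_(1 <= l < n.+1) _ *: D l u (pt TU l (nseq l e0))) => Z2.
  move: (\sum_(1 <= l < n.+1) _ *: D l u (tail_power TU n f l b)) => Z3.
  by move: (phi u) (phi v) => Z4 Z5; zmod_eq.
have -> : (2 * n).+1%:R * E = E + n%:R * E + n%:R * E by rewrite -natr1 natrM; ring.
apply: le_trans (ler_normD _ _) _; apply: lerD => //.
by apply: le_trans (ler_normD _ _) _; apply: lerD.
Qed.

End LocalEstimate.

(** * Rough paths and one-forms *)

Section Controls.
Variable R : realType.

(** Continuity and vanishing on the diagonal give smallness near each diagonal point; compactness of
    [0, 1] makes it uniform. *)
Lemma control_small (w : R -> R -> R) : control w -> forall delta : R, 0 < delta ->
  exists2 d : R, 0 < d & forall a b, 0 <= a -> a <= b -> b <= 1 -> b - a < d -> w a b <= delta.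
Proof.
move=> [wC w0 wd _] delta d0.
pose P (d a : R) := forall b, 0 <= a -> a <= b -> b <= 1 -> b - a < d -> w a b <= delta.
have loc (x : R) : `[0, 1]%classic x -> \forall a \near x & d \near 0^'+, P d a.
  rewrite /= in_itv /= => /andP[x0 x1].
  have wx : w x x = 0 by exact: wd.
  have simplex : [set st : R * R | 0 <= st.1 /\ st.1 <= st.2 /\ st.2 <= 1] (x, x) by split.
  have /cvgrPdist_lt /(_ _ d0) : (fun st : R * R => w st.1 st.2) st @[st --> within [set st : R * R | 0 <= st.1 /\ st.1 <= st.2 /\ st.2 <= 1] (nbhs (x, x))] --> (0 : R).
    have hc := iffLR (subspace_continuousP _ _) wC; have := hc _ simplex; rewrite /from_subspace /= wx; exact.
  rewrite nearE /within /= => -[[A B] [/= /nbhs_ballP[r r0 hr] /nbhs_ballP[r' r0' hr']] AB].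
  have m0 : 0 < Num.min r r' by rewrite lt_min r0.
  exists (ball x (Num.min r r' / 2), [set d | d < Num.min r r' / 2]) => /=.
    split; first by apply: nbhsx_ballx; rewrite divr_gt0.
    by apply: nbhs_right_lt; rewrite divr_gt0.
  move=> [a d] [/= ax dlt] b a0 ab b1 bad.
  suff : `|0 - w a b| < delta by rewrite sub0r normrN; move=> h; rewrite ltW // (le_lt_trans (ler_norm _)).
  apply: (AB (a, b)); last by split.
  split; [apply: hr|apply: hr'].
    by apply: le_ball ax; apply: (@le_trans _ _ (Num.min r r')); [lra|rewrite ge_min lexx].
  move: ax; rewrite -!ball_normE /= => ax.
  have : `|x - b| < Num.min r r'.
    rewrite -(subrKA a); apply: le_lt_trans (ler_normD _ _) _.
    rewrite [X in _ < X]splitr; apply: ltrD => //.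
    by rewrite distrC ger0_norm ?subr_ge0 //; exact: lt_trans dlt.
  by rewrite lt_min => /andP[].
have := (compact_near_coveringP _).1 (@segment_compact R 0 1) _ _ P _ loc.
case=> e /= e0 he; exists (e / 2); first by rewrite divr_gt0.
move=> a b a0 ab b1 bad.
apply: (he (e / 2)) => //=; rewrite ?divr_gt0 //.
  by rewrite /ball_ /= sub0r normrN gtr0_norm ?divr_gt0 //; lra.
by rewrite in_itv /= a0 (le_trans ab).
Qed.

End Controls.

(** * Increments and p-variation *)

Section Increments.
Variables (R : realType) (V : completeNormedModType R) (TV : tensor_powers V).
Variable X : R -> tseries TV.

Lemma increment_grouplike s t : grouplike (X s) -> grouplike (X t) -> grouplike (increment X s t).
Proof. by move=> gs gt; apply: grouplikeM => //; exact: grouplikeV. Qed.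

Lemma increment_mul s u t : grouplike (X u) ->
  tsmul (increment X s u) (increment X u t) = increment X s t.
Proof. by move=> gu; rewrite /increment tsmulA -[tsmul (X u) _]tsmulA tsmulV ?gu.1 // tsmul1l. Qed.

Lemma increment_id s : grouplike (X s) -> increment X s s = tsone TV.
Proof. by move=> gs; rewrite /increment tsmulVl ?gs.1. Qed.

Lemma big_partition (A : nmodType) (G : R -> R -> A) (s t : R) (D : seq R) :
  \sum_(0 <= i < size D) G (nth t (s :: D) i) (nth t D i) =
  (fix S a D := if D is x :: D' then G a x + S x D' else 0) s D.
Proof.
elim: D s => [|x D IH] s; first by rewrite big_nil.
by rewrite /= big_nat_recl //= -IH.
Qed.

Lemma riemann_sum_rsum (U : completeNormedModType R) (beta : R -> tseries TV -> U) t D :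
  riemann_sum X beta t D = rsum (fun a b => beta a (increment X a b)) 0 D.
Proof. by rewrite /riemann_sum (big_partition (fun a b => beta a (increment X a b))). Qed.

Variables (p : R) (w : R -> R -> R).
Hypotheses (p_ge1 : 1 <= p) (gX : forall t, 0 <= t -> t <= 1 -> grouplike (X t)).
Hypotheses (w_control : control w).
Hypothesis pvarp_w : forall s t, 0 <= s -> s <= t -> t <= 1 -> (pvarp p X s t <= (w s t)%:E)%E.

Let step a b : \bar R := poweR (gdist (X a) (X b)) p.
Fixpoint variation_sum (s : R) (D : seq R) : \bar R := if D is x :: D' then (step s x + variation_sum x D')%E else 0%E.

Let step_ge0 a b : (0 <= step a b)%E. Proof. exact: poweR_ge0. Qed.

Lemma variation_sum_ge0 s D : (0 <= variation_sum s D)%E.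
Proof. by elim: D s => //= x D IH s; rewrite adde_ge0. Qed.

Lemma variation_sum_cat s D1 D2 : variation_sum s (D1 ++ D2) = (variation_sum s D1 + variation_sum (last s D1) D2)%E.
Proof. by elim: D1 s => [|x D IH] s /=; rewrite ?add0e // IH addeA. Qed.

Lemma pvarpE s t : pvarp p X s t = ereal_sup [set variation_sum s D | D in [set D | itv_partition s t D]].
Proof.
rewrite /pvarp; congr ereal_sup; apply: eq_imagel => D _.
by rewrite (big_partition step).
Qed.

Lemma variation_sum_le s t D : itv_partition s t D -> (variation_sum s D <= pvarp p X s t)%E.
Proof. by move=> hD; rewrite pvarpE; apply: ereal_sup_ubound; exists D. Qed.

Lemma itv_partition1 (s t : R) : s < t -> itv_partition s t [:: t].
Proof. by move=> st; split; rewrite /= ?st. Qed.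

Lemma pvarp_ge0 s t : s <= t -> (0 <= pvarp p X s t)%E.
Proof.
rewrite le_eqVlt => /orP[/eqP <-|st].
  by apply: le_trans (variation_sum_ge0 s [::]) (variation_sum_le _); split.
by apply: le_trans (variation_sum_ge0 s [:: t]) (variation_sum_le (itv_partition1 st)).
Qed.

Local Notation vw s t := (fine (pvarp p X s t)).

Lemma pvarp_fine s t : 0 <= s -> s <= t -> t <= 1 -> (vw s t)%:E = pvarp p X s t.
Proof.
move=> s0 st t1; apply: fineK; rewrite fin_numElt (lt_le_trans _ (pvarp_ge0 st)) ?ltNyr //=.
by apply: le_lt_trans (pvarp_w s0 st t1) _; rewrite ltry.
Qed.

Lemma fine_pvarp_ge0 s t : 0 <= s -> s <= t -> t <= 1 -> 0 <= vw s t.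
Proof. by move=> s0 st t1; rewrite -lee_fin pvarp_fine // pvarp_ge0. Qed.

Lemma fine_pvarp_le s t : 0 <= s -> s <= t -> t <= 1 -> vw s t <= w s t.
Proof. by move=> s0 st t1; rewrite -lee_fin pvarp_fine // pvarp_w. Qed.

Lemma fine_pvarp_diag s : 0 <= s -> s <= 1 -> vw s s = 0.
Proof.
move=> s0 s1; apply/eqP; rewrite eq_le fine_pvarp_ge0 // andbT.
by case: w_control => _ _ wd _; rewrite -(wd s) // fine_pvarp_le.
Qed.

(** Partitions of [s, u] and [u, t] concatenate; the two suprema are taken one after the other, the
    other quantity being moved across as a finite number. *)
Lemma fine_pvarp_superadditive s u t : 0 <= s -> s <= u -> u <= t -> t <= 1 -> vw s u + vw u t <= vw s t.
Proof.
move=> s0 su ut t1; have u0 := le_trans s0 su; have u1 := le_trans ut t1; have st := le_trans su ut.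
have fin a b : 0 <= a -> a <= b -> b <= 1 -> pvarp p X a b \is a fin_num.
  by move=> a0 ab b1; rewrite -(pvarp_fine a0 ab b1).
rewrite -lee_fin [leLHS](_ : _ = (pvarp p X s u + pvarp p X u t)%E); last first.
  by rewrite -(pvarp_fine s0 su u1) -(pvarp_fine u0 ut t1).
rewrite (pvarp_fine s0 st t1).
rewrite -leeBrDr ?fin // [X in (X <= _)%E]pvarpE; apply: ge_ereal_sup => _ [D1 hD1 <-].
have fD : variation_sum s D1 \is a fin_num.
  rewrite fin_numElt (lt_le_trans _ (variation_sum_ge0 _ _)) ?ltNyr //=.
  by apply: le_lt_trans (variation_sum_le hD1) _; rewrite -(pvarp_fine s0 su u1) ltry.
rewrite leeBrDr ?fin // addeC -leeBrDr // [X in (X <= _)%E]pvarpE.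
apply: ge_ereal_sup => _ [D2 hD2 <-]; rewrite leeBrDr // addeC.
have -> : (variation_sum s D1 + variation_sum u D2)%E = variation_sum s (D1 ++ D2).
  by rewrite variation_sum_cat; case: hD1 => _ /eqP ->.
by apply: variation_sum_le; exact: itv_partition_cat hD2.
Qed.

(** The partition of [s, t] into one step bounds the distance of X_s and X_t, which dominates the
    k-th root of every component of order k >= 1. *)
Lemma increment_norm s t k : 0 <= s -> s <= t -> t <= 1 ->
  `|increment X s t k| <= (vw s t `^ p^-1) ^+ k.
Proof.
move=> s0 st t1; have t0 := le_trans s0 st; have s1 := le_trans st t1.
have p0 : 0 < p by exact: lt_le_trans p_ge1.
case: k => [|k].
  have [-> _] := increment_grouplike (gX s0 s1) (gX t0 t1).
  by rewrite ptens0_norm.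
have [<-|sn] := eqVneq s t.
  rewrite increment_id; last exact: gX.
  by rewrite [tsone TV k.+1]/(0 : TV k.+1) normr0 exprn_ge0 // powR_ge0.
have lst : s < t by rewrite lt_neqAle sn.
set a := `|_|; have a0 : 0 <= a by exact: normr_ge0.
have kpos : 0 < (k.+1%:R : R) by rewrite ltr0n.
have h1 : ((a `^ (k.+1%:R^-1))%:E <= gdist (X s) (X t))%E.
  by apply: ereal_sup_ubound; exists k.+1.
have h2 : (((a `^ (k.+1%:R^-1)) `^ p)%:E <= (vw s t)%:E)%E.
  rewrite (pvarp_fine s0 st t1); apply: le_trans (variation_sum_le (itv_partition1 lst)).
  rewrite /variation_sum adde0 /step -poweR_EFin.
  have := gt0_ler_poweR (ltW p0) _ _ h1; rewrite !in_itv /= !leey !andbT.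
  by apply; rewrite ?lee_fin ?powR_ge0 //; apply: le_trans h1; rewrite lee_fin powR_ge0.
move: h2; rewrite lee_fin => h2.
have h3 : a `^ k.+1%:R^-1 <= vw s t `^ p^-1.
  set c := a `^ _ in h2 *; have c0 : 0 <= c by exact: powR_ge0.
  have -> : c = (c `^ p) `^ p^-1 by rewrite -powRrM divff ?gt_eqF // powRr1.
  by apply: ge0_ler_powR => //; rewrite ?invr_ge0 ?nnegrE ?powR_ge0 ?fine_pvarp_ge0 // ltW.
have -> : a = (a `^ k.+1%:R^-1) ^+ k.+1.
  by rewrite -powR_mulrn ?powR_ge0 // -powRrM mulVf ?gt_eqF // powRr1.
by apply: lerXn2r; rewrite ?nnegrE ?powR_ge0.
Qed.

End Increments.

Section BigMax.
Variables (R : realType) (F : nat -> \bar R) (a b : nat).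

Lemma bigmaxe_ge0 : (0 <= \big[maxe/0%E]_(a <= i < b) F i)%E.
Proof.
elim: (index_iota a b) => [|i r IH]; first by rewrite big_nil.
by rewrite big_cons le_max IH orbT.
Qed.

Lemma bigmaxe_le (B : \bar R) : (0 <= B)%E ->
  (forall k, (a <= k < b)%N -> (F k <= B)%E) -> (\big[maxe/0%E]_(a <= i < b) F i <= B)%E.
Proof.
move=> B0 h; rewrite big_nat_cond; apply: (big_ind (fun z => (z <= B)%E)) => // [x y xB yB|i].
  by rewrite ge_max xB.
by rewrite andbT => /h.
Qed.

Lemma le_bigmaxe_nat k : (a <= k < b)%N -> (F k <= \big[maxe/0%E]_(a <= i < b) F i)%E.
Proof.
move=> kab; have : k \in index_iota a b by rewrite mem_index_iota.
elim: (index_iota a b) => // i r IH; rewrite inE big_cons le_max.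
by case/orP => [/eqP ->|/IH ->]; rewrite ?lexx ?orbT.
Qed.

End BigMax.

(** * Coefficients of one-forms *)

Section Membership.
Variables (R : realType) (V Z : completeNormedModType R) (TV : tensor_powers V).
Variable n : nat.
Implicit Types (f g F : tseries TV -> Z) (b x : tseries TV).

Lemma coefs_homog f M k : in_E n f -> (1 <= k <= n)%N -> opnorm (coefs n f k) <= M ->
  homog k M (fun x => coefs n f k (x k)).
Proof.
move=> /coefsP[cC _] kn cM; exists (coefs n f k) => //.
by apply: linear_bounded_le cM _; apply: clinear_linear_bounded; exact: cC.
Qed.

Lemma form_sum_coefs f x : in_E n f -> grouplike x ->
  form_sum n (fun k (x : tseries TV) => coefs n f k (x k)) x = f x.
Proof. by move=> /coefsP[_ h] gx; rewrite [RHS]h. Qed.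

Lemma homog_in_E J K F : (1 <= J <= n)%N -> homog J K F -> in_E n F.
Proof.
move=> Jn [c cK hc].
exists (fun J' (y : TV J') => if J' =P J is ReflectT e then c (ecast k (TV k) e y) else 0); split.
  move=> J' _; case: eqP => [e|_]; last exact: clinear0.
  by subst J'; rewrite /=; exact: linear_bounded_clinear cK.
move=> x gx; rewrite hc // (bigD1_seq J) ?iota_uniq ?mem_index_iota //= big1 ?addr0.
  by case: eqP => // e; rewrite ecast_series.
by move=> i iJ; case: eqP iJ => // ->; rewrite eqxx.
Qed.

Lemma in_E0 : in_E n (fun _ : tseries TV => 0 : Z).
Proof. by exists (fun _ _ => 0); split=> [k _|x _]; [exact: clinear0|rewrite big1]. Qed.

Lemma in_ED f g : in_E n f -> in_E n g -> in_E n (fun x => f x + g x).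
Proof.
move=> [c [cC hc]] [d [dC hd]]; exists (fun k y => c k y + d k y); split=> [k kn|x gx].
  by apply: clinearD; [exact: cC|exact: dC].
by rewrite hc // hd // big_split.
Qed.

Lemma in_EN f : in_E n f -> in_E n (fun x => - f x).
Proof.
move=> [c [cC hc]]; exists (fun k y => - c k y); split=> [k kn|x gx].
  have := clinearB (clinear0 (TV k) Z) (cC k kn); congr clinear.
  by apply/funext => y; rewrite sub0r.
by rewrite hc // sumrN.
Qed.

Lemma in_EZ (a : R) f : in_E n f -> in_E n (fun x => a *: f x).
Proof.
move=> [c [cC hc]]; exists (fun k y => a *: c k y); split=> [k kn|x gx].
  by apply: clinearZ; exact: cC.
by rewrite hc // scaler_sumr.
Qed.

Lemma in_E_sum I (r : seq I) (Q : pred I) (F : I -> tseries TV -> Z) :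
  (forall i, Q i -> in_E n (F i)) -> in_E n (fun x => \sum_(i <- r | Q i) F i x).
Proof.
move=> h; elim: r => [|i r IH].
  by have := in_E0; congr in_E; apply/funext => x; rewrite big_nil.
case Qi : (Q i); last by have := IH; congr in_E; apply/funext => x; rewrite big_cons Qi.
by have := in_ED (h i Qi) IH; congr in_E; apply/funext => x; rewrite big_cons Qi.
Qed.

Lemma in_E_ext f g : (forall x, grouplike x -> f x = g x) -> in_E n f -> in_E n g.
Proof. by move=> fg [c [cC hc]]; exists c; split=> // x gx; rewrite -fg // hc. Qed.

(** The unit has no component of positive order, so vanishing there removes the constant term. *)
Lemma graded_in_E q K F : graded q n.+1 K F -> F (tsone TV) = 0 -> in_E n F.
Proof.
move=> [c cK hc] F1; exists c; split=> [k /andP[_ kn]|x gx].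
  by apply: linear_bounded_clinear (cK k _); rewrite ltnS.
rewrite hc // big_ord_recl big_add1 big_mkord /= [X in X + _](_ : _ = 0) ?add0r //.
rewrite -[RHS]F1 (hc _ (grouplike1 _)) big_ord_recl big1 ?addr0 => [|i _].
  by case: gx => ->.
have [cL _] := cK _ (ltn_ord (lift ord0 i)); exact: (linear0' cL).
Qed.

(** The estimate may come from a representation with degrees up to D - 1, well beyond n: by
    uniqueness it agrees with the coefficients of the form in degrees at most n. *)
Lemma coefs_graded q D K F k : 0 < q -> 0 <= K -> graded q D K F -> in_E n F -> (n < D)%N ->
  (1 <= k <= n)%N -> opnorm (coefs n F k) <= K / q ^+ k.
Proof.
move=> q0 K0 [c cK hc] /coefsP[dC hd] nD kn; apply: opnorm_le.
  by rewrite divr_ge0 // exprn_ge0 // ltW.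
have kD : (k < D)%N by case/andP: kn => _ /leq_ltn_trans; apply.
suff -> : coefs n F k = c k by exact: cK.
apply/funext => y; apply/eqP; rewrite -subr_eq0; apply/eqP.
pose d j (y : TV j) := (if (0 < j <= n)%N then coefs n F j y else 0) - c j y.
have dE j : (j < D)%N -> clinear (d j).
  move=> jD; apply: clinearB; last exact: linear_bounded_clinear (cK j jD).
  case jn : (0 < j <= n)%N; last exact: clinear0.
  exact: dC.
have := @homogeneous_unique _ _ TV Z D d dE _ k kD y; rewrite /d kn; apply => x gx.
rewrite sumrB -hc // hd //; apply/eqP; rewrite subr_eq0; apply/eqP.
rewrite -(big_mkord xpredT (fun j => if (0 < j <= n)%N then coefs n F j (x j) else 0)).
rewrite (big_cat_nat (n := n.+1)) //= [X in _ + X]big1_seq ?addr0; last first.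
  by move=> i /=; rewrite mem_index_iota => /andP[ni _]; rewrite [(i <= n)%N]leqNgt ni andbF.
rewrite big_ltn //= add0r; apply: eq_big_nat => i /andP[i1 i2].
by rewrite i1 -ltnS i2.
Qed.

Lemma shift_in_E q f b : 0 < q -> in_E n f -> grouplike b -> (forall i, `|b i| <= q ^+ i) ->
  in_E n (shift f b).
Proof.
move=> q0 fE gb bq; have one_b : tsmul b (tsone TV) = b by exact: tsmul1r.
have h k : (1 <= k < n.+1)%N && true ->
    graded q n.+1 (opnorm (coefs n f k) * q ^+ k) (fun x => coefs n f k (tsmul b x k)).
  rewrite andbT => kn.
  apply: (@graded_shift _ _ _ _ q0 _ _ k _ (fun x => coefs n f k (x k))) => //.
  - by case/andP: kn.
  - exact: opnorm_ge0.
  exact: coefs_homog.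
have := graded_sum q0 (index_iota 1 n.+1) h; set K := \sum_(i <- _ | _) _ => hK.
apply: (graded_in_E (q := q) (K := K + `|f b|)); last by rewrite /shift one_b subrr.
apply: gradedB; last exact: graded_cst.
apply: graded_ext hK => x gx; have [_ ->] := coefsP fE; last exact: grouplikeM.
by rewrite -big_nat_cond.
Qed.

Lemma normk_in_E k f : in_E n f -> normk n k f = (opnorm (coefs n f k))%:E.
Proof. by move=> fE; rewrite /normk asboolT. Qed.

Lemma normE_le f (B : \bar R) : (0 <= B)%E -> (forall k, (1 <= k <= n)%N -> (normk n k f <= B)%E) ->
  (normE n f <= B)%E.
Proof.
by move=> B0 h; apply: bigmaxe_le => // k kn; exact: h.
Qed.

End Membership.

Section Composition.
Variables (R : realType) (V U W : completeNormedModType R).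
Variables (TV : tensor_powers V) (TU : tensor_powers U).
Hypothesis compat : tensor_compatible TV TU.
Variable n : nat.

Lemma tpoly_trunc l (f : tseries TV -> U) x : in_E n f -> grouplike x ->
  tpoly TU n l f x = trunc_power TU n (fun k (x : tseries TV) => coefs n f k (x k)) l x.
Proof.
move=> fE gx; apply: eq_bigr => k /andP[/forallP k0 _].
have cC (i : 'I_l) : clinear (coefs n f (k i)).
  by have [h _] := coefsP fE; apply: h; rewrite k0 -ltnS ltn_ord.
have [F hF _] := compat cC.
rewrite /tensor_map; case: xgetP => [G _ hG|/(_ F)//].
exact: (is_tensor_map_grouplike cC hG gx).
Qed.

Variables (phi : U -> W) (L M Mh : R).
Hypotheses (M_ge0 : 0 <= M) (L_ge0 : 0 <= L).
Hypothesis MMh : forall i, (1 <= i <= n)%N -> M ^+ i <= Mh.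

Lemma composed_formE (h : R -> U) (beta1 : R -> tseries TV -> U) t x :
  in_E n (beta1 t) -> grouplike x ->
  composed_form TU n phi h beta1 t x =
  composed_power TU phi n (fun k (x : tseries TV) => coefs n (beta1 t) k (x k)) (h t) x.
Proof. by move=> bE gx; apply: eq_bigr => l _; rewrite tpoly_trunc. Qed.

Variables (u : U) (F : nat -> tseries TV -> U).
Hypothesis hu : forall l, (l <= n)%N -> linear_bounded L (frechet phi (TU := TU) (l := l) u).
Hypothesis hF : forall k, (1 <= k <= n)%N -> homog k M (F k).

Let term l (k : {ffun 'I_l -> 'I_n.+1}) (x : tseries TV) : W :=
  frechet phi u (ptens TU (fun i => F (k i) x)).

Let term_homog l (k : {ffun 'I_l -> 'I_n.+1}) : (1 <= l <= n)%N ->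
  [forall i, (0 < k i)%N] && (\sum_i k i <= n)%N ->
  homog (\sum_i k i) (n`!%:R * (L * Mh)) (term k).
Proof.
move=> ln /andP[/forallP k0 kn].
have hk i : homog (k i) M (F (k i)) by apply: hF; rewrite k0 -ltnS ltn_ord.
have := homog_prod compat (k := fun i => nat_of_ord (k i)) L_ge0 (hu (l := l) _) hk (fun=> M_ge0).
case/andP: ln => l1 ln; move=> /(_ ln); apply: homog_le.
rewrite prodr_const card_ord; apply: ler_pM => //.
- by rewrite mulr_ge0 // exprn_ge0.
- by rewrite ler_nat leq_fact.
by rewrite ler_wpM2l // MMh // l1.
Qed.

Let composedE x : composed_power TU phi n F u x =
  \sum_(1 <= l < n.+1 | (1 <= l < n.+1)%N && true) (l`!%:R : R)^-1 *:
    \sum_(k : {ffun 'I_l -> 'I_n.+1} | [forall i, (0 < k i)%N] && (\sum_i k i <= n)%N) term k x.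
Proof.
rewrite -big_nat_cond; apply: eq_big_nat => l /andP[_ ln]; congr (_ *: _).
by rewrite /trunc_power (linear_sum' (hu ln).1).
Qed.

Lemma composed_in_E : in_E n (composed_power TU phi n F u).
Proof.
apply: (in_E_ext (fun x _ => esym (composedE x))); apply: in_E_sum => l; rewrite andbT => ln.
apply: in_EZ; apply: in_E_sum => k hk; apply: homog_in_E (term_homog ln hk).
case/andP: hk => /forallP k0 ->; rewrite andbT.
by case/andP: ln => l1 _; rewrite (bigD1 (Ordinal l1)) //=; apply: leq_trans (k0 (Ordinal l1)) _; exact: leq_addr.
Qed.

(** At scale q = 1 graded bounds are plain bounds of the coefficients. The constant counts n orders
    l, at most (n+1)^n multi-indices and at most n! shuffles. *)
Lemma composed_coefs k : (1 <= k <= n)%N ->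
  opnorm (coefs n (composed_power TU phi n F u) k) <= (n * (n.+1 ^ n * n`!))%:R * (L * Mh).
Proof.
move=> kn.
have Mh0 : 0 <= Mh.
  have n0 : (1 <= 1 <= n)%N by case/andP: kn => k1 k2; exact: leq_trans k1 k2.
  by apply: le_trans (MMh n0); rewrite expr1.
set B := leRHS; have B0 : 0 <= B by rewrite !mulr_ge0.
suff h : graded 1 n.+1 B (composed_power TU phi n F u).
  have := coefs_graded ltr01 B0 h composed_in_E (ltnSn n) kn.
  by rewrite expr1n divr1.
apply: (graded_ext (fun x _ => esym (composedE x))).
have hl l : (1 <= l < n.+1)%N && true -> graded 1 n.+1 ((n.+1 ^ n * n`!)%:R * (L * Mh))
   (fun x => (l`!%:R : R)^-1 *:
    \sum_(k : {ffun 'I_l -> 'I_n.+1} | [forall i, (0 < k i)%N] && (\sum_i k i <= n)%N) term k x).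
  rewrite andbT => ln; apply: (graded_scale_le1 ltr01).
  - by rewrite !mulr_ge0.
  - exact: inv_fact_le1.
  have hk (k' : {ffun 'I_l -> 'I_n.+1}) : [forall i, (0 < k' i)%N] && (\sum_i k' i <= n)%N ->
      graded 1 n.+1 (n`!%:R * (L * Mh)) (term k').
    move=> hk'; apply: (homog_graded ltr01 (J := (\sum_i k' i)%N)).
    - by case/andP: hk'; rewrite ltnS.
    - by rewrite !mulr_ge0.
    by rewrite expr1n divr1; exact: term_homog.
  have := graded_sum ltr01 (index_enum {ffun 'I_l -> 'I_n.+1}) hk; apply: (graded_le ltr01).
  apply: (@le_trans _ _ (\sum_(k' : {ffun 'I_l -> 'I_n.+1}) (n`!%:R * (L * Mh)))).
    rewrite big_mkcond; apply: ler_sum => k' _; case: ifP => // _.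
    by rewrite !mulr_ge0.
  rewrite sumr_const card_ffun !card_ord -[leLHS]mulr_natl natrM mulrA.
  apply: ler_wpM2r; first exact: mulr_ge0.
  apply: ler_wpM2r => //; rewrite ler_nat leq_pexp2l //.
  by case/andP: ln.
have := graded_sum ltr01 (index_iota 1 n.+1) hl; apply: (graded_le ltr01).
by rewrite -big_nat_cond big_const_nat iter_addr_0 subSS subn0 -[leLHS]mulr_natl mulrA -natrM.
Qed.

End Composition.

(** * The composed one-form *)

Section Quotients.
Variable R : realType.

Lemma le_mul_of_ediv_le (c b M : R) : 0 <= c -> 0 <= b -> (c%:E / b%:E <= M%:E)%E -> c <= M * b.
Proof.
rewrite le_eqVlt => /orP[/eqP<-|c0] b0.
  rewrite mul0e lee_fin => M0; exact: mulr_ge0.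
(* For b = 0 the quotient of c > 0 is +oo, which no real M bounds. *)
rewrite inver; case: eqP b0 => [->|/eqP bn] b0; first by rewrite mulry gtr0_sg // mul1e leye_eq.
by rewrite -EFinM lee_fin ler_pdivrMr // lt_neqAle eq_sym bn.
Qed.

Lemma ediv_le (c b M : R) : 0 <= c -> 0 <= b -> 0 <= M -> c <= M * b -> (c%:E / b%:E <= M%:E)%E.
Proof.
move=> c0 + M0; rewrite le_eqVlt => /orP[/eqP<-|b0].
  rewrite mulr0 => cle; have -> : c = 0 by apply/eqP; rewrite eq_le cle.
  by rewrite mul0e lee_fin.
by rewrite inver gt_eqF // -EFinM lee_fin ler_pdivrMr.
Qed.

(* The graded estimates need a positive scale [q], so they are proved for all
   q > w(s,t)^(1/p). *)
Lemma powR_right_limit (a C q0 Q rho : R) : 0 <= q0 -> q0 < Q -> 0 < rho -> 0 <= C ->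
  (forall q, q0 < q -> q <= Q -> a <= C * q `^ rho) -> a <= C * q0 `^ rho.
Proof.
move=> q00 q0Q rho0 C0 h; rewrite leNgt; apply/negP => lt.
move: C0 h lt; rewrite le_eqVlt => /orP[/eqP<-|C0] h lt.
  by have := h Q q0Q (lexx _); move: lt; rewrite !mul0r => lt /(lt_le_trans lt); rewrite ltxx.
have ac : q0 `^ rho < a / C by rewrite ltr_pdivlMr // mulrC.
have ac0 : 0 <= a / C by apply: le_trans (ltW ac); exact: powR_ge0.
set r := (a / C) `^ rho^-1.
have rE : r `^ rho = a / C by rewrite /r -powRrM mulVf ?gt_eqF // powRr1.
have r0 : 0 <= r by exact: powR_ge0.
have q0r : q0 < r.
  by rewrite ltNge; apply/negP => rq; move: ac; rewrite -rE ltNge ge0_ler_powR ?nnegrE // ltW.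
pose q := Num.min Q ((q0 + r) / 2).
have qq0 : q0 < q by rewrite lt_min q0Q /=; lra.
have qr : q < r by rewrite gt_min; apply/orP; right; lra.
have := h q qq0; rewrite ge_min lexx => /(_ isT); rewrite leNgt => /negP; apply.
rewrite mulrC -ltr_pdivlMr // -rE gt0_ltr_powR // ?nnegrE //.
by rewrite (le_trans q00) // ltW.
Qed.

End Quotients.

Section Constants.
Variables (R : realType) (n : nat).
Implicit Types theta Q : R.

(** 4 n Q^n is twice the constant of [y_graded] and [z_graded], used when omega_1 > 1; the summand 3
    keeps it above 1, which suffices when omega_1 <= 1. *)
Definition defect_const Q : R := 3 + 4 * n%:R * Q ^+ n.

(** The sewing constant of [form_almost_additive], per unit of M. *)
Definition integral_const theta Q : R := sew_const (n.+1%:R * defect_const Q) theta.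

(** Chosen to dominate at once the constants for the defect of the form, for h_t - h_s against its
    local approximation and for |h_t - h_s|; see [kappa_ge]. *)
Definition path_const theta Q : R := defect_const Q + integral_const theta Q * (Q ^+ n + 1).

Definition composed_const theta Q : R :=
  (n * (n + 6))%:R * local_const n (path_const theta Q) Q.

Lemma composed_const_ge0 theta Q : 1 < theta -> 0 <= Q -> 0 <= composed_const theta Q.
Proof.
move=> theta1 Q0; have Qn : 0 <= Q ^+ n by exact: exprn_ge0.
have d0 : 0 <= defect_const Q by rewrite addr_ge0 // !mulr_ge0.
have k0 : 0 <= path_const theta Q.
  rewrite addr_ge0 // mulr_ge0 ?addr_ge0 //.
  by apply: sew_const_ge0 => //; rewrite mulr_ge0.
by rewrite mulr_ge0 // /local_const !mulr_ge0 ?exprn_ge0.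
Qed.

End Constants.

(** * The integral of a slowly-varying one-form *)

Section SlowForm.
Variables (R : realType) (V U : completeNormedModType R) (TV : tensor_powers V).
Variables (p : R) (n : nat).
Hypotheses (n_gt0 : (0 < n)%N) (n_p : n%:R <= p) (p_ge1 : 1 <= p).
Variables (w w1 : R -> R -> R) (theta theta1 : R).
Hypothesis w_ge0 : forall s t, 0 <= s -> s <= t -> t <= 1 -> 0 <= w s t.
Hypothesis w_diag : forall s, 0 <= s -> s <= 1 -> w s s = 0.
Hypothesis w_add : forall s u t, 0 <= s -> s <= u -> u <= t -> t <= 1 -> w s u + w u t <= w s t.
Hypothesis w_small : forall delta : R, 0 < delta ->
  exists2 d : R, 0 < d & forall a b, 0 <= a -> a <= b -> b <= 1 -> b - a < d -> w a b <= delta.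
Hypothesis w1_ge0 : forall s t, 0 <= s -> s <= t -> t <= 1 -> 0 <= w1 s t.
Hypothesis w1_w : forall s t, 0 <= s -> s <= t -> t <= 1 -> w1 s t <= w s t.
Hypotheses (theta_gt1 : 1 < theta) (theta_le : theta <= theta1) (theta_n : p * theta <= n.+1%:R).
Variable X : R -> tseries TV.
Hypothesis gX : forall t, 0 <= t -> t <= 1 -> grouplike (X t).
Hypothesis X_norm : forall s t k, 0 <= s -> s <= t -> t <= 1 -> `|increment X s t k| <= (w s t `^ p^-1) ^+ k.
Variables (beta : R -> tseries TV -> U) (M : R).
Hypothesis M_ge0 : 0 <= M.
Hypothesis beta_E : one_form n beta.
Hypothesis beta_M : forall t k, 0 <= t -> t <= 1 -> (1 <= k <= n)%N -> opnorm (coefs n (beta t) k) <= M.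

Local Notation defect s t := (fun x => beta t x - shift (beta s) (increment X s t) x).
Hypothesis defect_M : forall s t k, 0 <= s -> s < t -> t <= 1 -> (1 <= k <= n)%N ->
  opnorm (coefs n (defect s t) k) <= M * w1 s t `^ (theta1 - k%:R / p).

Local Notation rho := (p * theta).
Local Notation Q := (w 0 1 `^ p^-1 + 1).
Local Notation comp t := (fun k (x : tseries TV) => coefs n (beta t) k (x k)).
Local Notation base s t := (w s t `^ p^-1).

Let p_gt0 : 0 < p. Proof. exact: lt_le_trans p_ge1. Qed.
Let Q_ge1 : 1 <= Q. Proof. by rewrite lerDr powR_ge0. Qed.
Let rho_ge1 : 1 <= rho.
Proof. by apply: (le_trans p_ge1); rewrite ler_peMr // ltW. Qed.

Lemma base_lt s t : 0 <= s -> s <= t -> t <= 1 -> base s t < Q.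
Proof.
move=> s0 st t1; apply: (@le_lt_trans _ _ (base 0 1)); last by rewrite ltrDl.
have w01 : w s t <= w 0 1 := w_le w_ge0 w_add (lexx 0) s0 st t1 (lexx 1).
have w0 : 0 <= w s t by exact: w_ge0.
by apply: ge0_ler_powR; rewrite ?nnegrE ?invr_ge0 ?(le_trans w0 w01) // ltW.
Qed.

Lemma base_pow s t a : 0 <= s -> s <= t -> t <= 1 -> base s t `^ (p * a) = w s t `^ a.
Proof. by move=> s0 st t1; rewrite -powRrM mulrA mulVf ?gt_eqF // mul1r. Qed.

Lemma comp_homog t k : 0 <= t -> t <= 1 -> (1 <= k <= n)%N -> homog k M (comp t k).
Proof.
move=> t0 t1 kn; apply: coefs_homog => //; last exact: beta_M.
by apply: beta_E.
Qed.

Lemma increment_q s t q : 0 <= s -> s <= t -> t <= 1 -> base s t < q ->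
  forall i, `|increment X s t i| <= q ^+ i.
Proof.
move=> s0 st t1 bq i; apply: le_trans (X_norm i s0 st t1) _.
apply: lerXn2r; rewrite ?nnegrE ?powR_ge0 //; last exact: ltW.
by apply: le_trans (ltW bq); exact: powR_ge0.
Qed.

Lemma defect_graded s t q : 0 <= s -> s < t -> t <= 1 -> base s t < q -> q <= Q ->
  graded q n.+1 (defect_const n Q * M * q `^ rho)
    (fun x => (form_sum n (comp s) (tsmul (increment X s t) x) -
               form_sum n (comp s) (increment X s t)) - form_sum n (comp t) x).
Proof.
move=> s0 st t1 bq qQ; have st' := ltW st; have t0 := le_trans s0 st'; have s1 := le_trans st' t1.
have q0 : 0 < q by apply: le_lt_trans bq; exact: powR_ge0.
have gst := increment_grouplike (gX s0 s1) (gX t0 t1).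
have bs : in_E n (beta s) by exact: beta_E.
have bt : in_E n (beta t) by exact: beta_E.
have w10 := w1_ge0 s0 st' t1; have w1w := w1_w s0 st' t1; have w0 := w_ge0 s0 st' t1.
have dc : 0 <= Q ^+ n by rewrite exprn_ge0 // (le_trans ler01).
have qr0 : 0 <= q `^ rho by exact: powR_ge0.
have n0 : 0 <= n%:R :> R by [].
have incq := increment_q s0 st' t1 bq.
(* For w1 > 1 a smaller exponent does not give a weaker bound, but then q >= 1 and
   the two terms of the difference may be bounded separately. *)
have [w1le|w1gt] := leP (w1 s t) 1; last first.
  have q1 : 1 <= q.
    apply: le_trans (ltW bq); have -> : 1 = 1 `^ p^-1 by rewrite powR1.
    by apply: ge0_ler_powR; rewrite ?nnegrE ?invr_ge0 // ltW // (lt_le_trans w1gt).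
  have qrho : q <= q `^ rho by exact: le1r_powR.
  have k0 : 2 * n%:R * Q ^+ n <= 2 * n%:R * Q ^+ n by [].
  have hs k : (0 < k <= n)%N -> homog k M (comp s k) by exact: comp_homog.
  have ht k : (0 < k <= n)%N -> homog k M (comp t k) by exact: comp_homog.
  have hy := y_graded q0 qQ Q_ge1 M_ge0 k0 hs gst incq.
  have hz := z_graded q0 qQ Q_ge1 M_ge0 k0 ht.
  apply: (graded_le q0 _ (gradedB hy hz)).
  rewrite -!mulrDl; apply: ler_pM => //.
  + by rewrite !mulr_ge0 // addr_ge0 // !mulr_ge0.
  + exact: ltW.
  apply: ler_wpM2r => //; rewrite /defect_const; lra.
apply: (graded_le q0 (K := M * q `^ rho)).
  rewrite -!mulrA -[leLHS]mul1r; apply: ler_wpM2r; first by rewrite mulr_ge0.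
  have : 0 <= n%:R * Q ^+ n by exact: mulr_ge0.
  by rewrite /defect_const -mulrA; lra.
have dE : in_E n (defect s t).
  apply: in_ED => //; apply: in_EN; exact: (shift_in_E q0 bs gst incq).
have [dC hd] := coefsP dE.
exists (fun J (y : TV J) => if (0 < J)%N then - coefs n (defect s t) J y else 0).
  move=> J Jn; case: J Jn => [|J] Jn /=.
    apply: linear_bounded_le (linear_bounded0 _ _).
    by rewrite divr_ge0 ?mulr_ge0 // exprn_ge0 // ltW.
  apply: linear_boundedN.
  apply: linear_bounded_le (clinear_linear_bounded (dC J.+1 Jn)).
  apply: le_trans (defect_M s0 st t1 (Jn : (1 <= J.+1 <= n)%N)) _.
  rewrite -mulrA; apply: ler_wpM2l => //.
  have Jp : J.+1%:R / p <= 1.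
    by rewrite ler_pdivrMr // mul1r (le_trans _ n_p) // ler_nat.
  have a0 : 0 < theta - J.+1%:R / p by rewrite subr_gt0 (le_lt_trans Jp).
  (* The weight is a power of q^p, and w1 <= w <= q^p. *)
  have -> : q `^ rho / q ^+ J.+1 = (q `^ p) `^ (theta - J.+1%:R / p).
    rewrite -powRrM mulrBr [p * (_ / p)]mulrC divfK ?gt_eqF //.
    by rewrite powRB ?powR_mulrn ?ltW // (gt_eqF q0) implybT.
  apply: (@le_trans _ _ (w1 s t `^ (theta - J.+1%:R / p))).
    move: w10; rewrite le_eqVlt => /orP[/eqP<-|w10].
      rewrite !powR0 //; first by rewrite gt_eqF.
      by rewrite gt_eqF // (lt_le_trans a0) // lerB.
    by apply: ger_powR; [rewrite w10|exact: lerB].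
  apply: ge0_ler_powR; rewrite ?nnegrE ?powR_ge0 //; first exact: ltW.
  apply: (le_trans w1w).
  have -> : w s t = base s t `^ p by rewrite -powRrM mulVf ?gt_eqF // powRr1.
  by apply: ge0_ler_powR; rewrite ?nnegrE ?powR_ge0 // ltW.
move=> x gx; rewrite !form_sum_coefs //; last exact: grouplikeM.
have := hd x gx; rewrite /shift => h.
rewrite [RHS]big_ord_recl add0r /= sumrN.
have -> : \sum_(i < n) coefs n (defect s t) (bump 0 i) (x (bump 0 i)) =
    \sum_(1 <= k < n.+1) coefs n (defect s t) k (x k) by rewrite big_add1 big_mkord.
by rewrite -h opprB.
Qed.

Local Notation mu := (fun s t => beta s (increment X s t)).
Local Notation dcn := (defect_const n Q).

Let Qn_ge0 : 0 <= Q ^+ n. Proof. by rewrite exprn_ge0 // (le_trans ler01). Qed.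
Let dc_ge0 : 0 <= dcn. Proof. by rewrite /defect_const addr_ge0 // !mulr_ge0. Qed.

Lemma beta_one t : 0 <= t -> t <= 1 -> beta t (tsone TV) = 0.
Proof.
move=> t0 t1; have [cC ->] := coefsP (beta_E t0 t1); last exact: grouplike1.
rewrite big1_seq // => k; rewrite mem_index_iota => /andP[_ kn].
by case: k kn => // k kn; exact: (linear0' (cC k.+1 kn).1).
Qed.

(** As X_{s,u} X_{u,t} = X_{s,t}, this is the defect between s and u, evaluated at X_{u,t}: in
    degree J the weight q^-J is cancelled by |X_{u,t}^J| <= q^J, and there are n + 1 degrees. *)
Lemma form_almost_additive s u t : 0 <= s -> s <= u -> u <= t -> t <= 1 ->
  `|mu s t - mu s u - mu u t| <= n.+1%:R * dcn * M * w s t `^ theta.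
Proof.
move=> s0 su ut t1; have st := le_trans su ut; have u0 := le_trans s0 su; have u1 := le_trans ut t1.
have C0 : 0 <= n.+1%:R * dcn * M by rewrite !mulr_ge0.
have s1 := le_trans su u1; have t0 := le_trans s0 st.
have [<-|sn] := eqVneq s u.
  by rewrite /= (increment_id (gX s0 s1)) beta_one // subr0 subrr normr0 mulr_ge0 // powR_ge0.
have su' : s < u by rewrite lt_neqAle sn.
rewrite -(base_pow theta s0 st t1).
apply: (@powR_right_limit _ _ _ _ Q) => //; first exact: powR_ge0.
- exact: base_lt.
- exact: lt_le_trans rho_ge1.
move=> q bq qQ.
have q0 : 0 < q by apply: le_lt_trans bq; exact: powR_ge0.
have mono a b : s <= a -> a <= b -> b <= t -> base a b < q.
  move=> sa ab bt; apply: le_lt_trans bq.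
  have w0 : 0 <= w a b by apply: w_ge0 => //; [exact: le_trans sa|exact: le_trans t1].
  have ww : w a b <= w s t by exact: (w_le w_ge0 w_add).
  by apply: ge0_ler_powR; rewrite ?nnegrE ?invr_ge0 ?(le_trans w0 ww) // ltW.
have [c cK hc] := defect_graded s0 su' u1 (mono s u (lexx _) su ut) qQ.
have gsu := increment_grouplike (gX s0 s1) (gX u0 u1).
have gut := increment_grouplike (gX u0 u1) (gX t0 t1).
have := hc _ gut; rewrite /= (increment_mul s t (gX u0 u1)).
have gst := increment_grouplike (gX s0 s1) (gX t0 t1).
rewrite !form_sum_coefs //; [|exact: beta_E..].
move=> ->; apply: le_trans (ler_norm_sum _ _ _) _.
have -> : n.+1%:R * dcn * M * q `^ rho = \sum_(J < n.+1) (dcn * M * q `^ rho).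
  by rewrite sumr_const card_ord -[RHS]mulr_natl !mulrA.
apply: ler_sum => J _; have [_ cJ] := cK J (ltn_ord J).
apply: le_trans (cJ _) _.
rewrite mulrAC ler_pdivrMr ?exprn_gt0 // ler_wpM2l ?mulr_ge0 ?powR_ge0 //.
exact: (increment_q u0 ut t1 (mono u t su ut (lexx _))).
Qed.

Local Notation ic := (integral_const n theta Q).

Let sew_scale : sew_const (n.+1%:R * dcn * M) theta = M * ic.
Proof. by rewrite /integral_const /sew_const !mulrA; congr (_ / _); ring. Qed.

Local Notation h := (rough_integral X beta).

Lemma rough_integralE t : h t = sewn mu t.
Proof.
rewrite /rough_integral (_ : riemann_sum X beta t = rsum mu 0) //.
by apply/funext => D; exact: riemann_sum_rsum.
Qed.

Lemma rough_integral0 : h 0 = 0.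
Proof.
rewrite rough_integralE.
have C0 : 0 <= n.+1%:R * dcn * M by rewrite !mulr_ge0.
exact: (sewn0 w_ge0 w_diag w_add theta_gt1 w_small C0 form_almost_additive).
Qed.

Lemma rough_integral_bound s t : 0 <= s -> s <= t -> t <= 1 ->
  `|h t - h s - mu s t| <= M * ic * w s t `^ theta.
Proof.
move=> s0 st t1; rewrite !rough_integralE -sew_scale.
apply: (sewn_bound w_ge0 w_diag w_add theta_gt1 w_small _ form_almost_additive) => //.
by rewrite !mulr_ge0.
Qed.

Let ic_ge0 : 0 <= ic.
Proof. by rewrite /integral_const; apply: sew_const_ge0 => //; rewrite mulr_ge0. Qed.

Local Notation kappa := (path_const n theta Q).

Lemma kappa_ge : (1 <= kappa) /\ (dcn <= kappa) /\ (2 * n%:R * Q ^+ n <= kappa) /\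
  (ic <= kappa) /\ (ic * Q ^+ n + 2 * n%:R * Q ^+ n <= kappa).
Proof.
rewrite /path_const /defect_const; have := ic_ge0; have := Qn_ge0.
move: ic (Q ^+ n) => I A A0 I0.
have h1 : 0 <= n%:R * A by exact: mulr_ge0.
have h2 : 0 <= I * A by exact: mulr_ge0.
rewrite mulrDr mulr1 -!mulrA.
split; first by lra.
split; first by lra.
split; first by lra.
by split; lra.
Qed.

Lemma pow_rho_le q : 0 < q -> q <= Q -> q `^ rho <= q * Q ^+ n.
Proof.
move=> q0 qQ; have Q0 : 0 <= Q by exact: le_trans ler01 Q_ge1.
rewrite -mulr_powRB1 ?(lt_le_trans ltr01) //; last exact: ltW.
apply: ler_wpM2l; first exact: ltW.
apply: (@le_trans _ _ (Q `^ (rho - 1))).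
  by apply: ge0_ler_powR; rewrite ?nnegrE ?subr_ge0 // ltW.
rewrite -powR_mulrn //; apply: ler_powR => //.
by rewrite lerBlDr natr1.
Qed.

Section OnePair.
Variables (s t q : R).
Hypotheses (s0 : 0 <= s) (st : s < t) (t1 : t <= 1) (bq : base s t < q) (qQ : q <= Q).

Let q_gt0 : 0 < q. Proof. by apply: le_lt_trans bq; exact: powR_ge0. Qed.
Let st' := ltW st.
Let t0 := le_trans s0 st'.
Let s1 := le_trans st' t1.
Let gst := increment_grouplike (gX s0 s1) (gX t0 t1).
Let incq := increment_q s0 st' t1 bq.
Let hs k : (0 < k <= n)%N -> homog k M (comp s k). Proof. exact: comp_homog. Qed.
Let ht k : (0 < k <= n)%N -> homog k M (comp t k). Proof. exact: comp_homog. Qed.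

Let muE : form_sum n (comp s) (increment X s t) = mu s t.
Proof. by rewrite form_sum_coefs //; exact: beta_E. Qed.

Let w_q : w s t `^ theta <= q `^ rho.
Proof.
rewrite -(base_pow theta s0 st' t1); apply: ge0_ler_powR; rewrite ?nnegrE ?powR_ge0 //; last exact: ltW.
  exact: le_trans rho_ge1.
exact: ltW.
Qed.

Lemma integral_form : `|(h t - h s) - form_sum n (comp s) (increment X s t)| <= kappa * M * q `^ rho.
Proof.
rewrite muE; apply: le_trans (rough_integral_bound s0 st' t1) _.
apply: ler_pM; rewrite ?powR_ge0 //; first exact: mulr_ge0 M_ge0 ic_ge0.
by rewrite [leLHS]mulrC ler_wpM2r //; case: kappa_ge => _ [_ [_ []]].
Qed.

Lemma integral_lipschitz : `|h t - h s| <= kappa * M * q.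
Proof.
have e0 : `|mu s t| <= 2 * n%:R * Q ^+ n * M * q.
  rewrite -muE; exact: (form_at_increment_le q_gt0 qQ Q_ge1 M_ge0 (lexx _) hs gst incq).
rewrite -(subrK (mu s t) (h t - h s)); apply: le_trans (ler_normD _ _) _.
apply: (@le_trans _ _ ((ic * Q ^+ n + 2 * n%:R * Q ^+ n) * M * q)); last first.
  apply: ler_wpM2r; first exact: ltW.
  by apply: ler_wpM2r => //; case: kappa_ge => _ [_ [_ []]].
rewrite [leRHS](_ : _ = M * ic * (q * Q ^+ n) + 2 * n%:R * Q ^+ n * M * q); last by ring.
apply: lerD => //; apply: le_trans (rough_integral_bound s0 st' t1) _.
apply: ler_wpM2l; first exact: mulr_ge0.
exact: le_trans (pow_rho_le q_gt0 qQ).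
Qed.

Lemma form_defect : graded q n.+1 (kappa * M * q `^ rho)
    (fun x => (form_sum n (comp s) (tsmul (increment X s t) x) -
               form_sum n (comp s) (increment X s t)) - form_sum n (comp t) x).
Proof.
apply: (graded_le q_gt0 _ (defect_graded s0 st t1 bq qQ)).
by apply: ler_wpM2r; rewrite ?powR_ge0 // ler_wpM2r //; case: kappa_ge => _ [].
Qed.

End OnePair.

Lemma integral_bounded t : 0 <= t -> t <= 1 -> `|h t| <= kappa * M * Q.
Proof.
rewrite le_eqVlt => /orP[/eqP<-|t0] t1.
  rewrite rough_integral0 normr0 !mulr_ge0 // ?(le_trans ler01) //; by case: kappa_ge.
have := integral_lipschitz (lexx 0) t0 t1 (base_lt (lexx 0) (ltW t0) t1) (lexx _).
by rewrite rough_integral0 subr0.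
Qed.

(** * Composition of the integral with [phi] *)

Section Composition.
Variables (W : completeNormedModType R) (TU : tensor_powers U).
Hypothesis compat : tensor_compatible TV TU.
Variables (phi : U -> W) (N : nat).
Hypothesis phiN : frechet_differentiable TU phi N.
Hypothesis nN : (n <= N)%N.
Variables (r L Mh eta : R).
Hypothesis h_r : forall t, 0 <= t -> t <= 1 -> `|h t| <= r.
Hypothesis L_ge0 : 0 <= L.
Hypothesis MMh : forall i, (1 <= i <= n)%N -> M ^+ i <= Mh.
Hypotheses (eta_gt0 : 0 < eta) (eta_le1 : eta <= 1) (rho_eta : rho <= n%:R + eta).
Hypothesis M_eta : M ^+ n * M `^ eta <= Mh.
Hypothesis phi_L : forall u l, `|u| <= r -> (l <= n)%N ->
  linear_bounded L (frechet phi (TU := TU) (l := l) u).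
Hypothesis phi_holder : forall u v (x : TU n), `|u| <= r -> `|v| <= r ->
  `|frechet phi u x - frechet phi v x| <= L * `|u - v| `^ eta * `|x|.

Local Notation form t := (composed_power TU phi n (comp t) (h t)).
Local Notation lc := (local_const n kappa Q).

Let kappa_ge0 : 0 <= kappa. Proof. by case: kappa_ge => h1 _; apply: le_trans h1. Qed.
Let Mh_ge0 : 0 <= Mh.
Proof. by apply: le_trans M_eta; rewrite mulr_ge0 ?exprn_ge0 ?powR_ge0. Qed.

Section Local.
Variables (s t q : R).
Hypotheses (s0 : 0 <= s) (st : s < t) (t1 : t <= 1) (bq : base s t < q) (qQ : q <= Q).

Let q_gt0 : 0 < q. Proof. by apply: le_lt_trans bq; exact: powR_ge0. Qed.
Let st' := ltW st.
Let t0 := le_trans s0 st'.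
Let s1 := le_trans st' t1.
Let gst := increment_grouplike (gX s0 s1) (gX t0 t1).
Let incq := increment_q s0 st' t1 bq.
Let hs k : (0 < k <= n)%N -> homog k M (comp s k). Proof. exact: comp_homog. Qed.
Let ht k : (0 < k <= n)%N -> homog k M (comp t k). Proof. exact: comp_homog. Qed.
Let H := L * `|h t - h s| `^ eta.
Let H_ge0 : 0 <= H. Proof. by rewrite mulr_ge0 // powR_ge0. Qed.

Let holder a (x : TU n) : 0 <= a <= 1 ->
  `|frechet phi (h s + a *: (h t - h s)) x - frechet phi (h s) x| <= H * `|x|.
Proof.
move=> /andP[a0 a1].
have ball : `|h s + a *: (h t - h s)| <= r.
  have -> : h s + a *: (h t - h s) = (1 - a) *: h s + a *: h t.
    by rewrite scalerBr scalerBl scale1r addrA addrAC.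
  apply: le_trans (ler_normD _ _) _; rewrite !normrZ !ger0_norm // ?subr_ge0 //.
  have -> : r = (1 - a) * r + a * r by ring.
  by apply: lerD; apply: ler_wpM2l; rewrite ?subr_ge0 //; exact: h_r.
apply: le_trans (phi_holder x ball (h_r s0 s1)) _.
apply: ler_wpM2r => //; apply: ler_wpM2l => //.
rewrite addrC addKr normrZ ger0_norm //; apply: ge0_ler_powR; rewrite ?nnegrE ?mulr_ge0 //.
  exact: ltW.
by rewrite ler_piMl.
Qed.

(** The remainder is of order M^(n+eta) q^(n+eta): [rho_eta] turns the power of q into q^rho and
    [M_eta] bounds the power of M. *)
Let holder_small : H * (kappa * M * q) ^+ n <= L * kappa ^+ n.+1 * Q ^+ n.+1 * Mh * q `^ rho.
Proof.
have q0 := ltW q_gt0; have Q0 : 0 <= Q by exact: le_trans ler01 Q_ge1.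
apply: (@le_trans _ _ (L * (kappa * M * q) `^ eta * (kappa * M * q) ^+ n)).
  apply: ler_wpM2r; first by rewrite exprn_ge0 // !mulr_ge0.
  apply: ler_wpM2l => //; apply: ge0_ler_powR; rewrite ?nnegrE ?mulr_ge0 //; first exact: ltW.
  exact: integral_lipschitz.
have -> : L * (kappa * M * q) `^ eta * (kappa * M * q) ^+ n =
   L * (kappa `^ eta * kappa ^+ n) * (M ^+ n * M `^ eta) * (q ^+ n * q `^ eta).
  by rewrite !powRM ?mulr_ge0 // !exprMn; ring.
have -> : L * kappa ^+ n.+1 * Q ^+ n.+1 * Mh * q `^ rho =
   L * kappa ^+ n.+1 * Mh * (Q ^+ n.+1 * q `^ rho) by ring.
have kn0 : 0 <= kappa ^+ n by exact: exprn_ge0.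
apply: ler_pM; rewrite ?mulr_ge0 ?exprn_ge0 ?powR_ge0 //.
  apply: ler_pM; rewrite ?mulr_ge0 ?exprn_ge0 ?powR_ge0 //.
  apply: ler_wpM2l => //; rewrite exprS; apply: ler_wpM2r => //.
  by apply: ler1_powR => //; case: kappa_ge.
have -> : q ^+ n * q `^ eta = q `^ (n%:R + eta - rho) * q `^ rho.
  rewrite -powRD ?subrK ?(gt_eqF q_gt0) ?implybT // powRD ?(gt_eqF q_gt0) ?implybT //.
  by rewrite powR_mulrn.
apply: ler_wpM2r; first exact: powR_ge0.
apply: (@le_trans _ _ (Q `^ (n%:R + eta - rho))).
  by apply: ge0_ler_powR; rewrite ?nnegrE ?subr_ge0.
rewrite -powR_mulrn //; apply: ler_powR => //.
have r0 : 0 <= rho by exact: le_trans rho_ge1.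
rewrite -natr1 -addrA lerD2l; apply: le_trans eta_le1; rewrite gerBl; exact: le_trans rho_ge1.
Qed.

Let hu l : (l <= n)%N -> linear_bounded L (frechet phi (TU := TU) (l := l) (h s)).
Proof. by apply: phi_L; exact: h_r. Qed.
Let hv l : (l <= n)%N -> linear_bounded L (frechet phi (TU := TU) (l := l) (h t)).
Proof. by apply: phi_L; exact: h_r. Qed.

Let rho_ge0 : 0 <= rho. Proof. exact: le_trans rho_ge1. Qed.

Lemma pair_graded : graded q (n * n).+1 ((n * (n + 6))%:R * (lc * (L * Mh * q `^ rho)))
  (fun x => form t x - (form s (tsmul (increment X s t) x) - form s (increment X s t))).
Proof.
have [k1 [k2 [k3 _]]] := kappa_ge.
exact: (local_graded compat phiN nN q_gt0 qQ Q_ge1 M_ge0 L_ge0 H_ge0 MMh rho_ge0 theta_n k1 k3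
  hu hv holder holder_small (integral_lipschitz s0 st t1 bq qQ) hs ht gst incq
  (integral_form s0 st t1 bq) (form_defect s0 st t1 bq qQ) n_gt0).
Qed.

Lemma pair_scalar : `|phi (h t) - phi (h s) - form s (increment X s t)| <=
  (2 * n).+1%:R * (lc * (L * Mh * q `^ rho)).
Proof.
have [k1 [k2 [k3 _]]] := kappa_ge.
exact: (local_scalar compat phiN nN q_gt0 qQ Q_ge1 M_ge0 L_ge0 H_ge0 MMh rho_ge0 theta_n k1 k3
  hu holder holder_small (integral_lipschitz s0 st t1 bq qQ) hs gst incq
  (integral_form s0 st t1 bq) n_gt0).
Qed.

End Local.

Local Notation cc := (composed_const n theta Q).
Local Notation cform := (composed_form TU n phi h beta).

Let lc_ge0 : 0 <= lc.
Proof. by rewrite /local_const !mulr_ge0 ?exprn_ge0 // (le_trans ler01). Qed.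

Lemma composed_form_at t x : 0 <= t -> t <= 1 -> grouplike x -> cform t x = form t x.
Proof. by move=> t0 t1 gx; rewrite composed_formE //; exact: beta_E. Qed.

Lemma composed_form_in_E t : 0 <= t -> t <= 1 -> in_E n (cform t).
Proof.
move=> t0 t1; apply: (in_E_ext (f := form t)); first by move=> x gx; rewrite composed_form_at.
apply: (composed_in_E compat M_ge0 L_ge0 MMh); last by move=> k; exact: comp_homog.
by move=> l; apply: phi_L; exact: h_r.
Qed.

Lemma composed_form_coefs t k : 0 <= t -> t <= 1 -> (1 <= k <= n)%N ->
  opnorm (coefs n (cform t) k) <= (n * (n.+1 ^ n * n`!))%:R * (L * Mh).
Proof.
move=> t0 t1 kn.
have hl l : (l <= n)%N -> linear_bounded L (frechet phi (TU := TU) (l := l) (h t)).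
  by apply: phi_L; exact: h_r.
have hk j : (0 < j <= n)%N -> homog j M (comp t j) by exact: comp_homog.
have := composed_coefs compat M_ge0 L_ge0 MMh hl hk kn; congr (opnorm _ <= _).
have fE := composed_in_E compat M_ge0 L_ge0 MMh hl hk.
apply/funext => y; apply: (coefs_unique _ kn).
have [cC hc] := coefsP (composed_form_in_E t0 t1); split => // x gx.
by rewrite -composed_form_at // hc.
Qed.

Local Notation cdefect s t := (fun x => cform t x - shift (cform s) (increment X s t) x).

Lemma composed_defect_in_E s t : 0 <= s -> s < t -> t <= 1 -> in_E n (cdefect s t).
Proof.
move=> s0 st t1; have st' := ltW st; have t0 := le_trans s0 st'; have s1 := le_trans st' t1.
apply: in_ED; first exact: composed_form_in_E.
apply: in_EN; apply: (@shift_in_E _ _ _ _ _ Q); first exact: lt_le_trans ltr01 Q_ge1.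
- exact: composed_form_in_E.
- exact: increment_grouplike (gX s0 s1) (gX t0 t1).
by apply: increment_q => //; exact: base_lt.
Qed.

(** In degree k the bound at scale q is a multiple of q^(rho - k) with rho - k > 0, so q may
    decrease to omega(s,t)^(1/p) even when this is 0. *)
Lemma composed_defect_coefs s t k : 0 <= s -> s < t -> t <= 1 -> (1 <= k <= n)%N ->
  opnorm (coefs n (cdefect s t) k) <= cc * (L * Mh) * w s t `^ (theta - k%:R / p).
Proof.
move=> s0 st t1 kn; have st' := ltW st; have t0 := le_trans s0 st'; have s1 := le_trans st' t1.
have gst := increment_grouplike (gX s0 s1) (gX t0 t1).
rewrite -(base_pow _ s0 st' t1) mulrBr [p * (_ / p)]mulrC divfK ?gt_eqF //.
have kp : k%:R < rho.
  apply: (@le_lt_trans _ _ p); last by rewrite ltr_pMr.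
  by apply: le_trans n_p; rewrite ler_nat; case/andP: kn.
have C0 : 0 <= cc * (L * Mh).
  by apply: mulr_ge0; [exact: mulr_ge0|exact: mulr_ge0].
apply: (@powR_right_limit _ _ _ _ Q) => //.
- exact: powR_ge0.
- exact: base_lt.
- by rewrite subr_gt0.
move=> q bq qQ; have q0 : 0 < q by apply: le_lt_trans bq; exact: powR_ge0.
have K0 : 0 <= (n * (n + 6))%:R * (lc * (L * Mh * q `^ rho)).
  by rewrite mulr_ge0 // mulr_ge0 // mulr_ge0 ?powR_ge0 // mulr_ge0.
have h1 : graded q (n * n).+1 ((n * (n + 6))%:R * (lc * (L * Mh * q `^ rho))) (cdefect s t).
  apply: graded_ext (pair_graded s0 st t1 bq qQ) => x gx.
  by rewrite /shift !composed_form_at //; exact: grouplikeM.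
have nn : (n < (n * n).+1)%N by rewrite ltnS leq_pmulr.
apply: le_trans (coefs_graded q0 K0 h1 (composed_defect_in_E s0 st t1) nn kn) _.
rewrite le_eqVlt; apply/orP; left; apply/eqP.
rewrite powRB ?(gt_eqF q0) ?implybT // powR_mulrn ?ltW // /composed_const.
by rewrite !mulrA.
Qed.

Lemma composed_form_increment s t : 0 <= s -> s < t -> t <= 1 ->
  `|phi (h t) - phi (h s) - cform s (increment X s t)| <=
  (2 * n).+1%:R * lc * (L * Mh) * w s t `^ theta.
Proof.
move=> s0 st t1; have st' := ltW st; have t0 := le_trans s0 st'; have s1 := le_trans st' t1.
have gst := increment_grouplike (gX s0 s1) (gX t0 t1).
rewrite -(base_pow _ s0 st' t1) composed_form_at //.
apply: (@powR_right_limit _ _ _ _ Q) => //.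
- exact: powR_ge0.
- exact: base_lt.
- exact: lt_le_trans rho_ge1.
- by apply: mulr_ge0; [exact: mulr_ge0|exact: mulr_ge0].
move=> q bq qQ; apply: le_trans (pair_scalar s0 st t1 bq qQ) _.
by rewrite !mulrA.
Qed.

Lemma composed_form_cvg t : 0 <= t -> t <= 1 ->
  riemann_sum X cform t @ mesh_to0 t --> phi (h t) - phi (h 0).
Proof.
move=> t0 t1.
have -> : riemann_sum X cform t = rsum (fun a b => cform a (increment X a b)) 0.
  by apply/funext => D; exact: riemann_sum_rsum.
have C0 : 0 <= (2 * n).+1%:R * lc * (L * Mh).
  by apply: mulr_ge0; [exact: mulr_ge0|exact: mulr_ge0].
exact: (increment_cvg w_ge0 w_diag w_add theta_gt1 w_small (I := fun t => phi (h t)) C0 t0 t1 composed_form_increment).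
Qed.

End Composition.

End SlowForm.

Lemma floor_lt_itv (R : realType) (g : R) : 0 < g -> (floor_lt g)%:R < g <= (floor_lt g).+1%:R.
Proof.
move=> g0; have cg : 0 < Num.ceil g by rewrite ceil_gt0.
have := ceil_itv g; rewrite /floor_lt; case: (Num.ceil g) cg => [[|m]|m] //= _.
by have -> : Posz m.+1 - 1 = m by rewrite -addn1 PoszD addrK.
Qed.

(** * Functions of class C^gamma *)

Section HolderClass.
Variables (R : realType) (U W : completeNormedModType R) (TU : tensor_powers U).
Variables (gamma : R) (phi : U -> W) (r : R).
Hypotheses (gamma_gt0 : 0 < gamma) (phiC : Cclass TU gamma phi) (r_ge0 : 0 <= r).
Local Notation N := (floor_lt gamma).
Local Notation L := (fine (Cnorm TU gamma phi r)).
Let quot (u v : U) : \bar R :=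
  ((opnorm (fun w => frechet phi (TU := TU) (l := N) u w - frechet phi (TU := TU) (l := N) v w))%R%:E
     / (`|u - v| `^ (gamma - N%:R))%R%:E)%E.

Let quot_ge0 (u v : U) : (0 <= quot u v)%E.
Proof. by rewrite mule_ge0 ?inve_ge0 ?lee_fin ?opnorm_ge0 ?powR_ge0. Qed.

Let pairs : set (U * U) := [set uv : U * U | `|uv.1| <= r /\ `|uv.2| <= r].

Let sup_quot_ge0 : (0 <= ereal_sup [set quot uv.1 uv.2 | uv in pairs])%E.
Proof.
apply: le_trans (quot_ge0 0 0) (ereal_sup_ubound _).
by exists (0, 0); split; rewrite /= normr0.
Qed.

Lemma Cnorm_ge0 : (0 <= Cnorm TU gamma phi r)%E.
Proof. by rewrite /Cnorm adde_ge0 ?bigmaxe_ge0. Qed.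

(** [Cclass] asserts finiteness for positive radii only, while the radius sup |h| may be 0;
    monotonicity in the radius reduces to r + 1. *)
Lemma Cnorm_fin : (L%:E = Cnorm TU gamma phi r)%E.
Proof.
apply: fineK; rewrite fin_numElt (lt_le_trans _ Cnorm_ge0) ?ltNyr //=.
have r1 : r <= r + 1 by rewrite lerDl.
have r10 : 0 < r + 1 by rewrite ltr_wpDl.
apply: le_lt_trans (phiC.2 _ r10); rewrite /Cnorm; apply: leeD.
  apply: bigmaxe_le => [|k kN]; first exact: bigmaxe_ge0.
  apply: le_trans (le_bigmaxe_nat _ kN).
  by apply: ereal_sup_le => _ [u /= ur <-]; exists u => //=; exact: le_trans ur r1.
apply: ereal_sup_le => _ [[u v] /= [ur vr] <-]; exists (u, v) => //.
by split; [exact: le_trans ur r1|exact: le_trans vr r1].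
Qed.

Let L_ge0 : 0 <= L. Proof. by rewrite -lee_fin Cnorm_fin Cnorm_ge0. Qed.

Lemma Cnorm_bounded u l : `|u| <= r -> (l <= N)%N ->
  linear_bounded L (frechet phi (TU := TU) (l := l) u).
Proof.
move=> ur lN; apply: linear_bounded_le (clinear_linear_bounded (frechet_clinear phiC.1 u lN)).
rewrite -lee_fin Cnorm_fin /Cnorm; apply: le_trans (leeDl _ sup_quot_ge0).
apply: le_trans (le_bigmaxe_nat _ (_ : (0 <= l < N.+1)%N)); last by [].
by apply: ereal_sup_ubound; exists u.
Qed.

Lemma Cnorm_holder u v x : `|u| <= r -> `|v| <= r ->
  `|frechet phi (TU := TU) (l := N) u x - frechet phi (TU := TU) (l := N) v x| <=
  L * `|u - v| `^ (gamma - N%:R) * `|x|.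
Proof.
move=> ur vr.
have uC := frechet_clinear phiC.1 u (leqnn N); have vC := frechet_clinear phiC.1 v (leqnn N).
have [_ h] := clinear_linear_bounded (clinearB uC vC).
apply: le_trans (h x) _; apply: ler_wpM2r => //.
apply: le_mul_of_ediv_le; rewrite ?opnorm_ge0 ?powR_ge0 // Cnorm_fin /Cnorm.
apply: le_trans (leeDr _ (bigmaxe_ge0 _ _ _)); apply: ereal_sup_ubound.
by exists (u, v).
Qed.

(** If n is the top order, eta = gamma - n. Otherwise D^n phi is differentiable with bounded
    derivative on the ball, which is convex, hence Lipschitz there and eta = 1. *)
Lemma Cnorm_holder_le (n : nat) : (n <= N)%N -> exists2 eta : R,
  [/\ 0 < eta, eta <= 1 & Num.min gamma n.+1%:R <= n%:R + eta] &
  forall u v (x : TU n), `|u| <= r -> `|v| <= r ->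
    `|frechet phi u x - frechet phi v x| <= L * `|u - v| `^ eta * `|x|.
Proof.
have /andP[N1 N2] := floor_lt_itv gamma_gt0.
rewrite leq_eqVlt => /orP[/eqP->|nN].
  exists (gamma - N%:R); last exact: Cnorm_holder.
  split; first by rewrite subr_gt0.
    by rewrite lerBlDl natr1.
  by rewrite addrC subrK ge_min lexx.
exists 1; first by split => //; rewrite natr1 ge_min lexx orbT.
move=> u v x ur vr; rewrite powRr1 //.
rewrite -{1}[u](subrK v) [u - v + v]addrC.
apply: (frechet_lipschitz phiC.1 x nN _ L_ge0) => t w /andP[t0 t1].
suff ball : `|v + t *: (u - v)| <= r by have [_] := Cnorm_bounded ball nN; exact.
have -> : v + t *: (u - v) = (1 - t) *: v + t *: u.
  by rewrite scalerBr scalerBl scale1r addrA addrAC.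
apply: le_trans (ler_normD _ _) _; rewrite !normrZ !ger0_norm // ?subr_ge0 //.
have -> : r = (1 - t) * r + t * r by ring.
by apply: lerD; apply: ler_wpM2l; rewrite ?subr_ge0.
Qed.

End HolderClass.

Section SlowNorm.
Variables (R : realType) (V U : completeNormedModType R) (TV : tensor_powers V).
Variables (p : R) (X : R -> tseries TV) (w : R -> R -> R) (theta : R).
Variable beta : R -> tseries TV -> U.
Local Notation n := (Num.truncn p).
Local Notation defect s t := (fun x => beta t x - shift (beta s) (increment X s t) x).
Hypothesis beta_E : one_form n beta.
Hypothesis defect_E : forall s t, 0 <= s -> s < t -> t <= 1 -> in_E n (defect s t).

Let unit_itv : set R := [set t : R | 0 <= t <= 1].

Let sup_normE_ge0 : (0 <= ereal_sup [set normE n (beta t) | t in unit_itv])%E.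
Proof.
apply: (@le_trans _ _ (normE n (beta 0))); first exact: bigmaxe_ge0.
by apply: ereal_sup_ubound; exists 0 => //; rewrite /unit_itv /= lexx ler01.
Qed.

Lemma slow_norm_ge0 : (0 <= slow_norm p X w theta beta)%E.
Proof. by rewrite /slow_norm adde_ge0 ?bigmaxe_ge0. Qed.

Lemma slow_norm_le (A B : R) : 0 <= A -> 0 <= B ->
  (forall t k, 0 <= t -> t <= 1 -> (1 <= k <= n)%N -> opnorm (coefs n (beta t) k) <= A) ->
  (forall s t k, 0 <= s -> s < t -> t <= 1 -> (1 <= k <= n)%N ->
     opnorm (coefs n (defect s t) k) <= B * w s t `^ (theta - k%:R / p)) ->
  (slow_norm p X w theta beta <= (A + B)%:E)%E.
Proof.
move=> A0 B0 hA hB; rewrite EFinD /slow_norm; apply: leeD.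
  apply: ge_ereal_sup => _ [t /andP[t0 t1] <-]; apply: normE_le => // k kn.
  by rewrite normk_in_E ?lee_fin ?hA //; exact: beta_E.
apply: bigmaxe_le => // k kn; apply: ge_ereal_sup => _ [[s t] /= [s0 st t1] <-].
rewrite normk_in_E; last exact: defect_E.
by apply: ediv_le; rewrite ?opnorm_ge0 ?powR_ge0 // hB.
Qed.

Hypothesis slow_fin : (slow_norm p X w theta beta < +oo)%E.
Local Notation M := (fine (slow_norm p X w theta beta)).

Lemma slow_norm_fin : (M%:E = slow_norm p X w theta beta)%E.
Proof. by apply: fineK; rewrite fin_numElt (lt_le_trans _ slow_norm_ge0) ?ltNyr. Qed.

Lemma slow_norm_coefs t k : 0 <= t -> t <= 1 -> (1 <= k <= n)%N -> opnorm (coefs n (beta t) k) <= M.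
Proof.
move=> t0 t1 kn; rewrite -lee_fin slow_norm_fin -normk_in_E; last exact: beta_E.
apply: le_trans (leeDl _ (bigmaxe_ge0 _ _ _)).
apply: (@le_trans _ _ (normE n (beta t))); first exact: (le_bigmaxe_nat (normk n ^~ (beta t))).
by apply: ereal_sup_ubound; exists t => //=; rewrite t0.
Qed.

Lemma slow_norm_defect s t k : 0 <= s -> s < t -> t <= 1 -> (1 <= k <= n)%N ->
  opnorm (coefs n (defect s t) k) <= M * w s t `^ (theta - k%:R / p).
Proof.
move=> s0 st t1 kn; apply: le_mul_of_ediv_le; rewrite ?opnorm_ge0 ?powR_ge0 // slow_norm_fin.
rewrite -normk_in_E; last exact: defect_E.
apply: le_trans (leeDr _ sup_normE_ge0).
apply: le_trans (le_bigmaxe_nat _ (kn : (1 <= k < n.+1)%N)).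
by apply: ereal_sup_ubound; exists (s, t).
Qed.

End SlowNorm.

Section Suprema.
Variable R : realType.

Lemma le_sup_path (U : normedModType R) (h : R -> U) (B : R) :
  (forall t, 0 <= t -> t <= 1 -> `|h t| <= B) ->
  forall t, 0 <= t -> t <= 1 -> `|h t| <= sup [set `|h t| | t in [set t : R | 0 <= t <= 1]].
Proof.
move=> hB t t0 t1; apply: ub_le_sup; last by exists t => //=; rewrite t0.
by exists B => _ [s /= /andP[s0 s1] <-]; exact: hB.
Qed.

Lemma le_max_pow (M : R) n i : 0 <= M -> (1 <= i <= n)%N -> M ^+ i <= Num.max M (M ^+ n.+1).
Proof.
move=> M0 /andP[i1 ni]; rewrite le_max; have [M1|M1] := leP M 1.
  by rewrite -[leRHS]expr1 ler_wiXn2l.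
by apply/orP; right; apply: ler_weXn2l; [exact: ltW|exact: leqW].
Qed.

(** M^(n+eta) is at most M for M <= 1 and at most M^(n+1) for M > 1. *)
Lemma le_max_powR (M eta : R) n : 0 <= M -> (0 < n)%N -> 0 < eta -> eta <= 1 ->
  M ^+ n * M `^ eta <= Num.max M (M ^+ n.+1).
Proof.
move=> M0 n0 eta0 eta1; rewrite le_max; have [M1|M1] := leP M 1.
  rewrite -[X in _ <= X]mulr1 ler_pM ?exprn_ge0 ?powR_ge0 //.
    by rewrite -[leRHS]expr1 ler_wiXn2l.
  apply: (@le_trans _ _ (1 `^ eta)); last by rewrite powR1.
  by apply: ge0_ler_powR; rewrite ?nnegrE // ltW.
apply/orP; right; rewrite exprSr ler_wpM2l ?exprn_ge0 //.
by apply: ler1_powR => //; exact: ltW.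
Qed.

End Suprema.

(** The power of M is n + 1 where n is the integer part of p, one more than in max(M, M^n): the
    Hoelder remainder of order n contributes M^(n+eta) with 0 < eta <= 1. *)
Theorem proposition28 (R : realType) :
  exists C : R -> R -> R -> R,
  forall (p : R) (V U W : completeNormedModType R)
    (TV : tensor_powers V) (TU : tensor_powers U)
    (X : R -> tseries TV) (beta1 : R -> tseries TV -> U)
    (omega1 : R -> R -> R) (theta1 : R) (gamma : R) (phi : U -> W),
  1 <= p ->
  tensor_compatible TV TU ->
  geometric_rough_path p X ->
  one_form (Num.truncn p) beta1 ->
  control omega1 ->
  1 < theta1 ->
  (slow_norm p X omega1 theta1 beta1 < +oo)%E ->
  p < gamma ->
  Cclass TU gamma phi ->
  let n := Num.truncn p in
  let h := rough_integral X beta1 in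
  let h_sup := sup [set `|h t| | t in [set t : R | 0 <= t <= 1]] in
  let beta := composed_form TU n phi h beta1 in
  let omega := fun s t => omega1 s t + fine (pvarp p X s t) in
  let theta := Num.min theta1 (Num.min (gamma / p) (n.+1%:R / p)) in
  let M := fine (slow_norm p X omega1 theta1 beta1) in
  one_form n beta /\
  (slow_norm p X omega theta beta <=
     (C p theta (omega 0 1)%R)%:E * Cnorm TU gamma phi h_sup
       * (Num.max M (M ^+ n.+1))%:E)%E /\
  (forall t, 0 <= t <= 1 ->
     cvg (riemann_sum X beta t @ mesh_to0 t) /\
     rough_integral X beta t = phi (h t) - phi (h 0)).
Proof.
(* The first summand bounds the coefficients of the form, the second its defect. Adding 1 to
   omega(0,1)^(1/p) gives Q >= 1 and leaves room for scales strictly above every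
   omega(s,t)^(1/p). *)
exists (fun p theta Omega => let n := Num.truncn p in
  (n * (n.+1 ^ n * n`!))%:R + composed_const n theta (Omega `^ p^-1 + 1)).
move=> p V U W TV TU X beta1 omega1 theta1 gamma phi p_ge1 compat [gX [wX wXc pvarX]] beta_E c1 theta1_gt1 slow_fin p_gamma phiC.
move=> n h h_sup beta omega theta M.
have p_gt0 : 0 < p by exact: lt_le_trans p_ge1.
have /andP[n_p p_n] := truncn_itv (ltW p_gt0); rewrite -/n in n_p p_n.
have n_gt0 : (0 < n)%N.
  by case: (n) p_n => //; rewrite ltNge p_ge1.
have gamma_gt0 : 0 < gamma by exact: lt_trans p_gamma.
have [_ c1_ge0 c1_diag c1_add] := c1.
have w_ge0 s t : 0 <= s -> s <= t -> t <= 1 -> 0 <= omega s t.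
  by move=> s0 st t1; rewrite addr_ge0 ?c1_ge0 ?(fine_pvarp_ge0 pvarX).
have w_diag s : 0 <= s -> s <= 1 -> omega s s = 0.
  by move=> s0 s1; rewrite /omega c1_diag // (fine_pvarp_diag wXc pvarX) // addr0.
have w_add s u t : 0 <= s -> s <= u -> u <= t -> t <= 1 -> omega s u + omega u t <= omega s t.
  by move=> s0 su ut t1; rewrite /omega addrACA lerD ?c1_add // (fine_pvarp_superadditive pvarX).
have w1_w s t : 0 <= s -> s <= t -> t <= 1 -> omega1 s t <= omega s t.
  by move=> s0 st t1; rewrite lerDl (fine_pvarp_ge0 pvarX).
(* Continuity of the p-variation is not established: it is small near the diagonal because the
   control of the rough path dominates it. *)
have w_small delta : 0 < delta -> exists2 d : R, 0 < d &
    forall a b, 0 <= a -> a <= b -> b <= 1 -> b - a < d -> omega a b <= delta.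
  move=> d0; have d20 : 0 < delta / 2 by rewrite divr_gt0.
  have [d' d'0 h1] := control_small c1 d20; have [d'' d''0 h2] := control_small wXc d20.
  exists (Num.min d' d''); first by rewrite lt_min d'0.
  move=> a b a0 ab b1; rewrite lt_min => /andP[bd' bd''].
  rewrite [delta]splitr lerD ?h1 //; apply: le_trans (h2 a b a0 ab b1 bd'').
  exact: (fine_pvarp_le pvarX).
have X_norm s t k : 0 <= s -> s <= t -> t <= 1 -> `|increment X s t k| <= (omega s t `^ p^-1) ^+ k.
  move=> s0 st t1; apply: le_trans (increment_norm p_ge1 gX pvarX k s0 st t1) _.
  have v0 := fine_pvarp_ge0 pvarX s0 st t1.
  apply: lerXn2r; rewrite ?nnegrE ?powR_ge0 //; apply: ge0_ler_powR; rewrite ?nnegrE ?w_ge0 //.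
    by rewrite invr_ge0 ltW.
  by rewrite lerDr c1_ge0.
have theta_gt1 : 1 < theta.
  by rewrite !lt_min theta1_gt1 !ltr_pdivlMr // !mul1r p_gamma.
have theta_le : theta <= theta1 by rewrite ge_min lexx.
have rho_min : p * theta <= Num.min gamma n.+1%:R.
  rewrite le_min; apply/andP; split; rewrite mulrC -ler_pdivlMr // !ge_min lexx !orbT //.
have theta_n : p * theta <= n.+1%:R.
  by apply: le_trans rho_min _; rewrite ge_min lexx orbT.
have defect_E s t : 0 <= s -> s < t -> t <= 1 ->
    in_E n (fun x => beta1 t x - shift (beta1 s) (increment X s t) x).
  move=> s0 st t1; have st' := ltW st; have t0 := le_trans s0 st'; have s1 := le_trans st' t1.
  apply: in_ED; first by apply: beta_E.
  apply: in_EN; apply: (@shift_in_E _ _ _ _ _ (omega s t `^ p^-1 + 1)).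
  - by rewrite ltr_pwDr // powR_ge0.
  - by apply: beta_E.
  - exact: increment_grouplike (gX _ s0 s1) (gX _ t0 t1).
  move=> i; apply: le_trans (X_norm s t i s0 st' t1) _.
  by apply: lerXn2r; rewrite ?nnegrE ?addr_ge0 ?powR_ge0 // lerDl.
have M_ge0 : 0 <= M by rewrite fine_ge0 // slow_norm_ge0.
have beta_M := slow_norm_coefs beta_E slow_fin.
have defect_M := slow_norm_defect defect_E slow_fin.
(* The real supremum bounds its elements only if the set is bounded, so a bound of h comes first. *)
have h_r : forall t, 0 <= t -> t <= 1 -> `|h t| <= h_sup.
  apply: le_sup_path; exact: (integral_bounded n_p p_ge1 w_ge0 w_diag w_add w_small c1_ge0 w1_w
    theta_gt1 theta_le theta_n gX X_norm M_ge0 beta_E beta_M defect_M).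
have h_sup_ge0 : 0 <= h_sup by apply: le_trans (h_r 0 (lexx _) ler01).
have nN : (n <= floor_lt gamma)%N.
  have /andP[_ gN] := floor_lt_itv gamma_gt0.
  by rewrite -ltnS -(ltr_nat R) (le_lt_trans n_p) // (lt_le_trans p_gamma).
have [eta [eta_gt0 eta_le1 rho_eta] phi_holder] := Cnorm_holder_le gamma_gt0 phiC h_sup_ge0 nN.
have {}rho_eta := le_trans rho_min rho_eta.
have LE := Cnorm_fin phiC h_sup_ge0.
set L := fine _ in phi_holder LE.
have L_ge0 : 0 <= L by rewrite fine_ge0 // Cnorm_ge0.
have phi_L u l : `|u| <= h_sup -> (l <= n)%N -> linear_bounded L (frechet phi (TU := TU) (l := l) u).
  by move=> ur ln; apply: Cnorm_bounded => //; exact: leq_trans nN.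
set Mh := Num.max M _.
have MMh i : (1 <= i <= n)%N -> M ^+ i <= Mh by exact: le_max_pow.
have M_eta : M ^+ n * M `^ eta <= Mh by exact: le_max_powR.
have LM_ge0 : 0 <= L * Mh by rewrite mulr_ge0 // le_max M_ge0.
have bE : one_form n beta.
  by move=> t t0 t1; exact: (composed_form_in_E M_ge0 beta_E beta_M compat h_r L_ge0 MMh phi_L).
split => //; split.
  rewrite -LE -!EFinM.
  have -> : ((n * (n.+1 ^ n * n`!))%:R + composed_const n theta (omega 0 1 `^ p^-1 + 1)) * L * Mh =
     (n * (n.+1 ^ n * n`!))%:R * (L * Mh) + composed_const n theta (omega 0 1 `^ p^-1 + 1) * (L * Mh).
    by rewrite -mulrA mulrDl.
  apply: slow_norm_le => //.
  - move=> s t s0 st t1.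
    exact: (composed_defect_in_E p_ge1 w_ge0 w_add gX X_norm M_ge0 beta_E beta_M compat h_r L_ge0 MMh phi_L s0 st t1).
  - exact: mulr_ge0.
  - by apply: mulr_ge0 => //; rewrite composed_const_ge0 // addr_ge0 ?powR_ge0.
  - move=> t k; exact: (composed_form_coefs M_ge0 beta_E beta_M compat h_r L_ge0 MMh phi_L).
  move=> s t k; exact: (composed_defect_coefs n_gt0 n_p p_ge1 w_ge0 w_diag w_add w_small c1_ge0 w1_w
    theta_gt1 theta_le theta_n gX X_norm M_ge0 beta_E beta_M defect_M compat phiC.1 nN h_r L_ge0 MMh
    eta_gt0 eta_le1 rho_eta M_eta phi_L phi_holder).
move=> t /andP[t0 t1].
have hc := composed_form_cvg n_gt0 n_p p_ge1 w_ge0 w_diag w_add w_small c1_ge0 w1_w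
    theta_gt1 theta_le theta_n gX X_norm M_ge0 beta_E beta_M defect_M compat phiC.1 nN h_r L_ge0 MMh
    eta_gt0 eta_le1 rho_eta M_eta phi_L phi_holder t0 t1.
split; first by apply/cvg_ex; exists (phi (h t) - phi (h 0)).
have pF := mesh_to0_proper t0; apply: (cvg_lim _ hc); exact: norm_hausdorff.
Qed.
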